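(* Let $A$ be a Noetherian ring, and consider the following conditions: (1) $A$ is a weakly Arf ring. (2) For every $M \in \operatorname{Max} \Lambda(A)$, $M:M$ is a weakly Arf ring and $M^2 = aM$ for some $a \in M$. (3) For every blow-up chain $A = A_0 \subseteq A_1 \subseteq \cdots \subseteq A_n \subseteq \cdots \subseteq \overline{A}$, $A_n$ is a weakly Arf ring for every $n \ge 0$. (4) For every blow-up chain $A = A_0 \subseteq A_1 \subseteq \cdots \subseteq A_n \subseteq \cdots \subseteq \overline{A}$, and for every $n \ge 0$ and $N \in \operatorname{Max} \Lambda (A_n)$, $N^2 = bN$ for some $b \in N$. Then the implications $(1) \Leftrightarrow (2) \Leftrightarrow (3) \Rightarrow (4)$ hold. If $\dim A=1$, or if $A_{\mathfrak p}$ is quasi-unmixed for every $\mathfrak p \in \operatorname{Spec} A$, then the implication $(4) \Rightarrow (1)$ holds.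
   Context: Rings are commutative. For a ring $A$: $Q(A)$ is the total ring of fractions, $\overline{A}$ the integral closure of $A$ in $Q(A)$, $W(A)$ the set of non-zerodivisors on $A$; for an ideal $I$ of $A$, $\overline{I}$ is its integral closure in $A$. For $A$-submodules $X,Y$ of $Q(A)$, $X:Y=\{a\in Q(A)\mid aY\subseteq X\}$. For an ideal $I$ containing a non-zerodivisor, $A^I=\bigcup_{n\ge 0}[I^n:I^n]\subseteq Q(A)$. $\mu_A(M)$ is the number of elements in a minimal system of generators of $M$. $A$ is weakly Arf if $yz/x\in A$ whenever $x,y,z\in A$ with $x\in W(A)$ and $y/x,z/x\in\overline{A}$. $\Lambda(A)=\{\overline{(x)}\mid x\in W(A)\}$, and $\operatorname{Max}\Lambda(A)$ is the set of maximal elements, with respect to inclusion, of the set of all proper ideals of $A$ belonging to $\Lambda(A)$. Blow-up chains: for a Noetherian ring $A$, if $A$ is integrally closed (i.e. $A=\overline A$), put $A_1=\overline{A}$; if $A\neq\overline{A}$, then there exists $M\in\operatorname{Max}\Lambda(A)$ with $\mu_A(M)\ge 2$, and one puts $A_1=A^M$ for some choice of such an $M$. Set $A_0=A$ and recursively $A_n=(A_{n-1})_1$ for $n\ge1$ (with a choice at each step). Any chain $A=A_0\subseteq A_1\subseteq\cdots\subseteq A_n\subseteq\cdots\subseteq\overline{A}$ so obtained is called here a blow-up chain; it depends on the choices made. A Noetherian local ring $(A,\mathfrak m)$ is quasi-unmixed if $\dim\widehat{A}/Q=\dim A$ for every minimal prime $Q$ of the $\mathfrak m$-adic completion $\widehat{A}$.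 *)

(* Defs.v *)
From HB Require Import structures.
From mathcomp Require Import all_boot all_order all_algebra.
From mathcomp Require Import generic_quotient ring_quotient ring.
From mathcomp Require Import boolp classical_sets functions.

Set Implicit Arguments.
Unset Strict Implicit.
Unset Printing Implicit Defensive.

Import GRing.Theory.
Local Open Scope ring_scope.
Local Open Scope quotient_scope.
Local Open Scope classical_set_scope.

(* Rings are the nonzero commutative rings [comNzRingType]; an [idealr A] is a
   proper ideal of A and a [prime_idealr A] is a prime ideal of A.            *)

(* The condition [0 \notin S] excludes exactly the zero localization. *)
Record multSet (A : comNzRingType) := MultSet {
  mset :> {pred A};
  mset1 : 1 \in mset;
  msetM : {in mset &, forall s t, s * t \in mset};
  mset0 : 0 \notin mset }.

Module Localization.
Section Localization.
Variables (A : comNzRingType) (S : multSet A).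

Local Notation dom := (A * {s : A | s \in S})%type.

Implicit Types x y z : dom.

Lemma domP x : sval x.2 \in S. Proof. exact: valP. Qed.

Definition one_den : {s : A | s \in S} := exist _ 1 (mset1 S).
Definition mul_den (s t : {s : A | s \in S}) : {s : A | s \in S} :=
  exist _ (sval s * sval t) (msetM (valP s) (valP t)).

Definition equiv x y : bool :=
  `[< exists2 u, u \in S & u * (x.1 * sval y.2 - y.1 * sval x.2) = 0 >].

Lemma equiv_refl : reflexive equiv.
Proof. by move=> x; apply/asboolP; exists 1; [exact: mset1 | rewrite subrr mulr0]. Qed.

Lemma equiv_sym : symmetric equiv.
Proof.
by move=> x y; apply/asboolP/asboolP => -[u Su e]; exists u => //;
  rewrite -[RHS]oppr0 -[X in _ = - X]e; ring.
Qed.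

Lemma equiv_trans : transitive equiv.
Proof.
move=> y x z /asboolP[u Su xy] /asboolP[v Sv yz]; apply/asboolP.
exists (u * v * sval y.2); first by rewrite !(msetM, domP).
have -> : u * v * sval y.2 * (x.1 * sval z.2 - z.1 * sval x.2) =
  v * sval z.2 * (u * (x.1 * sval y.2 - y.1 * sval x.2)) +
  u * sval x.2 * (v * (y.1 * sval z.2 - z.1 * sval y.2)) by ring.
by rewrite xy yz !mulr0 addr0.
Qed.

Canonical equiv_equiv := EquivRel equiv equiv_refl equiv_sym equiv_trans.

Definition type := {eq_quot equiv}.

#[export]
HB.instance Definition _ : EqQuotient _ equiv type := EqQuotient.on type.
#[export]
HB.instance Definition _ := Choice.on type.

Definition frac (a : A) (s : {s : A | s \in S}) : type := \pi_type (a, s).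

Lemma frac_eq a s b t : frac a s = frac b t <->
  exists2 u, u \in S & u * (a * sval t - b * sval s) = 0.
Proof. by split=> [/eqmodP/asboolP|e]; last apply/eqmodP/asboolP. Qed.

Lemma fracP (q : type) : exists a s, q = frac a s.
Proof. by elim/quotW: q => -[a s]; exists a, s. Qed.

Definition addf x y : dom :=
  (x.1 * sval y.2 + y.1 * sval x.2, mul_den x.2 y.2).
Definition mulf x y : dom := (x.1 * y.1, mul_den x.2 y.2).
Definition oppf x : dom := (- x.1, x.2).

Definition add := lift_op2 type addf.
Definition mul := lift_op2 type mulf.
Definition opp := lift_op1 type oppf.

Lemma repr_frac x : exists2 u, u \in S &
  u * (x.1 * sval (repr (\pi_type x)).2 - (repr (\pi_type x)).1 * sval x.2) = 0.
Proof. by have /eqmodP/asboolP := esym (reprK (\pi_type x)). Qed.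

Lemma pi_add : {morph \pi : x y / addf x y >-> add x y}.
Proof.
move=> x y; unlock add; apply/eqmodP/asboolP.
have [u Su ex] := repr_frac x; have [v Sv ey] := repr_frac y.
move: (repr (\pi_type x)) (repr (\pi_type y)) ex ey => x' y' ex ey.
exists (u * v); first exact: msetM.
rewrite /=; transitivity
  (v * sval y.2 * sval y'.2 * (u * (x.1 * sval x'.2 - x'.1 * sval x.2)) +
   u * sval x.2 * sval x'.2 * (v * (y.1 * sval y'.2 - y'.1 * sval y.2))).
  by ring.
by rewrite ex ey !mulr0 addr0.
Qed.

Lemma pi_mul : {morph \pi : x y / mulf x y >-> mul x y}.
Proof.
move=> x y; unlock mul; apply/eqmodP/asboolP.
have [u Su ex] := repr_frac x; have [v Sv ey] := repr_frac y.
move: (repr (\pi_type x)) (repr (\pi_type y)) ex ey => x' y' ex ey.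
exists (u * v); first exact: msetM.
rewrite /=; transitivity
  (v * y.1 * sval y'.2 * (u * (x.1 * sval x'.2 - x'.1 * sval x.2)) +
   u * x'.1 * sval x.2 * (v * (y.1 * sval y'.2 - y'.1 * sval y.2))).
  by ring.
by rewrite ex ey !mulr0 addr0.
Qed.

Lemma pi_opp : {morph \pi : x / oppf x >-> opp x}.
Proof.
move=> x; unlock opp; apply/eqmodP/asboolP.
have [u Su ex] := repr_frac x; move: (repr _) ex => x' ex.
by exists u => //=; rewrite -[RHS]oppr0 -[X in _ = - X]ex; ring.
Qed.

Lemma fracD a s b t :
  add (frac a s) (frac b t) = frac (a * sval t + b * sval s) (mul_den s t).
Proof. by rewrite /frac -pi_add. Qed.

Lemma fracM a s b t : mul (frac a s) (frac b t) = frac (a * b) (mul_den s t).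
Proof. by rewrite /frac -pi_mul. Qed.

Lemma fracN a s : opp (frac a s) = frac (- a) s.
Proof. by rewrite /frac -pi_opp. Qed.

Lemma frac_eqW a s b t : a * sval t = b * sval s -> frac a s = frac b t.
Proof.
move=> e; apply/frac_eq; exists 1; first exact: mset1.
by rewrite e subrr mulr0.
Qed.

Definition zero : type := frac 0 one_den.
Definition one : type := frac 1 one_den.

Lemma addA : associative add.
Proof.
move=> x y z; have [a [s ->]] := fracP x; have [b [t ->]] := fracP y.
have [c [u ->]] := fracP z; rewrite !fracD; apply: frac_eqW => /=; ring.
Qed.

Lemma addC : commutative add.
Proof.
move=> x y; have [a [s ->]] := fracP x; have [b [t ->]] := fracP y.
rewrite !fracD; apply: frac_eqW => /=; ring.
Qed.

Lemma add0 : left_id zero add.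
Proof.
by move=> x; have [a [s ->]] := fracP x; rewrite fracD; apply: frac_eqW => /=; ring.
Qed.

Lemma addN : left_inverse zero opp add.
Proof.
move=> x; have [a [s ->]] := fracP x.
rewrite fracN fracD; apply: frac_eqW => /=; ring.
Qed.

#[export]
HB.instance Definition _ := GRing.isZmodule.Build type addA addC add0 addN.

Lemma mulA : associative mul.
Proof.
move=> x y z; have [a [s ->]] := fracP x; have [b [t ->]] := fracP y.
have [c [u ->]] := fracP z; rewrite !fracM; apply: frac_eqW => /=; ring.
Qed.

Lemma mulC : commutative mul.
Proof.
move=> x y; have [a [s ->]] := fracP x; have [b [t ->]] := fracP y.
rewrite !fracM; apply: frac_eqW => /=; ring.
Qed.

Lemma mul1 : left_id one mul.
Proof.
by move=> x; have [a [s ->]] := fracP x; rewrite fracM; apply: frac_eqW => /=; ring.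
Qed.

Lemma mulD : left_distributive mul add.
Proof.
move=> x y z; have [a [s ->]] := fracP x; have [b [t ->]] := fracP y.
have [c [u ->]] := fracP z; rewrite !(fracD, fracM).
apply: frac_eqW => /=; ring.
Qed.

Lemma one_neq0 : one != zero.
Proof.
apply/eqP => /frac_eq[u Su] /=; rewrite mul0r subr0 !mulr1 => u0.
by move: (mset0 S); rewrite -u0 Su.
Qed.

#[export]
HB.instance Definition _ :=
  GRing.Zmodule_isComNzRing.Build type mulA mulC mul1 mulD one_neq0.

Definition unit : {pred type} := [pred x | `[< exists y : type, y * x = 1 >]].
Definition inv (x : type) : type := xget x [set y | y * x = 1].

Lemma mulV : {in unit, left_inverse 1 inv *%R}.
Proof. by move=> x /asboolP[y yx]; rewrite /inv; case: xgetP => // /(_ y). Qed.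

Lemma unitPl (x y : type) : y * x = 1 -> unit x.
Proof. by move=> yx; apply/asboolP; exists y. Qed.

Lemma inv_out : {in [predC unit], inv =1 id}.
Proof.
move=> x /= /negP xu; rewrite /inv; case: xgetP => // y _ yx.
by case: xu; exact: unitPl yx.
Qed.

#[export]
HB.instance Definition _ :=
  GRing.ComNzRing_hasMulInverse.Build type mulV unitPl inv_out.

Definition tofrac (a : A) : type := frac a one_den.

Lemma tofrac_is_zmod_morphism : zmod_morphism tofrac.
Proof.
move=> a b; rewrite -[LHS]/(frac _ _) -[RHS]/(add (frac _ _) (opp (frac _ _))).
by rewrite fracN fracD; apply: frac_eqW => /=; ring.
Qed.

#[export]
HB.instance Definition _ :=
  GRing.isZmodMorphism.Build A type tofrac tofrac_is_zmod_morphism.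

Lemma tofrac_is_monoid_morphism : monoid_morphism tofrac.
Proof.
split=> // a b; rewrite -[RHS]/(mul (frac _ _) (frac _ _)) fracM.
by apply: frac_eqW => /=; ring.
Qed.

#[export]
HB.instance Definition _ :=
  GRing.isMonoidMorphism.Build A type tofrac tofrac_is_monoid_morphism.

Lemma tofrac_unit s : s \in S -> tofrac s \is a GRing.unit.
Proof.
move=> Ss; apply/asboolP; exists (frac 1 (exist _ s Ss)).
rewrite -[LHS]/(mul _ (frac _ _)) fracM; apply: frac_eqW => /=; ring.
Qed.

Lemma fracE a s : frac a s = tofrac a / tofrac (sval s).
Proof.
apply: (mulIr (tofrac_unit (valP s))); rewrite divrK ?tofrac_unit ?(valP s)//.
rewrite -[LHS]/(mul _ (frac _ _)) fracM; apply: frac_eqW => /=; ring.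
Qed.

End Localization.
Module Exports. HB.reexport. End Exports.
End Localization.
Export Localization.Exports.

Notation localization := Localization.type.

Section TotalFractions.
Variable A : comNzRingType.

Definition regular_elt : {pred A} :=
  [pred x | `[< forall y : A, x * y = 0 -> y = 0 >]].

Lemma regular_elt1 : 1 \in regular_elt.
Proof. by apply/asboolP => y; rewrite mul1r. Qed.

Lemma regular_eltM : {in regular_elt &, forall s t, s * t \in regular_elt}.
Proof.
move=> s t /asboolP rs /asboolP rt; apply/asboolP => y.
by rewrite -mulrA => /rs/rt.
Qed.

Lemma regular_elt0 : 0 \notin regular_elt.
Proof.
apply/negP => /asboolP/(_ 1 (mul0r _))/eqP; by rewrite oner_eq0.
Qed.

Definition regular_mset := MultSet regular_elt1 regular_eltM regular_elt0.

Definition total_frac := localization regular_mset.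

HB.instance Definition _ := GRing.ComUnitRing.on total_frac.

Definition base_ring : set total_frac :=
  range (@Localization.tofrac A regular_mset).

End TotalFractions.

Arguments base_ring A : clear implicits.

Section LocalizationAtPrime.
Variables (A : comNzRingType) (p : prime_idealr A).

Definition prime_compl : {pred A} := [predC p].

Lemma prime_compl1 : 1 \in prime_compl.
Proof. by rewrite !inE idealr1. Qed.

Lemma prime_complM : {in prime_compl &, forall s t, s * t \in prime_compl}.
Proof. by move=> s t; rewrite !inE prime_idealrM negb_or => -> ->. Qed.

Lemma prime_compl0 : 0 \notin prime_compl.
Proof. by rewrite !inE idealr0. Qed.

Definition prime_mset := MultSet prime_compl1 prime_complM prime_compl0.

Definition localization_at := localization prime_mset.

HB.instance Definition _ := GRing.ComUnitRing.on localization_at.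

End LocalizationAtPrime.

Section Submodules.
Variable Q : comNzRingType.
Implicit Types (B I J X Y M : set Q) (s : seq Q).

Definition smul I J : set Q :=
  [set z | exists2 s : seq (Q * Q),
     forall p, p \in s -> I p.1 /\ J p.2 & z = \sum_(p <- s) p.1 * p.2].

(* The power I^n of an ideal I of B, with I^0 = B. *)
Definition spow B I n : set Q := iter n (smul I) B.

Definition scale (a : Q) X : set Q := [set a * x | x in X].

Definition colon X Y : set Q := [set a | scale a Y `<=` X].

Definition span B s : set Q :=
  [set x | exists2 c : nat -> Q, forall i, B (c i) &
     x = \sum_(i < size s) c i * s`_i].

Definition generated_by B M n : Prop :=
  exists2 s, size s = n & span B s = M.

(* The least cardinality of a system of generators of M over B; it is 0 by
   convention when M is not finitely generated.                               *)
Definition mu B M : nat :=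
  xget 0%N [set n | generated_by B M n /\
                    forall k, generated_by B M k -> (n <= k)%N].

Definition nonzerodivisors B : set Q :=
  [set x | B x /\ forall y, B y -> x * y = 0 -> y = 0].

Definition integral_elements B : set Q :=
  [set q | exists2 p : {poly Q}, p \is monic /\ (forall i, B p`_i) & root p q].

Definition ideal_integral_closure B I : set Q :=
  [set x | B x /\ exists n, (0 < n)%N /\ exists2 a : nat -> Q,
     forall i, (0 < i <= n)%N -> spow B I i (a i) &
     x ^+ n + \sum_(1 <= i < n.+1) a i * x ^+ (n - i) = 0].

Definition blowup B I : set Q :=
  \bigcup_n colon (spow B I n) (spow B I n).

Definition Lambda B : set (set Q) :=
  [set ideal_integral_closure B (scale x B) | x in nonzerodivisors B].

Definition MaxLambda B : set (set Q) :=
  [set M | [/\ Lambda B M, M <> B &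
     forall N, Lambda B N -> N <> B -> M `<=` N -> N = M]].

End Submodules.

(* From here on B is a ring between A (embedded as [base_ring A]) and
   Q = [total_frac A]. Such a B has the same total ring of fractions as A, by
   [regular_unit] and [intermediate_frac] below, so that the integral closure
   of B in Q(B) is [integral_elements B].                                     *)

Section WeaklyArf.
Variable A : comNzRingType.
Local Notation Q := (total_frac A).
Implicit Types (B M : set Q) (C : nat -> set Q).

Lemma regular_unit B (x : Q) :
  base_ring A `<=` B -> nonzerodivisors B x -> x \is a GRing.unit.
Proof.
move=> AB [_ rx]; have [a [s xE]] := Localization.fracP x.
rewrite xE Localization.fracE unitrM unitrV.
rewrite (Localization.tofrac_unit (valP s)) andbT.
apply: Localization.tofrac_unit; apply/asboolP => c ac0.
have : Localization.tofrac (regular_mset A) c = 0.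
  apply: rx; first by apply: AB; exists c.
  by rewrite xE Localization.fracE mulrAC -rmorphM ac0 rmorph0 mul0r.
move=> /Localization.frac_eq[u /asboolP ru] /=.
by rewrite mul0r subr0 mulr1 => /ru.
Qed.

Lemma intermediate_frac B (x : Q) : base_ring A `<=` B ->
  exists b s, [/\ B b, nonzerodivisors B s & x = b / s].
Proof.
move=> AB; have [a [s ->]] := Localization.fracP x.
exists (Localization.tofrac _ a), (Localization.tofrac _ (sval s)).
split; [by apply: AB; exists a | split; first by apply: AB; exists (sval s) |
  exact: Localization.fracE].
have us := Localization.tofrac_unit (valP s).
by move=> y _ sy; rewrite -[y](mulKr us) sy mulr0.
Qed.

Definition weakly_Arf B : Prop :=
  forall x y z, nonzerodivisors B x -> B y -> B z ->
    integral_elements B (y / x) -> integral_elements B (z / x) ->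
    B (y * z / x).

Definition blowup_step B B1 : Prop :=
  (B = integral_elements B /\ B1 = integral_elements B) \/
  (B <> integral_elements B /\
   exists M, [/\ MaxLambda B M, (2 <= mu B M)%N & B1 = blowup B M]).

Definition blowup_chain C : Prop :=
  C 0%N = base_ring A /\ forall n, blowup_step (C n) (C n.+1).

Definition principal_reduction M : Prop :=
  exists2 a, M a & smul M M = scale a M.

End WeaklyArf.

Section Dimension.
Variable A : comNzRingType.

Definition noetherian : Prop :=
  forall I : idealr A, exists s : seq A, span setT s = [set` I].

Definition prime_chain (n : nat) (p : nat -> prime_idealr A) : Prop :=
  forall i, (i < n)%N -> [set` p i] `<` [set` p i.+1].

(* [None] stands for an infinite dimension. *)
Definition krull_dim : option nat :=
  xget None [set d | exists n, [/\ d = Some n, exists p, prime_chain n p &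
                       forall k p, prime_chain k p -> (k <= n)%N]].

Definition minimal_prime (P : prime_idealr A) : Prop :=
  forall P' : prime_idealr A, {subset P' <= P} -> {subset P <= P'}.

Definition maximal_ideal (m : idealr A) : Prop :=
  forall J : idealr A, {subset m <= J} -> {subset J <= m}.

Definition local_ring (m : idealr A) : Prop :=
  maximal_ideal m /\ forall n : idealr A, maximal_ideal n -> n =i m.

End Dimension.

Module Completion.
Section Completion.
Variables (A : comNzRingType) (m : idealr A).

Definition adic (k : nat) : set A := spow setT [set` m] k.

Lemma adic0 k : adic k 0.
Proof. by case: k => // k; exists [::]; rewrite ?big_nil. Qed.

Lemma adicD k x y : adic k x -> adic k y -> adic k (x + y).
Proof.
case: k => // k [s sP ->] [t tP ->]; exists (s ++ t); last by rewrite big_cat.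
by move=> p; rewrite mem_cat => /orP[/sP|/tP].
Qed.

Lemma adicM k a x : adic k x -> adic k (a * x).
Proof.
case: k => // k [s sP ->]; exists [seq (a * p.1, p.2) | p <- s].
  move=> _ /mapP[p /sP[/= mp1 kp2] ->] /=; split=> //.
  exact: idealMr.
by rewrite big_map mulr_sumr; apply: eq_bigr => p _; rewrite mulrA.
Qed.

Lemma adicB k x y : adic k x -> adic k y -> adic k (x - y).
Proof. by move=> kx ky; apply: adicD => //; rewrite -mulN1r; exact: adicM. Qed.

Lemma adic1_proper : ~ adic 1 1.
Proof.
case=> s sP e; have /negP[] := negbT (idealr1 m).
rewrite e big_seq; apply: rpred_sum => p /sP[/= mp _].
by rewrite mulrC idealMr.
Qed.

Definition cauchy : {pred (nat -> A)} :=
  [pred x : nat -> A | `[< forall k, exists N : nat, forall i j,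
     (N <= i)%N -> (N <= j)%N -> adic k (x i - x j) >]].

Lemma cauchy_subring_closed : subring_closed cauchy.
Proof.
split.
- by apply/asboolP => k; exists 0%N => i j _ _; rewrite subrr; exact: adic0.
- move=> x y /asboolP cx /asboolP cy; apply/asboolP => k.
  have [N hN] := cx k; have [N' hN'] := cy k; exists (maxn N N') => i j.
  rewrite !geq_max => /andP[Ni N'i] /andP[Nj N'j].
  rewrite -[X in adic k X]/(x i - y i - (x j - y j)).
  have -> : x i - y i - (x j - y j) = x i - x j - (y i - y j) by ring.
  by apply: adicB; [exact: hN | exact: hN'].
- move=> x y /asboolP cx /asboolP cy; apply/asboolP => k.
  have [N hN] := cx k; have [N' hN'] := cy k; exists (maxn N N') => i j.
  rewrite !geq_max => /andP[Ni N'i] /andP[Nj N'j].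
  rewrite -[X in adic k X]/(x i * y i - x j * y j).
  have -> : x i * y i - x j * y j = y i * (x i - x j) + x j * (y i - y j).
    by ring.
  by apply: adicD; apply: adicM; [exact: hN | exact: hN'].
Qed.

#[export]
HB.instance Definition _ :=
  GRing.isSubringClosed.Build (nat -> A) cauchy cauchy_subring_closed.

Record cauchy_seq := CauchySeq
  { cseq :> nat -> A; cauchy_seqP : cseq \in cauchy }.

#[export]
HB.instance Definition _ := [isSub for cseq].
#[export]
HB.instance Definition _ := [Choice of cauchy_seq by <:].
#[export]
HB.instance Definition _ :=
  [SubChoice_isSubComNzRing of cauchy_seq by <:].

Definition null : {pred cauchy_seq} :=
  [pred x : cauchy_seq | `[< forall k, exists N : nat, forall i,
     (N <= i)%N -> adic k (x i) >]].

Lemma null_idealr_closed : idealr_closed null.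
Proof.
split.
- by apply/asboolP => k; exists 0%N => i _; exact: adic0.
- apply/negP => /asboolP/(_ 1%N)[N /(_ N (leqnn N))].
  exact: adic1_proper.
- move=> a x y /asboolP nx /asboolP ny; apply/asboolP => k.
  have [N hN] := nx k; have [N' hN'] := ny k; exists (maxn N N') => i.
  rewrite geq_max => /andP[Ni N'i].
  rewrite -[X in adic k X]/(a i * x i + y i).
  by apply: adicD; [apply: adicM; exact: hN | exact: hN'].
Qed.

#[export]
HB.instance Definition _ :=
  isIdealr.Build cauchy_seq null null_idealr_closed.

Definition type := {ideal_quot null}.

#[export]
HB.instance Definition _ := GRing.ComNzRing.on type.

End Completion.
Module Exports. HB.reexport. End Exports.
End Completion.
Export Completion.Exports.

Notation completion := Completion.type.

Definition quasi_unmixed (A : comNzRingType) : Prop :=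
  noetherian A /\ exists2 m : idealr A, local_ring m &
    forall P : prime_idealr (completion m), minimal_prime P ->
      krull_dim {ideal_quot P} = krull_dim A.

(* Main.v *)
(* Write cl(x) for the integral closure of xA, that is the y in A with y/x
   integral. Being weakly Arf means cl(x)^2 = x cl(x) for all regular x, and then
   M : M = M/x for M = cl(x); this gives (1) => (2), (3), (4). Conversely, if
   cl(x) lies in a maximal M with M^2 = aM, then yz/x is in A as soon as
   (y/a)(z/a)/(x/a) is in M : M = M/a, which gives (2) => (1). Iterating this along
   a blow-up chain gives (4) => (1) if the process stops, that is if the number n of
   nonunit factors in x = a_1 ... a_n x', with all factors in a finite extension B of
   A inside Q(A), is bounded independently of B.

   Count lengths after localization at the minimal primes of x: these are finite and
   multiplicative, and the length of B/xB is that of A/xA, so it suffices that a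
   factor a of x that is not a unit of B stays a nonunit over some minimal prime of x.
   Otherwise a minimal prime p of aB \cap A has height at least 2; this is excluded
   if dim A = 1. If L = A_p is quasi-unmixed, then B_p is one-dimensional at its
   maximal ideals containing a, and these are split off from the other ones by an
   idempotent e of the completion of B_p. If d is a common denominator of B, then
   de is a non-nilpotent element of the completion of L, and modulo its annihilator
   the maximal ideal is the radical of a principal ideal. So a minimal prime of the
   completion that does not contain de has a quotient of dimension at most 1, whereas
   L has dimension at least 2. *)

Require Import Defs.
From HB Require Import structures.
From mathcomp Require Import all_boot all_order all_algebra.
From mathcomp Require Import generic_quotient ring_quotient ring.
From mathcomp Require Import boolp classical_sets.
(* Again, since [all_algebra] shadows [span]. *)
Require Import Defs.

Set Implicit Arguments.
Unset Strict Implicit.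
Unset Printing Implicit Defensive.

Import GRing.Theory.
Local Open Scope ring_scope.
Local Open Scope quotient_scope.
Local Open Scope classical_set_scope.

(** * Submodules and noetherian rings *)

(** The ring changes at every blow-up while [x] stays in [A], so the bound on the number of nonunit
    factors must not depend on [B]; hence lengths are taken over [A]. Only upper bounds occur, so no
    length is ever defined: [lenle] bounds the steps of chains, and localization at p is expressed
    by multipliers outside p. The completion of [B_p] is not constructed either. Approximate
    idempotents [e_n] of [B_p] are multiplied by the common denominator d: for b in [B_p] the
    elements [d e_n b] come from L and converge in the completion of L. The limit for b = 1 is the
    element de of the overview. The limits for the generators b of [B_p] span a finitely generated
    module, on which Nakayama's lemma produces the elements that annihilate de. *)

Lemma ex_sequence (T : Type) (R : T -> T -> Prop) (x0 : T) :
  (forall x, exists y, R x y) ->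
  exists2 u : nat -> T, u 0%N = x0 & forall n, R (u n) (u n.+1).
Proof.
move=> /choice[g gP]; by exists (fun n => iter n g x0).
Qed.

Section Submodules.
Variables (A E : comNzRingType) (f : {rmorphism A -> E}).
Implicit Types (X Y Z : set E) (I : set A) (s t : seq E) (a b c : A) (u v w : E).

Definition submod X :=
  [/\ X 0, forall u v, X u -> X v -> X (u + v) & forall a u, X u -> X (f a * u)].

(** The coefficient set [I] is a parameter: [setT] gives the span over [A], and the powers of an
    ideal m give the submodules [m^n B] of the adic filtration. *)
Fixpoint lin I s : set E :=
  if s is g :: s' then
    [set u | exists a v, [/\ I a, lin I s' v & u = f a * g + v]]
  else [set 0].

Lemma submodN X u : submod X -> X u -> X (- u).
Proof. by case=> _ _ XM /(XM (-1)); rewrite rmorphN1 mulN1r. Qed.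

Lemma submodB X u v : submod X -> X u -> X v -> X (u - v).
Proof. by move=> sX Xu /(submodN sX); case: sX => _ + _; apply. Qed.

Lemma submod_sum X (T : Type) (r : seq T) (P : pred T) (F : T -> E) :
  submod X -> (forall i, P i -> X (F i)) -> X (\sum_(i <- r | P i) F i).
Proof. by case=> X0 XD _ XF; apply: big_ind. Qed.

Lemma submodI X Y : submod X -> submod Y -> submod (X `&` Y).
Proof.
move=> [X0 XD XM] [Y0 YD YM]; split=> //.
- by move=> u v [Xu Yu] [Xv Yv]; split; [exact: XD | exact: YD].
- by move=> a u [Xu Yu]; split; [exact: XM | exact: YM].
Qed.

Definition addm X Y : set E := [set w | exists u v, [/\ X u, Y v & w = u + v]].

Lemma submod_add X Y : submod X -> submod Y -> submod (addm X Y).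
Proof.
move=> [X0 XD XM] [Y0 YD YM]; split.
- by exists 0, 0; split=> //; rewrite addr0.
- move=> _ _ [u [v [Xu Yv ->]]] [u' [v' [Xu' Yv' ->]]].
  by exists (u + u'), (v + v'); split; [exact: XD | exact: YD | ring].
- move=> a _ [u [v [Xu Yv ->]]].
  by exists (f a * u), (f a * v); split; [exact: XM | exact: YM | ring].
Qed.

Lemma addm_subl X Y : submod Y -> X `<=` addm X Y.
Proof. by move=> [Y0 _ _] u Xu; exists u, 0; rewrite addr0. Qed.

Lemma addm_subr X Y : submod X -> Y `<=` addm X Y.
Proof. by move=> [X0 _ _] u Yu; exists 0, u; rewrite add0r. Qed.

Lemma addmSl X X' Y : X `<=` X' -> addm X Y `<=` addm X' Y.
Proof. by move=> XX' _ [u [v [/XX' Xu Yv ->]]]; exists u, v. Qed.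

Lemma addm_min X Y Z : submod Z -> X `<=` Z -> Y `<=` Z -> addm X Y `<=` Z.
Proof. by move=> [_ ZD _] XZ YZ _ [u [v [/XZ ? /YZ ? ->]]]; exact: ZD. Qed.

Lemma submod_scale X (v : E) : submod X -> submod (scale v X).
Proof.
move=> [X0 XD XM]; split; first by exists 0 => //; rewrite mulr0.
- by move=> _ _ [u Xu <-] [w Xw <-]; exists (u + w); [exact: XD | rewrite mulrDr].
- by move=> a _ [u Xu <-]; exists (f a * u); [exact: XM | rewrite mulrCA].
Qed.

Lemma submod_cyclic (v : E) : submod [set w | exists a, w = f a * v].
Proof.
split; first by exists 0; rewrite rmorph0 mul0r.
- by move=> _ _ [a ->] [b ->]; exists (a + b); rewrite rmorphD mulrDl.
- by move=> a _ [b ->]; exists (a * b); rewrite rmorphM mulrA.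
Qed.

Lemma submod_range : submod (range f).
Proof.
split; first by exists 0 => //; rewrite rmorph0.
- by move=> _ _ [a _ <-] [b _ <-]; exists (a + b) => //; rewrite rmorphD.
- by move=> a _ [b _ <-]; exists (a * b) => //; rewrite rmorphM.
Qed.

Lemma submod0 : submod [set 0].
Proof.
by split=> [//|_ _ -> ->|a _ ->] /=; rewrite ?addr0 ?mulr0.
Qed.

Lemma lin0 I s : I 0 -> lin I s 0.
Proof.
by move=> I0; elim: s => //= g s IH; exists 0, 0; rewrite rmorph0 mul0r addr0.
Qed.

Lemma linD I s u v : (forall a b, I a -> I b -> I (a + b)) ->
  lin I s u -> lin I s v -> lin I s (u + v).
Proof.
move=> ID; elim: s u v => [|g s IH] u v /=; first by move=> -> ->; rewrite addr0.
move=> [a [u' [Ia su ->]]] [b [v' [Ib sv ->]]].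
exists (a + b), (u' + v'); split; [exact: ID | exact: IH | rewrite rmorphD; ring].
Qed.

Lemma linM I (J : set A) s a u : (forall b, I b -> J (a * b)) ->
  lin I s u -> lin J s (f a * u).
Proof.
move=> IM; elim: s u => [|g s IH] u /=; first by move=> ->; rewrite mulr0.
move=> [b [v [Ib sv ->]]]; exists (a * b), (f a * v).
by split; [exact: IM | exact: IH | rewrite rmorphM; ring].
Qed.

Lemma lin_sub I (J : set A) s : I `<=` J -> lin I s `<=` lin J s.
Proof.
move=> IJ; elim: s => //= g s IH _ [a [v [/IJ Ia /IH sv ->]]].
by exists a, v.
Qed.

Lemma lin_gen I s a g : I 0 -> I a -> g \in s -> lin I s (f a * g).
Proof.
move=> I0 Ia; elim: s => // h s IH; rewrite inE => /orP[/eqP <-|/IH sg] /=.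
  by exists a, 0; split=> //; [exact: lin0 | rewrite addr0].
by exists 0, (f a * g); rewrite rmorph0 mul0r add0r.
Qed.

Lemma lin_mem s g : g \in s -> lin setT s g.
Proof. by rewrite -{2}[g]mul1r -(rmorph1 f); exact: lin_gen. Qed.

Lemma submod_lin s : submod (lin setT s).
Proof. by split; [exact: lin0 | move=> *; exact: linD | move=> a u; exact: linM]. Qed.

Lemma lin_min s X : submod X -> (forall g, g \in s -> X g) -> lin setT s `<=` X.
Proof.
move=> sX; have [X0 XD XM] := sX; elim: s => [_ _ -> //|g s IH Xs u /=].
move=> [a [v [_ /IH sv ->]]]; apply: XD; first by apply: XM; apply: Xs; exact: mem_head.
by apply: sv => h hs; apply: Xs; rewrite inE hs orbT.
Qed.

Lemma lin_catl s t : lin setT s `<=` lin setT (s ++ t).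
Proof.
apply: lin_min; first exact: submod_lin.
by move=> g gs; apply: lin_mem; rewrite mem_cat gs.
Qed.

Lemma lin_catr s t : lin setT t `<=` lin setT (s ++ t).
Proof.
apply: lin_min; first exact: submod_lin.
by move=> g gs; apply: lin_mem; rewrite mem_cat gs orbT.
Qed.

Lemma lin_span s : lin setT s = span (range f) s.
Proof.
apply/seteqP; split.
  elim: s => [_ -> |g s IH _ /= [a [v [_ /IH[c cf ->] ->]]]].
    by exists (fun=> 0); [move=> _; exists 0; rewrite // rmorph0 | rewrite big_ord0].
  exists (fun i => if i is i'.+1 then c i' else f a).
    by case=> [|i //]; exists a.
  by rewrite big_ord_recl.
move=> _ [c cf ->]; apply: submod_sum => [|i _]; first exact: submod_lin.
have [a _ <-] := cf i; apply: lin_gen => //; exact: mem_nth.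
Qed.

Definition fg X := exists s, X = lin setT s.

End Submodules.

Notation ideal := (submod idfun).

Lemma idealM (A : comNzRingType) (I : set A) a b : ideal I -> I b -> I (a * b).
Proof. by case=> _ _; apply. Qed.

Definition noeth (A : comNzRingType) := forall I : set A, ideal I -> fg idfun I.

Lemma ideal_idealr (A : comNzRingType) (I : set A) : ideal I -> ~ I 1 ->
  exists p : idealr A, [set` p] = I.
Proof.
move=> [I0 ID IM] I1; pose P : {pred A} := fun a => `[< I a >].
have Pcl : idealr_closed P.
  split; [exact/asboolP | by apply/negP => /asboolP |].
  by move=> a u v /asboolP Iu /asboolP Iv; apply/asboolP/ID => //; exact: IM.
pose K := isIdealr.Build A P Pcl.
pose p : idealr A := HB.pack P K.
exists p; apply/seteqP; split=> a /=.
  by rewrite unfold_in /= => /asboolP.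
by move=> Ia; rewrite unfold_in; apply/asboolP.
Qed.

Lemma idealr_ideal (A : comNzRingType) (p : idealr A) : ideal [set` p].
Proof.
split=> /=; [exact: idealr0 | by move=> *; exact: rpredD |].
by move=> a u; exact: idealMr.
Qed.

Lemma noetherian_noeth (A : comNzRingType) : noetherian A -> noeth A.
Proof.
move=> nA I idI; have [I1|I1] := pselect (I 1).
  exists [:: 1]; apply/seteqP; split=> a _.
    by exists a, 0; rewrite /= mulr1 addr0.
  by rewrite -[a]mulr1; exact: idealM.
have [p pI] := ideal_idealr idI I1; have [s sp] := nA p.
exists s; rewrite -pI -sp lin_span; congr span.
by apply/seteqP; split=> // a _; exists a.
Qed.

Section Noetherian.
Variables (A E : comNzRingType) (f : {rmorphism A -> E}).
Hypothesis nA : noeth A.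
Implicit Types (X Y : set E) (s t : seq E).

Lemma noeth_sub s X : submod f X -> X `<=` lin f setT s -> fg f X.
Proof.
elim: s X => [|g s IH] X sX Xs.
  exists [::]; apply/seteqP; split=> // _ ->; by case: sX.
have [X0 XD XM] := sX; have [_ sD sM] := submod_lin f s; have sl := submod_lin f.
(* The coefficients of [g] in elements of [X]. Lifts [ws] of generators of this ideal, together with
   generators [t] of the part of [X] in the span of the tail, generate [X]. *)
pose I : set A := [set a | exists2 v, lin f setT s v & X (f a * g + v)].
have idI : ideal I.
  split.
  - by exists 0; rewrite ?rmorph0 ?mul0r ?addr0//; exact: lin0.
  - move=> a b [v sv Xv] [w sw Xw]; exists (v + w); first exact: sD.
    have -> : f (a + b) * g + (v + w) = (f a * g + v) + (f b * g + w).
      by rewrite rmorphD; ring.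
    exact: XD.
  - move=> a b [v sv Xv]; exists (f a * v); first exact: sM.
    have -> : f (a * b) * g + f a * v = f a * (f b * g + v).
      by rewrite rmorphM; ring.
    exact: XM.
have [al Ial] := nA idI.
have [t tE] : fg f (X `&` lin f setT s).
  by apply: IH; [exact: submodI | move=> u []].
have [ws Xws wsP] : exists2 ws, (forall w, w \in ws -> X w) &
    forall c, lin idfun setT al c ->
    exists2 w, lin f setT ws w & exists2 v, lin f setT s v & w = f c * g + v.
  have: forall a, a \in al -> I a by rewrite Ial => a; exact: lin_mem.
  elim: al {Ial} => [_|a al IHal Ial].
    exists [::] => // c ->; exists 0 => //; exists 0; first exact: lin0.
    by rewrite rmorph0 mul0r addr0.
  have [ws Xws wsP] := IHal (fun b hb => Ial b (mem_behead (s := a :: al) hb)).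
  have [v sv Xv] := Ial a (mem_head _ _).
  exists ((f a * g + v) :: ws).
    by move=> w; rewrite inE => /orP[/eqP -> //|]; exact: Xws.
  move=> _ [b [c [_ /wsP[w sw [v' sv' wE]] ->]]] /=.
  exists (f b * (f a * g + v) + w); first by exists b, w.
  exists (f b * v + v'); first by apply: sD => //; exact: sM.
  by rewrite wE rmorphD rmorphM /=; ring.
exists (ws ++ t); apply/seteqP; split=> u; last first.
  apply: (lin_min sX) => w; rewrite mem_cat => /orP[/Xws //|wt].
  by have : lin f setT t w by [exact: lin_mem]; rewrite -tE => -[].
move=> Xu; have [a [v [_ sv uE]]] := Xs _ Xu.
have : I a by exists v => //; rewrite -uE.
rewrite Ial => /wsP[w sw [v' sv' wE]].
have Xw : X w by apply: (lin_min sX) sw.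
have uw : lin f setT t (u - w).
  rewrite -tE; split; first exact: (submodB sX).
  have -> : u - w = v - v' by rewrite uE wE; ring.
  exact: (submodB (sl _)).
rewrite -(subrK w u); have [_ D _] := sl (ws ++ t); apply: D.
  exact: lin_catr.
exact: lin_catl.
Qed.

Lemma noeth_acc s (X : nat -> set E) : (forall n, submod f (X n)) ->
  (forall n, X n `<=` lin f setT s) -> (forall n, X n `<=` X n.+1) ->
  exists n, forall m, X m `<=` X n.
Proof.
move=> sX Xs Xinc; have mono i j : (i <= j)%N -> X i `<=` X j.
  move=> /subnK <-; elim: (j - i)%N => // k IH.
  exact: subset_trans IH (Xinc _).
pose Y := [set u | exists n, X n u].
have sY : submod f Y.
  split; first by exists 0%N; case: (sX 0%N).
  - move=> u v [n Xu] [m Xv]; exists (maxn n m).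
    have [_ + _] := sX (maxn n m); apply.
      exact: mono (leq_maxl _ _) _ Xu.
    exact: mono (leq_maxr _ _) _ Xv.
  - by move=> a u [n Xu]; exists n; have [_ _] := sX n; apply.
have [t tE] : fg f Y by apply: (@noeth_sub s) => // u [n /Xs].
have [n nP] : exists n, forall g, g \in t -> X n g.
  have: forall g, g \in t -> Y g by rewrite tE => g; exact: lin_mem.
  elim: {tE} t => [_|g t IH Yt]; first by exists 0%N.
  have [|n nP] := IH; first by move=> h ht; apply: Yt; rewrite inE ht orbT.
  have [m mP] := Yt g (mem_head _ _); exists (maxn n m) => h.
  rewrite inE => /orP[/eqP ->|/nP]; first exact: mono (leq_maxr _ _) _ mP.
  exact: mono (leq_maxl _ _) _.
exists n => m u Xu; apply: (lin_min (sX n) nP).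
by rewrite -tE; exists m.
Qed.

Lemma noeth_ind s (P : set E -> Prop) :
  (forall X, submod f X -> X `<=` lin f setT s ->
     (forall Y, submod f Y -> Y `<=` lin f setT s -> X `<` Y -> P Y) -> P X) ->
  forall X, submod f X -> X `<=` lin f setT s -> P X.
Proof.
move=> IH X sX Xs; apply: contrapT => nPX.
pose bad Y := [/\ submod f Y, Y `<=` lin f setT s & ~ P Y].
pose R (Y Z : {Y | bad Y}) := sval Y `<` sval Z.
have step (Y : {Y | bad Y}) : exists Z, R Y Z.
  case: Y => Y [sY Ys nPY]; apply: contrapT => noZ; apply: (nPY).
  apply: IH => // Z sZ Zs YZ; apply: contrapT => nPZ; apply: noZ.
  by exists (exist _ Z (And3 sZ Zs nPZ)).
have [u _ uP] := ex_sequence (exist bad X (And3 sX Xs nPX)) step.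
have [||n|n nP] := @noeth_acc s (fun n => sval (u n)).
- by move=> n; case: (svalP (u n)).
- by move=> n; case: (svalP (u n)).
- by case: (uP n).
- by case: (uP n) => _; apply; exact: nP.
Qed.

End Noetherian.

Lemma ideal_full (A : comNzRingType) (I : set A) : I `<=` lin idfun setT [:: 1].
Proof. by move=> a _; exists a, 0; rewrite /= mulr1 addr0. Qed.

Lemma ideal_ind (A : comNzRingType) (P : set A -> Prop) : noeth A ->
  (forall I, ideal I -> (forall J, ideal J -> I `<` J -> P J) -> P I) ->
  forall I, ideal I -> P I.
Proof.
move=> nA IH I idI; apply: (@noeth_ind A A idfun nA [:: 1]) => //; last exact: ideal_full.
by move=> X sX _ h; apply: IH => // J idJ; apply: h => //; exact: ideal_full.
Qed.

Definition is_prime (A : comNzRingType) (q : set A) :=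
  [/\ ideal q, ~ q 1 & forall a b, q (a * b) -> q a \/ q b].

Lemma primeX (A : comNzRingType) (q : set A) a n : is_prime q -> q (a ^+ n) -> q a.
Proof.
move=> [_ q1 qM]; elim: n => [/q1 //|n IH]; rewrite exprS => /qM[//|/IH //].
Qed.

Lemma prime_idealrP (A : comNzRingType) (q : set A) : is_prime q ->
  exists p : prime_idealr A, [set` p] = q.
Proof.
move=> [[q0 qD qM] q1 qP]; pose P : {pred A} := fun a => `[< q a >].
have Pcl : idealr_closed P.
  split; [exact/asboolP | by apply/negP => /asboolP |].
  by move=> a u v /asboolP Iu /asboolP Iv; apply/asboolP/qD => //; exact: qM.
have Ppr : prime_idealr_closed P.
  by move=> a b /asboolP/qP[?|?]; apply/orP; [left|right]; apply/asboolP.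
pose K := isIdealr.Build A P Pcl.
pose K' := isPrimeIdealrClosed.Build A P Ppr.
pose p : prime_idealr A := HB.pack P K K'.
exists p; apply/seteqP; split=> a /=.
  by rewrite unfold_in /= => /asboolP.
by move=> Ia; rewrite unfold_in; apply/asboolP.
Qed.

Lemma idealr_prime (A : comNzRingType) (p : prime_idealr A) : is_prime [set` p].
Proof.
split; [exact: idealr_ideal | by rewrite /= idealr1 |].
by move=> a b /=; rewrite prime_idealrM => /orP.
Qed.

(** * Length and the principal ideal theorem *)

Section Length.
Variables (A : comNzRingType) (F : set (set A)).
Hypothesis primeF : forall p, F p -> is_prime p.

Section Chains.
Variables (E : comNzRingType) (f : {rmorphism A -> E}).
Implicit Types (X Y Z : set E) (s : seq E).

(* [F] is a family of primes. [negl X Y] says that X/(X \cap Y) vanishes after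
   localization at each of them, and [lenle X Y n] that a decreasing chain from X
   to Y has at most [n] steps that are not negligible in this sense. *)
Definition negl X Y := forall p, F p ->
  exists2 t, ~ p t & forall u, X u -> Y (f t * u).

Definition lenle X Y n := forall (Z : nat -> set E) k,
  (forall i, (i <= k)%N -> [/\ submod f (Z i), Y `<=` Z i & Z i `<=` X]) ->
  (forall i, (i < k)%N -> Z i.+1 `<=` Z i) ->
  (\sum_(i < k) `[< ~ negl (Z i) (Z i.+1) >] <= n)%N.

Lemma negl_sub X Y : X `<=` Y -> negl X Y.
Proof.
move=> XY p /primeF[_ p1 _]; exists 1 => // u /XY.
by rewrite rmorph1 mul1r.
Qed.

Lemma lenle_sub X X' Y Y' n : X `<=` X' -> Y' `<=` Y -> lenle X' Y' n -> lenle X Y n.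
Proof.
move=> XX' YY' h Z k Zk Zd; apply: h => // i /Zk[sZ YZ ZX]; split=> //.
  exact: subset_trans YZ.
exact: subset_trans XX'.
Qed.

Lemma lenle_refl X Y : X `<=` Y -> lenle X Y 0.
Proof.
move=> XY Z k Zk Zd; rewrite leqn0 big1// => -[i /= ik] _.
case: asboolP => // -[]; apply: negl_sub => u Zu.
have [_ _ ZX] := Zk i (ltnW ik); have [_ YZ _] := Zk i.+1 ik.
exact/YZ/XY/ZX.
Qed.

(** A chain [W] induces the chains [W + Y] above [Y] and [W] intersected with [Y] below it. By the
    modular law a step negligible in both is negligible in [W], with the product of the two
    multipliers. *)
Lemma lenle_add X Y Z n m : submod f Y -> Y `<=` X -> Z `<=` Y ->
  submod f X -> lenle X Y n -> lenle Y Z m -> lenle X Z (n + m).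
Proof.
move=> sY YX ZY sX hn hm W k Wk Wd.
apply: leq_trans (leq_add (hn (fun i => addm (W i) Y) k _ _)
   (hm (fun i => W i `&` Y) k _ _)).
- rewrite -big_split; apply: leq_sum => -[i /= ik] _.
  case: (asboolP (~ negl (W i) _)) => // nWi.
  case: asboolP => // /contrapT h1; case: asboolP => // /contrapT h2.
  case: nWi => p Fp; have [t1 pt1 t1P] := h1 p Fp; have [t2 pt2 t2P] := h2 p Fp.
  exists (t2 * t1); first by have [_ _ pP] := primeF Fp; case/pP.
  move=> u Wu; have [|w [y [Ww Yy wy]]] := t1P u.
    exact: (addm_subl sY).
  have [sWi _ _] := Wk i (ltnW ik); have [sWi1 _ _] := Wk i.+1 ik.
  have Wy : W i y.
    have -> : y = f t1 * u - w by rewrite wy; ring.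
    apply: (submodB sWi); last exact: Wd Ww.
    by case: sWi => _ _; apply.
  have [W2 _] := t2P y (conj Wy Yy).
  rewrite rmorphM -mulrA wy mulrDr; have [_ + M] := sWi1; apply=> //.
  exact: M.
- move=> i /Wk[sW ZW WX]; split; first exact: submod_add.
    exact: (addm_subr sW).
  exact: (addm_min sX).
- by move=> i /Wd Wi; exact: addmSl.
- move=> i /Wk[sW ZW WX]; split; first exact: submodI.
    by move=> u Zu; split; [exact: ZW | exact: ZY].
  by move=> u [].
- by move=> i /Wd Wi u [/Wi ? ?].
Qed.

(** The descending chain condition that a bound provides: it holds only up to negligibility, since
    [n.+1] consecutive non-negligible steps would exceed the bound. *)
Lemma lenle_dcc X Y n (Z : nat -> set E) : lenle X Y n ->
  (forall i, [/\ submod f (Z i), Y `<=` Z i & Z i `<=` X]) ->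
  (forall i, Z i.+1 `<=` Z i) -> exists i, negl (Z i) (Z i.+1).
Proof.
move=> h ZP Zd; apply: contrapT => noi.
have := h Z n.+1 (fun i _ => ZP i) (fun i _ => Zd i).
rewrite (eq_bigr (fun=> 1%N)); first by rewrite sum1_card card_ord ltnn.
by move=> i _; case: asboolP => // -[] h'; apply: noi; exists i.
Qed.

End Chains.

(** A chain between the two modules pulls back along [a] to [f a * v] to a chain of ideals above
    [I]; modulo [Y] every element of the chain is a multiple of [v], so no non-negligible step is
    lost. *)
Lemma lenle_cyclic (E : comNzRingType) (f : {rmorphism A -> E}) (Y : set E)
    (v : E) (I : set A) n : submod f Y -> (forall a, I a -> Y (f a * v)) ->
  lenle idfun setT I n ->
  lenle f (addm [set w | exists a, w = f a * v] Y) Y n.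
Proof.
move=> sY IY h W k Wk Wd; pose Z i := [set a | W i (f a * v)].
apply: leq_trans (h Z k _ _) => [|i /Wk[sW YW WX]|i /Wd Wi a]; last exact: Wi.
  apply: leq_sum => -[i /= ik] _; case: (asboolP (~ negl f _ _)) => // nW.
  case: asboolP => // /contrapT hZ; case: nW => p /hZ[t pt tP].
  exists t => // u Wu; have [_ _ /(_ _ Wu)] := Wk i (ltnW ik).
  move=> [_ [y [[a ->] Yy uE]]].
  have [sWi YWi _] := Wk i (ltnW ik); have [[_ WD WM] YWi1 _] := Wk i.+1 ik.
  have Za : Z i a.
    have -> : Z i a = W i (u - y) by rewrite uE addrK.
    by apply: (submodB sWi) => //; exact: YWi.
  rewrite uE mulrDr; apply: WD; last by apply: WM; exact: YWi1.
  by rewrite mulrA -rmorphM; exact: tP.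
have [W0 WD WM] := sW; split=> //.
- split; rewrite /Z /=; first by rewrite rmorph0 mul0r.
    by move=> a b Wa Wb; rewrite rmorphD mulrDl; exact: WD.
  by move=> a b Wb; rewrite rmorphM -mulrA; exact: WM.
- by move=> a Ia; exact/YW/IY.
Qed.

Lemma lenle_lin (E : comNzRingType) (f : {rmorphism A -> E}) (Y : set E)
    (s : seq E) (I : set A) n : submod f Y ->
  (forall g a, g \in s -> I a -> Y (f a * g)) -> lenle idfun setT I n ->
  lenle f (addm (lin f setT s) Y) Y (size s * n).
Proof.
move=> sY IY h; elim: s IY => [_|g s IH IY].
  by apply: lenle_refl => _ [_ [y [-> Yy ->]]]; rewrite add0r.
have sX := submod_add (submod_lin f s) sY.
have sG := submod_cyclic f g.
have sub : addm (lin f setT (g :: s)) Y `<=`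
    addm [set w | exists a, w = f a * g] (addm (lin f setT s) Y).
  move=> _ [_ [y [[a [v [_ sv ->]]] Yy ->]]].
  by exists (f a * g), (v + y); split; [exists a | exists v, y | ring].
apply: (lenle_sub sub (fun _ h => h)); rewrite mulSn.
apply: (lenle_add sX).
- exact: (addm_subr sG).
- exact: (addm_subr (submod_lin f s)).
- exact: submod_add sG sX.
- apply: (lenle_cyclic sX _ h) => a Ia; apply: (addm_subr (submod_lin f s)).
  by apply: IY => //; exact: mem_head.
- by apply: IH => g' a g's; apply: IY; rewrite inE g's orbT.
Qed.

(** Localized at a prime of [F], the ring A/q is a field or zero. So the only step that can count is
    the one at which the chain drops into [q]; the induction bounds the count by the truth value of
    [Z k] lying in [q]. *)
Lemma lenle_prime (q : set A) : is_prime q ->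
  (forall p, F p -> q `<=` p -> p `<=` q) -> lenle idfun setT q 1.
Proof.
move=> [idq q1 qP] qF Z k Zk Zd.
suff [] : (\sum_(i < k) `[< ~ negl idfun (Z i) (Z i.+1) >] <= `[< Z k `<=` q >])%N.
  by move=> /leq_trans; apply; case: asboolP.
elim: k Zk Zd => [_ _|k IH Zk Zd]; first by rewrite big_ord0.
rewrite big_ord_recr /=; have [_ qZ _] := Zk k.+1 (leqnn _).
have {}IH := IH (fun i ik => Zk i (leqW ik)) (fun i ik => Zd i (leqW ik)).
have [n|n] := asboolP (~ negl _ _ _).
  have Zq : Z k.+1 `<=` q.
    move=> c Zc; apply: contrapT => qc; apply: n => p Fp.
    have [qp|] := pselect (q `<=` p).
      exists c; first by move=> /(qF _ Fp qp).
      move=> u _ /=; rewrite mulrC; have [[_ _ ZM] _ _] := Zk k.+1 (leqnn _).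
      exact: ZM.
    move=> /nonsubset[c' [qc' pc']]; exists c' => // u _ /=; apply: qZ.
    by rewrite mulrC; exact: idealM.
  rewrite (asboolT Zq); move: IH; case: asboolP => [h|_].
    by case: n; apply: negl_sub => u /h /qZ.
  by rewrite leqn0 => /eqP ->.
rewrite addn0; apply: leq_trans IH _; case: asboolP => // h.
by rewrite asboolT// => u /(Zd k (leqnn _))/h.
Qed.

(** Noetherian induction along a prime filtration: if [a * b] is in [I] but neither factor is, then
    A/I is an extension of A/(I + aA) by A/(I : a), and both ideals are strictly larger than [I]. *)
Lemma lenle_finite (I : set A) : noeth A -> ideal I ->
  (forall q, is_prime q -> I `<=` q -> forall p, F p -> q `<=` p -> p `<=` q) ->
  exists n, lenle idfun setT I n.
Proof.
move=> nA; move: I; apply: ideal_ind => // I idI IH hI.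
have {}IH J : ideal J -> I `<=` J -> ~ J `<=` I -> exists n, lenle idfun setT J n.
  move=> idJ IJ JI; apply: IH => // q pq Jq; apply: hI => //.
  exact: subset_trans Jq.
have [I1|I1] := pselect (I 1).
  by exists 0%N; apply: lenle_refl => a _; rewrite -[a]mulr1; exact: idealM.
have [pI|] := pselect (forall a b, I (a * b) -> I a \/ I b).
  by exists 1%N; apply: lenle_prime => //; exact: hI.
move=> /existsNP[a /existsNP[b /not_implyP[Iab /not_orP[Ia Ib]]]].
have sC := submod_cyclic idfun a; pose K := [set c | I (c * a)].
have [I0 ID IM] := idI.
have idK : ideal K.
  split; rewrite /K /=; first by rewrite mul0r.
    by move=> u v Iu Iv; rewrite mulrDl; exact: ID.
  by move=> u v Iv; rewrite -mulrA; exact: IM.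
have idJ := submod_add sC idI.
have [||n hn] := IH _ idJ; first exact: (addm_subr sC).
  move=> /(_ a) h; apply: Ia; apply: h; exists a, 0; split=> //; last by rewrite addr0.
  by exists 1; rewrite rmorph1 mul1r.
have [||m hm] := IH _ idK; first by move=> c Ic; rewrite /K /= mulrC; exact: IM.
  by move=> /(_ b) h; apply: Ib; apply: h; rewrite /K /= mulrC.
exists (n + m)%N; apply: (lenle_add idJ) => //; first exact: (addm_subr sC).
exact: lenle_cyclic hm.
Qed.

End Length.

(** * Modules over a subring and Nakayama's lemma *)

Section Nakayama.
Variable E : comNzRingType.
Implicit Types (B H U : set E).

Definition is_subring B :=
  [/\ B 1, forall u v, B u -> B v -> B (u - v) & forall u v, B u -> B v -> B (u * v)].

Definition bmod B H :=
  [/\ H 0, forall u v, H u -> H v -> H (u + v) & forall b u, B b -> H u -> H (b * u)].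

Lemma subring0 B : is_subring B -> B 0.
Proof. by case=> B1 BB _; rewrite -(subrr 1); exact: BB. Qed.

Lemma subringN B u : is_subring B -> B u -> B (- u).
Proof. by move=> rB Bu; rewrite -sub0r; case: rB (subring0 rB) => _ BB _; move/BB; apply. Qed.

Lemma subringD B u v : is_subring B -> B u -> B v -> B (u + v).
Proof.
move=> rB Bu Bv; rewrite -[v]opprK; have [_ BB _] := rB; apply: BB => //.
exact: subringN.
Qed.

Lemma subringX B u n : is_subring B -> B u -> B (u ^+ n).
Proof.
move=> [B1 _ BM] Bu; elim: n => [|n IH]; rewrite ?expr0// exprS; exact: BM.
Qed.

Lemma bmod_refl B : is_subring B -> bmod B B.
Proof.
move=> rB; split; [exact: subring0 | by move=> *; exact: subringD | by case: rB].
Qed.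

Lemma bmod_scale B X v : bmod B X -> bmod B (scale v X).
Proof.
move=> [X0 XD XM]; split; first by exists 0 => //; rewrite mulr0.
- by move=> _ _ [u Xu <-] [w Xw <-]; exists (u + w); [exact: XD | rewrite mulrDr].
- by move=> b _ Bb [u Xu <-]; exists (b * u); [exact: XM | rewrite mulrCA].
Qed.

Lemma bmod_add B X Y : bmod B X -> bmod B Y -> bmod B (addm X Y).
Proof.
move=> [X0 XD XM] [Y0 YD YM]; split.
- by exists 0, 0; split=> //; rewrite addr0.
- move=> _ _ [u [v [Xu Yv ->]]] [u' [v' [Xu' Yv' ->]]].
  by exists (u + u'), (v + v'); split; [exact: XD | exact: YD | ring].
- move=> a _ Ba [u [v [Xu Yv ->]]].
  by exists (a * u), (a * v); split; [exact: XM | exact: YM | ring].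
Qed.

Lemma bmod_submod (A : comNzRingType) (f : {rmorphism A -> E}) B H :
  range f `<=` B -> bmod B H -> submod f H.
Proof.
by move=> AB [H0 HD HM]; split=> // a u Hu; apply: HM => //; apply: AB; exists a.
Qed.

(** Every binomial term contains [u ^+ k] or [v ^+ l]: the argument that a radical is closed under
    addition, with multipliers [s] and [t]. *)
Lemma binomial_mem B X u v s t k l : is_subring B -> bmod B X -> B u -> B v ->
  B s -> B t -> X (s * u ^+ k) -> X (t * v ^+ l) -> X (s * t * (u + v) ^+ (k + l)).
Proof.
move=> rB [X0 XD XM] Bu Bv Bs Bt Xu Xv; have [_ _ BM] := rB.
have XMn w n : X w -> X (w *+ n).
  by move=> Xw; elim: n => [|n IH]; rewrite ?mulr0n// mulrS; exact: XD.
rewrite exprDn mulr_sumr; apply: big_ind => // -[i /= ile] _.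
rewrite mulrnAr; apply: XMn; have [li|il] := leqP l i.
  have R x y z : s * t * (x * (y * z)) = (s * x * y) * (t * z) by ring.
  rewrite -{2}(subnK li) exprD R; apply: XM => //.
  by apply: (BM); [apply: (BM) => // |]; exact: subringX.
have R x y z : s * t * (x * y * z) = (t * x * z) * (s * y) by ring.
have -> : (k + l - i = (l - i) + k)%N by rewrite addnC -addnBAC ?(ltnW il).
rewrite exprD R; apply: XM => //.
by apply: (BM); [apply: (BM) => // |]; exact: subringX.
Qed.

Fixpoint blin B (s : seq E) : set E :=
  if s is g :: s' then
    [set u | exists b v, [/\ B b, blin B s' v & u = b * g + v]]
  else [set 0].

Lemma blin_smul B (t : E) (X : set E) s : bmod B X ->
  (forall g, g \in s -> X (t * g)) -> forall w, blin B s w -> X (t * w).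
Proof.
move=> [X0 XD XM]; elim: s => [_ _ ->|g s IH Xs _ [b [v [Bb sv ->]]]].
  by rewrite mulr0.
rewrite mulrDr; apply: XD; first by rewrite mulrCA; apply: XM => //; exact/Xs/mem_head.
by apply: IH => // h hs; apply: Xs; rewrite inE hs orbT.
Qed.

(** Since [U] absorbs multiples of [x], the element [x] is in the Jacobson radical once [U] is
    inverted. The proof eliminates generators one by one: the tail is treated modulo [H + gB], and
    then the relation for [g] is solved. *)
Lemma nakayama B U (x : E) s : is_subring B -> U `<=` B -> U 1 -> B x ->
  (forall u v, U u -> U v -> U (u * v)) ->
  (forall u b, U u -> B b -> U (u + x * b)) -> forall H, bmod B H ->
  (forall g, g \in s -> exists t h w, [/\ U t, H h, blin B s w & t * g = h + x * w]) ->
  exists2 t, U t & forall g, g \in s -> H (t * g).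
Proof.
move=> rB UB U1 Bx UM UD; elim: s => [H _ _|g s IH H bH Hs]; first by exists 1.
have [_ BB BM] := rB; have [H0 HD HM] := bH.
pose G := addm H (scale g B).
have bG : bmod B G by apply: bmod_add => //; apply: bmod_scale; exact: bmod_refl.
have [|t1 Ut1 t1P] := IH G bG.
  move=> h hs; have [|t [h0 [_ [Ut Hh0 [b [w [Bb sw ->]]] tE]]]] := Hs h.
    by rewrite inE hs orbT.
  exists t, (h0 + x * (b * g)), w; split=> //.
    by exists h0, (x * (b * g)); split=> //; exists (x * b); [exact: BM | ring].
  by rewrite tE; ring.
have [t [h0 [_ [Ut Hh0 [b [w [Bb sw ->]]] tE]]]] := Hs g (mem_head _ _).
have [h2 [_ [Hh2 [b2 Bb2 <-] wE]]] := blin_smul bG t1P sw.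
(* Multiply [t * g = h0 + x * (b * g + w)] by [t1], insert the relation for [t1 * w], and collect
   the coefficient of [g]. It is [t1 * t] modulo [x], hence in [U]. *)
pose u := t1 * t + x * - (t1 * b + b2).
have Uu : U u.
  apply: UD; [exact: UM | apply: subringN => //; apply: subringD => //].
  by apply: BM => //; exact: UB.
have Hug : H (u * g).
  have -> : u * g = t1 * h0 + x * h2.
    have -> : u * g = t1 * (t * g) - x * (t1 * b * g + g * b2) by rewrite /u; ring.
    by rewrite tE !mulrDr mulrCA (mulrCA t1 x) wE; ring.
  apply: HD; apply: HM => //; exact: UB.
exists (u * t1); first exact: UM.
move=> h; rewrite inE => /orP[/eqP ->|/t1P].
  by rewrite mulrAC mulrC; apply: HM => //; exact: UB.
move=> [h3 [_ [Hh3 [b3 Bb3 <-] E3]]].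
rewrite -mulrA E3 mulrDr; apply: HD; first by apply: HM => //; exact: UB.
by rewrite mulrA mulrC; exact: HM.
Qed.

End Nakayama.

Lemma setT_subring (R : comNzRingType) : is_subring [set: R].
Proof. by split. Qed.

(* The prime is the complement of a maximal multiplicative set containing [S]
   and disjoint from [I]; the last clause makes it minimal over [I]. *)
Lemma prime_avoid (A : comNzRingType) (I S : set A) : ideal I -> S 1 ->
  (forall a b, S a -> S b -> S (a * b)) -> (forall a, S a -> ~ I a) ->
  exists q, [/\ is_prime q, I `<=` q, forall a, S a -> ~ q a &
    forall a, q a -> exists t n, ~ q t /\ I (t * a ^+ n)].
Proof.
move=> idI S1 SM SI; have [I0 ID IM] := idI.
have bI : bmod setT I by split=> // b u _; exact: IM.
(* Zorn's lemma is applied to [X], with [S] joined to it, because the union of the empty chain must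
   also satisfy [P]. *)
pose P (X : set A) := (forall a b, (S `|` X) a -> (S `|` X) b -> (S `|` X) (a * b))
  /\ (forall a, (S `|` X) a -> ~ I a).
have [F FP totF|X [[XM XI] Xmax]] := @Zorn_bigcup A P.
  split.
    move=> a b [Sa|[Y FY Ya]] [Sb|[Z FZ Zb]].
    - by left; exact: SM.
    - have [ZM _] := FP _ FZ.
      have [?|?] := ZM a b (or_introl Sa) (or_intror Zb); [by left|].
      by right; exists Z.
    - have [YM _] := FP _ FY.
      have [?|?] := YM a b (or_intror Ya) (or_introl Sb); [by left|].
      by right; exists Y.
    - have [YZ|ZY] := totF _ _ FY FZ.
        have [ZM _] := FP _ FZ.
        have [?|?] := ZM a b (or_intror (YZ _ Ya)) (or_intror Zb); [by left|].
        by right; exists Z.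
      have [YM _] := FP _ FY.
      have [?|?] := YM a b (or_intror Ya) (or_intror (ZY _ Zb)); [by left|].
      by right; exists Y.
  move=> a [/SI //|[Y FY Ya]]; have [_ YI] := FP _ FY.
  by apply: YI; right.
pose W := S `|` X; pose q : set A := ~` W.
have W1 : W 1 by left.
have WX t n : W t -> W (t ^+ n).
  by move=> Wt; elim: n => [|n IH]; rewrite ?expr0// exprS; exact: XM.
(* By maximality of [W], adjoining the powers of an element [a] outside [W] must make it meet
   [I]. *)
have qP a : q a -> exists t n, W t /\ I (t * a ^+ n).
  move=> Wa; apply: contrapT => noI.
  pose V : set A := [set b | exists t n, W t /\ b = t * a ^+ n].
  apply: (Xmax (X `|` V)).
    split; first by left.
    move=> /(_ a) h; apply: Wa; right; apply: h; right.
    by exists 1, 1%N; rewrite mul1r expr1.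
  have WV b : (S `|` (X `|` V)) b -> V b.
    move=> [Sb|[Xb|//]]; exists b, 0%N; rewrite expr0 mulr1; split=> //.
      by left.
    by right.
  split=> [b c /WV[t [n [Wt ->]]] /WV[t' [n' [Wt' ->]]]|b /WV[t [n [Wt ->]]] Ib].
    right; right; exists (t * t'), (n + n')%N; split; first exact: XM.
    by rewrite exprD mulrACA.
  by apply: noI; exists t, n.
have qI t n a : W t -> I (t * a ^+ n) -> q a.
  move=> Wt It Wa; apply: (XI (t * a ^+ n)) => //; apply: XM => //; exact: WX.
exists q; split.
- split; last 2 first.
  + by apply.
  + move=> a b Wab; apply: contrapT => /not_orP[/contrapT Wa /contrapT Wb].
    by apply: Wab; exact: XM.
  split.
  + by move=> W0; apply: (XI 0).
  + move=> a b /qP[t [n [Wt It]]] /qP[t' [n' [Wt' It']]].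
    apply: (qI (t * t') (n + n')%N); first exact: XM.
    exact: (binomial_mem (setT_subring A) bI).
  + move=> a u /qP[t [n [Wt It]]]; apply: (qI t n) => //.
    by rewrite exprMn mulrCA; exact: idealM.
- by move=> a Ia Wa; exact: (XI a).
- by move=> a Sa; apply; left.
- move=> a /qP[t [n [Wt It]]]; exists t, n; split=> //; exact.
Qed.

Lemma lin_blin (A E : comNzRingType) (f : {rmorphism A -> E}) (B : set E) s :
  range f `<=` B -> lin f setT s `<=` blin B s.
Proof.
move=> AB; elim: s => [//|g s IH _ [a [v [_ /IH sv ->]]]].
by exists (f a), v; split=> //; apply: AB; exists a.
Qed.

(* Krull's principal ideal theorem, in the form: where [B/xB] satisfies the
   descending chain condition, every nonzerodivisor [d] divides a power of [x].
   The ideals [J n] below are the [x]-saturations of [d ^+ n B]; the chain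
   condition and Nakayama give [J n = J n.+1] up to [U]. *)
Lemma krull_pit (A E : comNzRingType) (f : {rmorphism A -> E}) (B U : set E)
    (bs : seq E) (x d : E) : noeth A -> is_subring B -> range f `<=` B ->
  B `<=` lin f setT bs -> U `<=` B -> U 1 ->
  (forall u v, U u -> U v -> U (u * v)) ->
  (forall u b, U u -> B b -> U (u + x * b)) -> B x -> B d ->
  (forall e, B e -> d * e = 0 -> e = 0) ->
  (forall J : nat -> set E, (forall n, bmod B (J n) /\ J n `<=` B) ->
    (forall n, J n.+1 `<=` J n) ->
    exists n, exists2 t, U t & forall u, J n u ->
      exists v b, [/\ J n.+1 v, B b & t * u = v + x * b]) ->
  exists t j b, [/\ U t, B b & t * x ^+ j = d * b].
Proof.
move=> nA rB AB Bbs UB U1 UM UD Bx Bd rd stab.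
have [B1 BB BM] := rB.
pose J n : set E := [set u | B u /\ exists c t b, [/\ U t, B b &
  t * x ^+ c * u = d ^+ n * b]].
have BJ n : J n `<=` B by move=> u [].
have bJ n : bmod B (J n).
  split.
  - split; first exact: subring0.
    by exists 0%N, 1, 0; split=> //; [exact: subring0 | ring].
  - move=> u v [Bu [c [t [b [Ut Bb e]]]]] [Bv [c' [t' [b' [Ut' Bb' e']]]]].
    split; first exact: subringD.
    exists (c + c')%N, (t * t'), (t' * x ^+ c' * b + t * x ^+ c * b'); split.
    + exact: UM.
    + by apply: subringD => //; apply: (BM) => //; apply: (BM) => //;
        try exact: UB; exact: subringX.
    + rewrite exprD.
      transitivity (t' * x ^+ c' * (t * x ^+ c * u) + t * x ^+ c * (t' * x ^+ c' * v)).
        by ring.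
      by rewrite e e'; ring.
  - move=> a u Ba [Bu [c [t [b [Ut Bb e]]]]]; split; first exact: BM.
    exists c, t, (a * b); split=> //; first exact: BM.
    by rewrite mulrCA e; ring.
have sat n u : B u -> J n (x * u) -> J n u.
  move=> Bu [_ [c [t [b [Ut Bb e]]]]]; split=> //.
  by exists c.+1, t, b; split=> //; rewrite -e exprSr; ring.
have Jd n : J n.+1 `<=` J n.
  move=> u [Bu [c [t [b [Ut Bb e]]]]]; split=> //.
  by exists c, t, (d * b); split=> //; [exact: BM | rewrite e exprSr; ring].
have [n [t Ut tP]] := stab J (fun n => conj (bJ n) (BJ n)) Jd.
have [s sE] : fg f (J n).
  apply: (noeth_sub nA (s := bs)); first exact: bmod_submod (bJ n).
  exact: subset_trans Bbs.
have [|t' Ut' t'P] := @nakayama _ B U x s rB UB U1 Bx UM UD _ (bJ n.+1).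
  move=> g gs; have Jg : J n g by rewrite sE; exact: lin_mem.
  have [v [b [Jv Bb tgE]]] := tP g Jg.
  (* The difference [t * g - v = x * b] is in [J n], and [J n] is saturated for [x], so [b] is in
     [J n] as well: up to [U], [J n] is contained in [J n.+1 + x (J n)]. *)
  exists t, v, b; split=> //; apply: (lin_blin AB); rewrite -sE; apply: sat => //.
  have -> : x * b = t * g - v by rewrite tgE; ring.
  have sJ := bmod_submod AB (bJ n).
  apply: (submodB sJ); last exact: Jd.
  by have [_ _ JM] := bJ n; apply: JM => //; exact: UB.
have Jdn : J n (d ^+ n).
  split; first exact: subringX.
  by exists 0%N, 1, 1; split=> //; ring.
(* Nakayama moves [d ^+ n] from [J n] into [J n.+1], that is, [t2 * t' * x ^+ c * d ^+ n] is a
   multiple of [d ^+ n.+1]. Cancelling the regular element [d ^+ n] gives the claim. *)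
have [_ [c [t2 [b [Ut2 Bb e]]]]] : J n.+1 (t' * d ^+ n).
  apply: (blin_smul (bJ n.+1) t'P); apply: (lin_blin AB).
  by rewrite -sE.
exists (t2 * t'), c, b; split=> //; first exact: UM.
have Bt : B (t2 * t' * x ^+ c) by apply: (BM); [apply: (BM); exact: UB | exact: subringX].
apply/eqP; rewrite -subr_eq0; apply/eqP.
have : B (t2 * t' * x ^+ c - d * b) by apply: BB => //; exact: BM.
have : d ^+ n * (t2 * t' * x ^+ c - d * b) = 0.
  apply/eqP; rewrite mulrBr subr_eq0; apply/eqP.
  by rewrite [RHS]mulrA -exprSr -e; ring.
elim: n {bJ BJ sat Jd tP sE t'P Jdn e} => [|n IH]; first by rewrite expr0 mul1r.
rewrite exprS -mulrA => h Bh; apply: IH => //; apply: rd => //.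
by apply: BM => //; exact: subringX.
Qed.

(** * Integral extensions *)

Section Integral.
Variables (A E : comNzRingType) (f : {rmorphism A -> E}).
Implicit Types (B X : set E) (s : seq E) (q u v : E).

Lemma range_subring : is_subring (range f).
Proof.
split; first by exists 1 => //; rewrite rmorph1.
- by move=> _ _ [a _ <-] [b _ <-]; exists (a - b) => //; rewrite rmorphB.
- by move=> _ _ [a _ <-] [b _ <-]; exists (a * b) => //; rewrite rmorphM.
Qed.

Lemma subring_sum B (T : Type) (r : seq T) (P : pred T) (F : T -> E) :
  is_subring B -> (forall i, P i -> B (F i)) -> B (\sum_(i <- r | P i) F i).
Proof.
move=> rB; apply: big_ind; [exact: subring0 | by move=> *; exact: subringD].
Qed.

Lemma integral_eq B q : is_subring B -> integral_elements B q <->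
  exists m (c : nat -> E), (forall i, B (c i)) /\
    q ^+ m.+1 = \sum_(i < m.+1) c i * q ^+ i.
Proof.
move=> rB; split=> [[p [pm Bp] /eqP pq]|[m [c [Bc qE]]]].
  have := monic_neq0 pm; rewrite -size_poly_gt0.
  case sp: (size p) => [//|[|m]] _.
    (* A monic constant is 1 and has no root, so the degree is positive. *)
    have p1 : p = 1.
      by rewrite [LHS]size1_polyC ?sp//; move: pm; rewrite monicE lead_coefE sp => /eqP ->.
    by move: pq; rewrite p1 hornerC => /eqP; rewrite oner_eq0.
  exists m, (fun i => - p`_i); split; first by move=> i; exact: subringN.
  move: pq; rewrite horner_coef sp big_ord_recr /=.
  have -> : p`_m.+1 = 1 by move: pm; rewrite monicE lead_coefE sp => /eqP.
  rewrite mul1r addrC => /eqP; rewrite addr_eq0 => /eqP ->.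
  by rewrite -sumrN; apply: eq_bigr => i _; rewrite mulNr.
pose p := 'X^(m.+1) - \poly_(i < m.+1) c i.
exists p; last first.
  rewrite /root /p hornerD hornerN hornerXn horner_poly qE subrr; exact/eqP.
split; last first.
  move=> i; rewrite /p coefB coefXn coef_poly.
  have [B1 BB _] := rB; apply: BB; first by case: eqP => _ //; exact: subring0.
  by case: ifP => // _; exact: subring0.
rewrite monicE /p lead_coefDl ?lead_coefXn// size_polyXn size_polyN.
exact: size_poly.
Qed.

Lemma integral_mem B : is_subring B -> B `<=` integral_elements B.
Proof.
move=> rB q Bq; apply/(integral_eq _ rB); exists 0%N, (fun=> q); split=> //.
by rewrite big_ord1 expr1 expr0 mulr1.
Qed.

Lemma integral_sub B B' : B `<=` B' -> integral_elements B `<=` integral_elements B'.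
Proof. by move=> BB' q [p [pm Bp] pq]; exists p => //; split=> // i; exact: BB'. Qed.

(** Multiplying the equation of degree [m.+1] for [u = 1/a] by [a ^+ m] writes [u] as a polynomial
    in [a] over [B]. *)
Lemma integral_inv B a u : is_subring B -> B a -> u * a = 1 ->
  integral_elements B u -> B u.
Proof.
move=> rB Ba ua /(integral_eq _ rB)[m [c [Bc uE]]].
have -> : u = u ^+ m.+1 * a ^+ m by rewrite exprS -mulrA -exprMn ua expr1n mulr1.
rewrite uE mulr_suml; apply: subring_sum => // -[i /= im] _.
have im' : (i <= m)%N by [].
have -> : c i * u ^+ i * a ^+ m = c i * a ^+ (m - i) * (u * a) ^+ i.
  by rewrite -{1}(subnK im') exprD exprMn; ring.
rewrite ua expr1n mulr1; have [_ _ BM] := rB.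
by apply: BM => //; exact: subringX.
Qed.

(** The determinant trick: if [C] is the matrix of multiplication by [q] on the generators, then
    det(q - C) kills every generator, hence 1, so [q] is a root of the characteristic polynomial of
    [C]. *)
Lemma fg_lin_stable s q : lin f setT s 1 ->
  (forall u, u \in s -> lin f setT s (q * u)) -> integral_elements (range f) q.
Proof.
move=> s1 qs.
have [C CP] : exists C : 'M[A]_(size s),
    forall i : 'I_(size s), q * s`_i = \sum_j f (C i j) * s`_j.
  have h (i : 'I_(size s)) : exists r : 'rV[A]_(size s),
      q * s`_i = \sum_j f (r 0 j) * s`_j.
    have := qs _ (mem_nth 0 (ltn_ord i)); rewrite lin_span => -[c cf ->].
    have /choice[g gP] : forall j : nat, exists a, c j = f a.
      by move=> j; have [a _ <-] := cf j; exists a.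
    by exists (\row_j g j); apply: eq_bigr => j _; rewrite mxE gP.
  have [g gP] := choice h; exists (\matrix_(i, j) g i 0 j) => i.
  by rewrite gP; apply: eq_bigr => j _; rewrite mxE.
exists (map_poly f (char_poly C)).
  split; first by rewrite monic_map // char_poly_monic.
  by move=> i; rewrite coef_map; exists (char_poly C)`_i.
rewrite map_char_poly; set D := map_mx f C.
pose N := q%:M - D.
have -> : root (char_poly D) q = (\det N == 0).
  rewrite /root -[_.[q]]/(horner_eval q _) /char_poly -det_map_mx; congr (\det _ == 0).
  apply/matrixP => i j; rewrite !mxE /= /horner_eval hornerD hornerN !hornerC.
  by rewrite hornerMn hornerX.
have Ns : N *m (\col_i s`_i) = 0.
  apply/matrixP => i j; rewrite mulmxBl !mxE.
  under eq_bigr => k _ do rewrite !mxE.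
  rewrite (bigD1 i)//= eqxx mulr1n big1 ?addr0 => [|k ki].
    rewrite CP -sumrB big1// => k _; rewrite !mxE; exact: subrr.
  by rewrite eq_sym (negbTE ki) mulr0n mul0r.
have dets i : (i < size s)%N -> \det N * s`_i = 0.
  move=> si; have := congr1 (fun M => \adj N *m M) Ns.
  rewrite mulmxA mul_adj_mx mulmx0 mul_scalar_mx => /matrixP/(_ (Ordinal si) 0).
  by rewrite !mxE.
have : [set u | \det N * u = 0] 1.
  apply: (lin_min _ _ s1); first split; rewrite /= ?mulr0//.
  - by move=> u v eu ev; rewrite mulrDr eu ev addr0.
  - by move=> a u eu; rewrite mulrCA eu mulr0.
  - by move=> g gs; rewrite -(nth_index 0 gs); apply: dets; rewrite index_mem.
by rewrite /= mulr1 => ->.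
Qed.

Definition finite_ext B := [/\ is_subring B, range f `<=` B & fg f B].

Lemma finite_ext_integral B : finite_ext B -> B `<=` integral_elements (range f).
Proof.
move=> [[B1 _ BM] _ [s sE]] q Bq; apply: (@fg_lin_stable s); first by rewrite -sE.
by move=> u us; rewrite -sE; apply: BM => //; rewrite sE; exact: lin_mem.
Qed.

Lemma finite_ext_range : finite_ext (range f).
Proof.
split=> //; first exact: range_subring.
exists [:: 1]; apply/seteqP; split=> [_ [a _ <-]|_ [a [_ [_ -> ->]]]].
  by exists a, 0; rewrite mulr1 addr0.
by exists a => //; rewrite mulr1 addr0.
Qed.

Lemma fg_scale X v : fg f X -> fg f (scale v X).
Proof.
move=> [s ->]; exists [seq v * u | u <- s]; apply/seteqP; split.
  move=> _ [u su <-]; elim: s u su => [_ ->|g s IH _ [a [w [_ /IH sw ->]]]] /=.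
    exact: mulr0.
  by exists a, (v * w); split=> //; ring.
apply: lin_min; first exact/submod_scale/submod_lin.
by move=> _ /mapP[u us ->]; exists u => //; exact: lin_mem.
Qed.

Lemma fg_addm X Y : fg f X -> fg f Y -> fg f (addm X Y).
Proof.
move=> [s ->] [t ->]; exists (s ++ t).
have sS := submod_lin f s; have sT := submod_lin f t.
apply/seteqP; split.
  by apply: (addm_min (submod_lin f _)); [exact: lin_catl | exact: lin_catr].
apply: lin_min; first exact: submod_add.
move=> u; rewrite mem_cat => /orP[us|ut].
  by apply: (addm_subl sT); exact: lin_mem.
by apply: (addm_subr sS); exact: lin_mem.
Qed.

Lemma finite_ext_adjoin B q : finite_ext B -> integral_elements B q ->
  exists B', [/\ finite_ext B', B `<=` B' & B' q].
Proof.
move=> [rB AB fB] /(integral_eq _ rB)[m [c [Bc qE]]].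
have [B1 BB BM] := rB.
(* [Y n] is spanned over [B] by the powers of [q] below [n]. The integral equation makes [Y m.+1]
   stable under multiplication by [q], so it is the ring B[q]. *)
pose Y n : set E := [set u | exists d : nat -> E,
  (forall i, B (d i)) /\ u = \sum_(i < n) d i * q ^+ i].
have YS n : Y n.+1 = addm (Y n) (scale (q ^+ n) B).
  apply/seteqP; split.
    move=> _ [d [Bd ->]]; rewrite big_ord_recr /=.
    exists (\sum_(i < n) d i * q ^+ i), (d n * q ^+ n); split=> //.
      by exists d.
    by exists (d n) => //; rewrite mulrC.
  move=> _ [_ [_ [[d [Bd ->]] [b Bb <-] ->]]].
  exists (fun i => if (i < n)%N then d i else b); split; first by move=> i; case: ifP.
  rewrite big_ord_recr /= ltnn mulrC; congr (_ + _); apply: eq_bigr => i _.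
  by rewrite ltn_ord.
have fY n : fg f (Y n).
  elim: n => [|n IH]; last by rewrite YS; apply: fg_addm => //; exact: fg_scale.
  exists [::]; apply/seteqP; split=> [_ [d [_ ->]]|_ ->]; first by rewrite big_ord0.
  by exists (fun=> 0); rewrite big_ord0; split=> // _; exact: subring0.
have YB n u v : Y n u -> Y n v -> Y n (u - v).
  move=> [d [Bd ->]] [e [Be ->]]; exists (fun i => d i - e i); split.
    by move=> i; exact: BB.
  by rewrite -sumrB; apply: eq_bigr => i _; rewrite mulrBl.
have Y0 n : Y n 0.
  exists (fun=> 0); split=> [_|]; first exact: subring0.
  by rewrite big1// => i _; rewrite mul0r.
have YN n u : Y n u -> Y n (- u) by rewrite -sub0r; exact: YB.
have YD n u v : Y n u -> Y n v -> Y n (u + v).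
  by move=> Yu /YN; rewrite -[v in u + v]opprK; exact: YB.
have YM n b u : B b -> Y n u -> Y n (b * u).
  move=> Bb [d [Bd ->]]; exists (fun i => b * d i); split=> [i|]; first exact: BM.
  by rewrite mulr_sumr; apply: eq_bigr => i _; rewrite mulrA.
have Yq u : Y m.+1 u -> Y m.+1 (q * u).
  move=> [d [Bd ->]]; rewrite mulr_sumr big_ord_recr /=; apply: YD; last first.
    have -> : q * (d m * q ^+ m) = d m * q ^+ m.+1 by rewrite exprS; ring.
    by apply: YM => //; exists c.
  exists (fun i => if i is j.+1 then d j else 0); split.
    by case=> // ; exact: subring0.
  rewrite big_ord_recl mul0r add0r; apply: eq_bigr => i _.
  by rewrite /= exprS; ring.
have YX n u : Y m.+1 u -> Y m.+1 (q ^+ n * u).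
  by move=> Yu; elim: n => [|n IH]; rewrite ?mul1r// exprS -mulrA; exact: Yq.
have Yb b : B b -> Y m.+1 b.
  move=> Bb; exists (fun i => if i is 0 then b else 0); split.
    by case=> // _; exact: subring0.
  by rewrite big_ord_recl big1 ?addr0 ?mulr1// => i _; rewrite mul0r.
exists (Y m.+1); split=> //.
- split=> //; last by move=> a /AB; exact: Yb.
  split; [exact: Yb | exact: YB |].
  move=> u v [d [Bd ->]] Yv; rewrite mulr_suml.
  apply: (big_ind (Y m.+1)) => //; first exact: YD.
  by move=> i _; rewrite -mulrA; apply: YM => //; exact: YX.
- by rewrite -[q]mulr1; apply: Yq; exact: Yb.
Qed.

(** Transitivity of integrality: all finite extensions share one notion of integral element, so
    integrality need not be tracked along a blow-up chain. *)
Lemma finite_ext_integralE B : finite_ext B ->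
  integral_elements B = integral_elements (range f).
Proof.
move=> fB; apply/seteqP; split; last by case: fB => _ AB _; exact: integral_sub.
by move=> q /(finite_ext_adjoin fB)[B' [fB' _ B'q]]; exact: finite_ext_integral B'q.
Qed.

Lemma integral_subring : is_subring (integral_elements (range f)).
Proof.
have two u v : integral_elements (range f) u -> integral_elements (range f) v ->
    exists B, [/\ finite_ext B, B u & B v].
  move=> Iu Iv; have [B [fB _ Bu]] := finite_ext_adjoin finite_ext_range Iu.
  move: Iv; rewrite -(finite_ext_integralE fB) => /(finite_ext_adjoin fB).
  by move=> [B' [fB' BB' B'v]]; exists B'; split=> //; exact: BB'.
split.
- by apply: (integral_mem range_subring); case: range_subring.
- move=> u v Iu Iv; have [B [fB Bu Bv]] := two u v Iu Iv.
  by apply: (finite_ext_integral fB); case: fB => -[_ BB _] _ _; exact: BB.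
- move=> u v Iu Iv; have [B [fB Bu Bv]] := two u v Iu Iv.
  by apply: (finite_ext_integral fB); case: fB => -[_ _ BM] _ _; exact: BM.
Qed.

Lemma finite_ext_adjoin_seq B s : finite_ext B ->
  (forall q, q \in s -> integral_elements (range f) q) ->
  exists B', [/\ finite_ext B', B `<=` B' & forall q, q \in s -> B' q].
Proof.
move=> fB; elim: s => [_|q s IH Is]; first by exists B; split=> // q; rewrite in_nil.
have [|B1 [fB1 BB1 B1s]] := IH; first by move=> u us; apply: Is; rewrite inE us orbT.
have := Is q (mem_head _ _); rewrite -(finite_ext_integralE fB1).
move=> /(finite_ext_adjoin fB1)[B2 [fB2 B12 B2q]]; exists B2; split=> //.
  exact: subset_trans B12.
by move=> u; rewrite inE => /orP[/eqP -> //|/B1s /B12].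
Qed.

End Integral.

Section Products.
Variable Q : comNzRingType.
Implicit Types (B I J X : set Q) (u v : Q).

Lemma smul_mem (I J : set Q) u v : I u -> J v -> smul I J (u * v).
Proof.
move=> Iu Jv; exists [:: (u, v)]; last by rewrite big_seq1.
by move=> _ /[!inE]/eqP ->.
Qed.

Lemma smul_min (I J X : set Q) : X 0 -> (forall u v, X u -> X v -> X (u + v)) ->
  (forall u v, I u -> J v -> X (u * v)) -> smul I J `<=` X.
Proof.
move=> X0 XD XM _ [s sP ->]; rewrite big_seq; apply: big_ind => // p /sP[Ip Jp].
exact: XM.
Qed.

Lemma bmod_smul B (I J : set Q) : bmod B J -> bmod B (smul I J).
Proof.
move=> [J0 JD JM]; split.
- by exists [::]; rewrite ?big_nil.
- move=> _ _ [s sP ->] [t tP ->]; exists (s ++ t); last by rewrite big_cat.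
  by move=> p; rewrite mem_cat => /orP[/sP|/tP].
- move=> b _ Bb [s sP ->]; exists [seq (p.1, b * p.2) | p <- s].
    by move=> _ /mapP[p /sP[Ip Jp] ->]; split=> //=; exact: JM.
  by rewrite big_map mulr_sumr; apply: eq_bigr => p _ /=; rewrite mulrCA.
Qed.

Lemma bmod_spow B I n : is_subring B -> bmod B (spow B I n).
Proof. by move=> rB; elim: n => [|n IH]; [exact: bmod_refl | exact: bmod_smul]. Qed.

End Products.

(** * Closures of principal ideals and blow-ups *)

Section Stages.
Variables (A : comNzRingType) (Q : comUnitRingType) (f : {rmorphism A -> Q}).
Hypothesis nzd_unit : forall (B : set Q) x,
  range f `<=` B -> nonzerodivisors B x -> x \is a GRing.unit.
Local Notation R := (range f).
Implicit Types (B M X : set Q) (a b q u v w x y z : Q).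

Local Notation int := (integral_elements R).
Local Notation stage := (finite_ext f).

Definition cl B x := ideal_integral_closure B (scale x B).

(* [weakly_Arf] with [total_frac A] replaced by an arbitrary extension [Q] of [A]. *)
Definition warf B := forall x y z, nonzerodivisors B x -> B y -> B z ->
  integral_elements B (y / x) -> integral_elements B (z / x) -> B (y * z / x).

Lemma stage_base B : stage B -> R `<=` B.
Proof. by case. Qed.

Lemma stage_int B : stage B -> integral_elements B = int.
Proof. exact: finite_ext_integralE. Qed.

Lemma stage_sub_int B : stage B -> B `<=` int.
Proof. exact: finite_ext_integral. Qed.

Lemma intM u v : int u -> int v -> int (u * v).
Proof. by case: (integral_subring f) => _ _; apply. Qed.

Lemma nzdP B x : stage B -> nonzerodivisors B x <-> B x /\ x \is a GRing.unit.
Proof.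
move=> sB; split=> [nx|[Bx ux]].
  by split; [case: nx | exact: nzd_unit (stage_base sB) nx].
by split=> // y _ xy; rewrite -[y](mulKr ux) xy mulr0.
Qed.

Lemma warfP B : stage B -> warf B <->
  forall x y z, B x -> x \is a GRing.unit -> B y -> B z -> int (y / x) -> int (z / x) ->
    B (y * z / x).
Proof.
move=> sB; have iE := stage_int sB; split=> [wB x y z Bx ux By Bz Iy Iz|wB x y z nx By Bz].
  by apply: (wB x y z ((nzdP x sB).2 (conj Bx ux)) By Bz); rewrite iE.
have [Bx ux] := (nzdP x sB).1 nx.
by rewrite iE => Iy Iz; exact: wB.
Qed.

Lemma unit_stage B x : stage B -> B x -> x \is a GRing.unit -> int x^-1 -> B x^-1.
Proof.
move=> sB Bx ux Ix; have [rB _ _] := sB.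
apply: (integral_inv rB Bx (mulVr ux)); rewrite (stage_int sB); exact: Ix.
Qed.

Lemma smul_scale1 B n x : is_subring B -> spow B (scale x B) n = scale (x ^+ n) B.
Proof.
move=> rB; have [B1 _ BM] := rB.
elim: n => [|n IH].
  by apply/seteqP; split=> [b Bb|_ [b Bb <-]]; [exists b | ]; rewrite ?mul1r.
rewrite -[LHS]/(smul (scale x B) (spow B (scale x B) n)) IH.
apply/seteqP; split=> [_ [s sP ->]|_ [b Bb <-]].
  rewrite big_seq; have [X0 XD _] := bmod_scale (x ^+ n.+1) (bmod_refl rB).
  apply: (big_ind (scale (x ^+ n.+1) B)) => // -[_ _] /sP[[b Bb <-] [c Bc <-]] /=.
  by exists (b * c); [exact: BM | rewrite exprS; ring].
exists [:: (x, x ^+ n * b)]; last by rewrite big_seq1 exprS mulrA.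
move=> _ /[!inE]/eqP -> /=; split; last by exists b.
by exists 1; rewrite ?mulr1.
Qed.

(** Dividing an equation of degree n by [x ^+ n] turns coefficients in [x ^+ i B] into coefficients
    in [B], and conversely; the indices are reversed because [integral_eq] lists coefficients by
    ascending powers. *)
Lemma clP B x y : stage B -> x \is a GRing.unit -> cl B x y <-> B y /\ int (y / x).
Proof.
move=> sB ux; have [rB _ _] := sB; rewrite -(stage_int sB).
have ps n := smul_scale1 n x rB.
split=> [[By [n [n0 [a aP eq]]]]|[By /(integral_eq _ rB)[m [c [Bc eq]]]]].
  split=> //; apply/(integral_eq _ rB).
  case: n n0 aP eq => // m _ aP eq.
  have /choice[b bP] : forall i : nat, exists b, (0 < i <= m.+1)%N -> B b /\ a i = x ^+ i * b.
    move=> i; have [im|_] := boolP (0 < i <= m.+1)%N; last by exists 0.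
    by have := aP i im; rewrite ps => -[b Bb <-]; exists b.
  exists m, (fun i => if (i <= m)%N then - b (m.+1 - i)%N else 0); split.
    move=> i; case: ifP => im; last exact: subring0.
    apply: subringN => //; apply: (bP _ _).1.
    by apply/andP; split; [rewrite subn_gt0 | exact: leq_subr].
  rewrite expr_div_n; move/eqP: eq; rewrite addr_eq0 => /eqP ->.
  rewrite mulNr big_add1 big_mkord mulr_suml (reindex_inj rev_ord_inj) -sumrN.
  apply: eq_bigr => -[i /= im] _; rewrite subSS -ltnS im.
  have im' : (i <= m)%N by [].
  have e1 : ((m - i).+1 = m.+1 - i)%N by rewrite subSn.
  have [_ ->] : B (b (m - i).+1) /\ a (m - i).+1 = x ^+ (m - i).+1 * b (m - i).+1.
    by apply: bP => /=; exact: leq_subr.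
  rewrite e1 subKn; last exact: ltnW.
  have -> : x ^+ m.+1 = x ^+ (m.+1 - i) * x ^+ i by rewrite -exprD subnK// ltnW.
  have R4 (X b' Y Z W : Q) : - (X * b' * Y * (Z * W)) = - b' * (Y * Z) * (X * W) by ring.
  by rewrite expr_div_n invrM ?unitrX// R4 mulrV ?unitrX// mulr1.
split=> //; exists m.+1; split=> //.
exists (fun i => - (x ^+ i * c (m.+1 - i)%N)).
  move=> i _; rewrite ps; exists (- c (m.+1 - i)%N); last exact: mulrN.
  exact: subringN.
have -> : y ^+ m.+1 = x ^+ m.+1 * (y / x) ^+ m.+1.
  by rewrite expr_div_n mulrCA mulrV ?mulr1// unitrX.
rewrite eq big_add1 big_mkord mulr_sumr (reindex_inj rev_ord_inj) -big_split big1//=.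
move=> -[i /= im] _; rewrite subSS -ltnS in im *.
have im' : (i <= m)%N by [].
have -> : x ^+ m.+1 = x ^+ i.+1 * x ^+ (m - i) by rewrite -exprD addSn subnKC.
have R5 (X X' c' Y Z : Q) : X * X' * (c' * (Y * Z)) + - (X * c') * Y =
  X * c' * Y * (X' * Z - 1) by ring.
by rewrite expr_div_n R5 mulrV ?unitrX// subrr mulr0.
Qed.

Lemma cl_sub B x : cl B x `<=` B.
Proof. by move=> y []. Qed.

Lemma cl_mem B x : stage B -> B x -> x \is a GRing.unit -> cl B x x.
Proof.
move=> sB Bx ux; apply/(clP _ sB ux); rewrite mulrV//; split=> //.
by case: (integral_subring f).
Qed.

Lemma bmod_cl B x : stage B -> x \is a GRing.unit -> bmod B (cl B x).
Proof.
move=> sB ux; have [rB _ _] := sB; have rI := integral_subring f.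
split.
- by apply/(clP _ sB ux); rewrite mul0r; split; exact: subring0.
- move=> u v /(clP _ sB ux)[Bu Iu] /(clP _ sB ux)[Bv Iv].
  by apply/(clP _ sB ux); rewrite mulrDl; split; exact: subringD.
- move=> b u Bb /(clP _ sB ux)[Bu Iu]; apply/(clP _ sB ux); split.
    by case: rB => _ _; apply.
  by rewrite -mulrA; apply: intM => //; exact: (stage_sub_int sB).
Qed.

Lemma cl_eq B x : stage B -> B x -> x \is a GRing.unit -> ~ B x^-1 -> cl B x <> B.
Proof.
move=> sB Bx ux nBx clB; apply: nBx; apply: unit_stage => //.
have [[B1 _ _] _ _] := sB; rewrite -clB in B1.
by have [_] := (clP _ sB ux).1 B1; rewrite mul1r.
Qed.

Lemma Lambda_cl B M : stage B -> Lambda B M <->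
  exists x, [/\ B x, x \is a GRing.unit & M = cl B x].
Proof.
move=> sB; split=> [[x /(nzdP _ sB)[Bx ux] <-]|[x [Bx ux ->]]]; first by exists x.
by exists x => //; apply/nzdP.
Qed.

Lemma bmod_fg B X : noeth A -> stage B -> bmod B X -> X `<=` B -> fg f X.
Proof.
move=> nA [_ AB [s sE]] bX XB; apply: (noeth_sub nA (s := s)).
  exact: bmod_submod AB bX.
by rewrite -sE.
Qed.

Lemma ex_MaxLambda B x : noeth A -> stage B -> B x -> x \is a GRing.unit ->
  ~ B x^-1 -> exists2 M, MaxLambda B M & cl B x `<=` M.
Proof.
move=> nA sB Bx ux nBx; have [_ AB [s sE]] := sB.
have clS y : B y -> y \is a GRing.unit -> submod f (cl B y).
  by move=> By uy; apply: (bmod_submod AB); exact: bmod_cl.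
have : Lambda B (cl B x) by apply/(Lambda_cl _ sB); exists x.
move: (cl_eq sB Bx ux nBx).
pose P X := X <> B -> Lambda B X -> exists2 M, MaxLambda B M & X `<=` M.
apply: (@noeth_ind A Q f nA s P); last by rewrite -sE; exact: cl_sub.
  move=> X sX Xs IH XB LX.
  have [[N [LN NB XN NX]]|noN] :=
    pselect (exists N, [/\ Lambda B N, N <> B, X `<=` N & N <> X]).
    have [|||M MM NM] := IH N _ _ _ NB LN.
    - by have [y [By uy ->]] := (Lambda_cl _ sB).1 LN; exact: clS.
    - by have [y [By uy ->]] := (Lambda_cl _ sB).1 LN; rewrite -sE; exact: cl_sub.
    - by split=> // NX'; apply: NX; exact/seteqP.
    - by exists M => //; exact: subset_trans NM.
  exists X => //; split=> // N LN NB XN; apply: contrapT => NX.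
  by apply: noN; exists N.
exact: clS.
Qed.

Lemma MaxLambdaP B M : stage B -> MaxLambda B M ->
  exists w, [/\ B w, w \is a GRing.unit, M = cl B w & ~ B w^-1].
Proof.
move=> sB [/(Lambda_cl _ sB)[w [Bw uw ME]] MB _]; exists w; split=> // Bw'.
apply: MB; rewrite ME; apply/seteqP; split; first exact: cl_sub.
move=> b Bb; rewrite -[b]mulr1 -(mulVr uw) mulrA.
have [_ _ CM] := bmod_cl sB uw; apply: CM; last exact: cl_mem.
by case: sB => -[_ _ BM] _ _; exact: BM.
Qed.

Lemma warf_reduction B x : stage B -> warf B -> B x -> x \is a GRing.unit ->
  smul (cl B x) (cl B x) = scale x (cl B x).
Proof.
move=> sB wB Bx ux; have [C0 CD CM] := bmod_cl sB ux.
apply/seteqP; split.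
  have [S0 SD _] := bmod_scale x (bmod_cl sB ux).
  apply: smul_min => // u v /(clP _ sB ux)[Bu Iu] /(clP _ sB ux)[Bv Iv].
  exists (u * v / x); last by rewrite mulrCA mulrV ?mulr1.
  apply/(clP _ sB ux); split; first exact: (warfP sB).1.
  have -> : u * v / x / x = (u / x) * (v / x) by ring.
  exact: intM.
by move=> _ [u Cu <-]; apply: smul_mem => //; exact: cl_mem.
Qed.

Lemma colonE M a : M a -> a \is a GRing.unit -> smul M M = scale a M ->
  colon M M = scale a^-1 M.
Proof.
move=> Ma ua MM; apply/seteqP; split=> [c cM|_ [m Mm <-] _ [m' Mm' <-]].
  by exists (c * a); [apply: cM; exists a | rewrite mulrCA mulVr ?mulr1].
have : scale a M (m * m') by rewrite -MM; exact: smul_mem.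
by move=> [n Mn nE]; rewrite -mulrA -nE mulKr.
Qed.

Lemma colon_subring B M : is_subring B -> bmod B M -> is_subring (colon M M).
Proof.
move=> rB [M0 MD MM]; split.
- by move=> _ [m Mm <-]; rewrite mul1r.
- move=> u v uM vM _ [m Mm <-]; rewrite mulrBl; apply: MD.
    by apply: uM; exists m.
  rewrite -mulN1r; apply: MM; last by apply: vM; exists m.
  by apply: subringN => //; case: rB.
- move=> u v uM vM _ [m Mm <-]; rewrite -mulrA; apply: uM.
  by exists (v * m) => //; apply: vM; exists m.
Qed.

(** Finiteness holds because [a] is in [M], so that [M : M] lies in the finitely generated module
    [M / a]. *)
Lemma stage_colon B M a : noeth A -> stage B -> bmod B M -> M `<=` B -> M a ->
  a \is a GRing.unit -> stage (colon M M) /\ B `<=` colon M M.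
Proof.
move=> nA sB bM MB Ma ua; have [rB AB fB] := sB.
have BC : B `<=` colon M M.
  by move=> b Bb _ [m Mm <-]; case: bM => _ _; apply.
have rC := colon_subring rB bM.
split=> //; split=> //; first exact: subset_trans BC.
have [s sE] : fg f (scale a^-1 M) by apply: fg_scale; exact: bmod_fg bM MB.
apply: (noeth_sub nA (s := s)).
  by apply: (bmod_submod (subset_trans AB BC)); exact: bmod_refl.
rewrite -sE => c cM; exists (c * a); last by rewrite mulrCA mulVr ?mulr1.
by apply: cM; exists a.
Qed.

(** Elements of [M : M] are [m / w] with [m] in [M], and their quotients are quotients of elements
    of [B]. Weak Arfness of [B] puts [m' * m'' / m] in [B], and its quotient by [w] is the integral
    element [(m' / m) * (m'' / w)], so it lies in [M] again. *)
Lemma warf_colon B w : noeth A -> stage B -> warf B -> B w ->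
  w \is a GRing.unit -> warf (colon (cl B w) (cl B w)).
Proof.
move=> nA sB wB Bw uw; have bM := bmod_cl sB uw.
have Mw := cl_mem sB Bw uw.
have [sC _] := stage_colon nA sB bM (@cl_sub B w) Mw uw.
have CE := colonE Mw uw (warf_reduction sB wB Bw uw).
apply/(warfP sC) => x y z; rewrite CE.
move=> [m Mm <-] ux [m' Mm' <-] [m'' Mm'' <-].
have um : m \is a GRing.unit by move: ux; rewrite unitrMr ?unitrV.
have red c : (w^-1 * c) / (w^-1 * m) = c / m.
  have R3 (w' c' m1 w0 : Q) : w' * c' * (m1 * w0) = c' * m1 * (w0 * w') by ring.
  by rewrite invrM ?unitrV// invrK R3 mulrV ?mulr1.
rewrite !red => Iy Iz; exists (m' * m'' / m).
  have [Bm Im] := (clP _ sB uw).1 Mm; have [Bm' Im'] := (clP _ sB uw).1 Mm'.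
  have [Bm'' Im''] := (clP _ sB uw).1 Mm''.
  apply/(clP _ sB uw); split; first exact: (warfP sB).1.
  have -> : m' * m'' / m / w = (m' / m) * (m'' / w) by ring.
  exact: intM.
rewrite -[RHS]mulrA red; ring.
Qed.

(** One step of the descent. Since [C = M / a], and [(y/a) (z/a) / (x/a)] is [y z / x] divided by
    [a], membership in [C] says that [y z / x] is in [M], hence in [B]. *)
Lemma step_back B w a x y z : stage B -> B w -> w \is a GRing.unit ->
  cl B w a -> smul (cl B w) (cl B w) = scale a (cl B w) ->
  B x -> x \is a GRing.unit -> cl B x `<=` cl B w -> B y -> B z ->
  int (y / x) -> int (z / x) -> let C := colon (cl B w) (cl B w) in
  [/\ a \is a GRing.unit, C (x / a), C (y / a), C (z / a) &
    C ((y / a) * (z / a) / (x / a)) -> B (y * z / x)].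
Proof.
move=> sB Bw uw Ma MM Bx ux xw By Bz Iy Iz C; have Mw := cl_mem sB Bw uw.
have ua : a \is a GRing.unit.
  have : smul (cl B w) (cl B w) (w * w) by exact: smul_mem.
  rewrite MM => -[m _ e].
  by have : w * w \is a GRing.unit by [rewrite unitrM uw]; rewrite -e unitrM => /andP[].
have CE : C = scale a^-1 (cl B w) by exact: colonE.
have Cd v : cl B w v -> C (v / a) by move=> Mv; rewrite CE; exists v => //; exact: mulrC.
split=> //; [by apply/Cd/xw/cl_mem | by apply/Cd/xw/clP | by apply/Cd/xw/clP |].
rewrite CE => -[m [Bm _] mE].
suff -> : y * z / x = m by [].
rewrite -[m](mulVKr ua) mE invrM ?unitrV// invrK.
have R6 (y' z' a' a1 x1 : Q) : a' * (y' * a1 * (z' * a1) * (a' * x1)) =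
  y' * z' * x1 * (a' * a1) * (a' * a1) by ring.
by rewrite R6 mulrV// !mulr1.
Qed.

Lemma spow_scale B M a n : is_subring B -> bmod B M -> M `<=` B ->
  smul M M = scale a M -> spow B M n.+1 = scale (a ^+ n) M.
Proof.
move=> rB bM MB MM; have [M0 MD MS] := bM; elim: n => [|n IH].
  apply/seteqP; split=> [|_ [m Mm <-]].
    have [S0 SD _] := bmod_scale (a ^+ 0) bM; apply: smul_min => // u v Mu Bv.
    by exists (v * u); [exact: MS | rewrite mul1r mulrC].
  by rewrite mulrC; apply: smul_mem => //; case: rB.
rewrite -[LHS]/(smul M (spow B M n.+1)) IH; apply/seteqP; split.
  have [S0 SD _] := bmod_scale (a ^+ n.+1) bM; apply: smul_min => // u _ Mu [v Mv <-].
  have : smul M M (u * v) by exact: smul_mem.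
  rewrite MM => -[m Mm mE]; exists m => //.
  by rewrite exprSr -mulrA mE; ring.
move=> _ [m Mm <-]; have : smul M M (a * m) by rewrite MM; exists m.
move=> [s sP sE]; exists [seq (p.1, a ^+ n * p.2) | p <- s].
  by move=> _ /mapP[p /sP[Mp Mp'] ->]; split=> //=; exists p.2.
rewrite exprSr -mulrA sE big_map mulr_sumr; apply: eq_bigr => p _ /=; exact: mulrCA.
Qed.

(** The reduction makes every positive power of [M] a unit multiple of [M], so all the colon rings
    of the union agree from the first power on. *)
Lemma blowupE B M a : is_subring B -> bmod B M -> M `<=` B ->
  a \is a GRing.unit -> smul M M = scale a M -> blowup B M = colon M M.
Proof.
move=> rB bM MB ua MM; have [M0 MD MS] := bM; apply/seteqP; split.
  move=> c [[|n] _]; rewrite /=.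
    move=> cB _ [m Mm <-]; apply: MS => //.
    rewrite -[c]mulr1; apply: cB; exists 1 => //; by case: rB.
  rewrite -[smul _ _]/(spow B M n.+1) (spow_scale n rB bM MB MM) => cM _ [m Mm <-].
  have [|m' Mm' mE] := cM (c * (a ^+ n * m)).
    by exists (a ^+ n * m) => //; exists m.
  suff -> : c * m = m' by [].
  by apply: (mulrI (unitrX n ua)); rewrite mE mulrCA.
move=> c cM; exists 1%N => //; rewrite (spow_scale 0 rB bM MB MM).
move=> _ [_ [m Mm <-] <-]; exists (c * m); first by apply: cM; exists m.
exact: mulrCA.
Qed.

(** No reduction of [M] is assumed. The quotients [u / w] of generators of [M] are integral, so they
    lie in a finite extension [B']. Then [M^n] is contained in [w ^+ n B'] and contains [w ^+ n], so
    each [M^n : M^n] is contained in [B']. *)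
Lemma stage_blowup B w : noeth A -> stage B -> B w -> w \is a GRing.unit ->
  stage (blowup B (cl B w)) /\ B `<=` blowup B (cl B w).
Proof.
move=> nA sB Bw uw; set M := cl B w; have [rB AB fB] := sB.
have bM : bmod B M by exact: bmod_cl.
have Mw : M w by exact: cl_mem.
have BC : B `<=` blowup B M.
  move=> b Bb; exists 0%N => // _ [c Bc <-]; by case: rB => _ _; apply.
have inc n : colon (spow B M n) (spow B M n) `<=` colon (spow B M n.+1) (spow B M n.+1).
  move=> c cM _ [_ [s sP ->] <-]; exists [seq (p.1, c * p.2) | p <- s].
    move=> _ /mapP[p /sP[Mp Mp'] ->]; split=> //=.
    by apply: cM; exists p.2.
  by rewrite big_map mulr_sumr; apply: eq_bigr => p _ /=; exact: mulrCA.
have incm n m : (n <= m)%N ->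
    colon (spow B M n) (spow B M n) `<=` colon (spow B M m) (spow B M m).
  move=> /subnK <-; elim: (m - n)%N => // k IH; exact: subset_trans IH (inc _).
have rC n := colon_subring rB (bmod_spow M n rB).
have rbl : is_subring (blowup B M).
  split; first by apply: BC; case: rB.
  - move=> u v [n _ nu] [m _ mv]; exists (maxn n m) => //.
    have [_ + _] := rC (maxn n m); apply.
      exact: incm (leq_maxl _ _) _ nu.
    exact: incm (leq_maxr _ _) _ mv.
  - move=> u v [n _ nu] [m _ mv]; exists (maxn n m) => //.
    have [_ _] := rC (maxn n m); apply.
      exact: incm (leq_maxl _ _) _ nu.
    exact: incm (leq_maxr _ _) _ mv.
split=> //; split=> //; first exact: subset_trans BC.
have [s sE] : fg f M by exact: bmod_fg bM (@cl_sub _ _).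
have [|B' [fB' BB' B's]] := @finite_ext_adjoin_seq _ _ f B [seq u / w | u <- s] sB.
  move=> _ /mapP[u us ->]; have : M u by rewrite sE; exact: lin_mem.
  by move=> /(clP _ sB uw)[].
have [rB' AB' [t tE]] := fB'.
have MwB u : M u -> scale w B' u.
  rewrite sE; apply: lin_min => [|g gs].
    by apply: submod_scale; apply: (bmod_submod AB'); exact: bmod_refl.
  exists (g / w); last by rewrite mulrCA mulrV ?mulr1.
  by apply: B's; apply/mapP; exists g.
have MnB n : spow B M n `<=` scale (w ^+ n) B'.
  elim: n => [b Bb|n IH]; first by exists b; [exact: BB' | rewrite mul1r].
  have [S0 SD _] := bmod_scale (w ^+ n.+1) (bmod_refl rB').
  apply: smul_min => // u v /MwB[u' Bu' <-] /IH[v' Bv' <-].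
  by exists (u' * v'); [case: rB' => _ _; exact | rewrite exprS mulrACA].
have wM n : spow B M n (w ^+ n).
  elim: n => [|n IH]; first by case: rB.
  by rewrite exprS; exact: smul_mem.
apply: (noeth_sub nA (s := t)).
  by apply: (bmod_submod (subset_trans AB BC)); exact: bmod_refl.
rewrite -tE => c [n _ cM]; have [|b B'b bE] := MnB n (c * w ^+ n).
  by apply: cM; exists (w ^+ n).
suff -> : c = b by [].
by apply: (mulIr (unitrX n uw)); rewrite -bE mulrC.
Qed.

Lemma principal_of_mu B M : noeth A -> stage B -> MaxLambda B M ->
  (mu B M < 2)%N -> exists2 c, B c & M = scale c B.
Proof.
move=> nA sB MM muM; have [rB AB fB] := sB; have [B1 BB BM] := rB.
have [w [Bw uw ME _]] := MaxLambdaP sB MM.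
have Mw : M w by rewrite ME; exact: cl_mem.
have bM : bmod B M by rewrite ME; exact: bmod_cl.
have MB : M `<=` B by rewrite ME; exact: cl_sub.
have gen : exists n, generated_by B M n.
  have [s sE] : fg f M by exact: bmod_fg bM MB.
  exists (size s), s => //; apply/seteqP; split.
    move=> _ [c Bc ->]; have [M0 MD MS] := bM; apply: big_ind => // i _.
    by apply: MS => //; rewrite sE; apply: lin_mem; exact: mem_nth.
  rewrite sE lin_span => _ [c Rc ->]; exists c => // i; exact/AB/Rc.
have gen' : exists n, `[< generated_by B M n >] by have [n gn] := gen; exists n; apply/asboolP.
have mn n : generated_by B M n -> (ex_minn gen' <= n)%N.
  by move=> gn; case: ex_minnP => m _; apply; apply/asboolP.
(* [M] is finitely generated, so [mu] is an attained minimum and not the default value 0. *)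
move: muM; have : generated_by B M (mu B M).
  pose S := [set n | generated_by B M n /\ forall k, generated_by B M k -> (n <= k)%N].
  suff /(xgetPex 0%N)[] : exists n, S n by [].
  by exists (ex_minn gen'); split=> //; case: ex_minnP => m /asboolP.
move=> [s <- sE]; case: s sE => [|c [|//]] sE _.
  move: Mw; rewrite -sE => -[d _]; rewrite big_ord0 => w0.
  by move: uw; rewrite w0 unitr0.
exists c.
  by apply: MB; rewrite -sE; exists (fun=> 1); rewrite ?big_ord1 ?mul1r.
rewrite -sE; apply/seteqP; split.
  by move=> _ [d Bd ->]; rewrite big_ord1; exists (d 0%N); rewrite // mulrC.
by move=> _ [b Bb <-]; exists (fun=> b); rewrite // big_ord1 mulrC.
Qed.

(* If every maximal element were principal, noetherian induction on [cl B x] would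
   give [cl B x = xB] for every regular [x], so [B] would be integrally closed. *)
Lemma nonprincipal_MaxLambda B : noeth A -> stage B ->
  (forall q, exists b s, [/\ B b, B s, s \is a GRing.unit & q = b / s]) ->
  B <> integral_elements B -> exists2 M, MaxLambda B M & (2 <= mu B M)%N.
Proof.
move=> nA sB fracB nint; apply: contrapT => noM; apply: nint.
have [rB AB fB] := sB; have [B1 BB BM] := rB.
have princ M : MaxLambda B M -> exists2 c, B c & M = scale c B.
  move=> MM; apply: principal_of_mu => //; rewrite ltnNge; apply/negP => h.
  by apply: noM; exists M.
have main x : B x -> x \is a GRing.unit -> cl B x `<=` scale x B.
  have [s sE] := fB.
  pose P X := forall x, B x -> x \is a GRing.unit -> X = cl B x -> X `<=` scale x B.
  suff main X : submod f X -> X `<=` lin f setT s -> P X.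
    move=> Bx ux; apply: main => //; last by rewrite -sE; exact: cl_sub.
    by apply: (bmod_submod AB); exact: bmod_cl.
  apply: (noeth_ind nA) => {}X sX Xs IH {}x Bx ux XE y Xy.
  have [Bx'|nBx] := pselect (B x^-1).
    exists (x^-1 * y); last by rewrite mulVKr.
    by apply: BM => //; move: Xy; rewrite XE => /cl_sub.
  have [M MM xM] := ex_MaxLambda nA sB Bx ux nBx.
  have [c Bc ME] := princ M MM.
  have [x' Bx' xE] : scale c B x by rewrite -ME; apply: xM; exact: cl_mem.
  have [y' By' yE] : scale c B y by rewrite -ME; apply: xM; rewrite -XE.
  have [uc ux'] : c \is a GRing.unit /\ x' \is a GRing.unit.
    by move: ux; rewrite -xE unitrM => /andP[].
  have yx v : (c * v) / x = v / x'.
    have R4 (c0 v0 x1 c1 : Q) : c0 * v0 * (x1 * c1) = v0 * x1 * (c0 * c1) by ring.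
    by rewrite -xE invrM// R4 mulrV ?mulr1.
  (* Here [x = c x'], and the closure of [x'] is strictly larger: if [x'] were in the closure of
     [x], then 1/c would be integral, [c] a unit of [B], and [M = cB = B]. *)
  have [||||v Bv vE] := IH (cl B x') _ _ _ x' Bx' ux' erefl y'.
  - by apply: (bmod_submod AB); exact: bmod_cl.
  - by rewrite -sE; exact: cl_sub.
  - split.
      rewrite XE => v Xv; have [Bv Iv] := (clP _ sB ux).1 Xv.
      apply/(clP _ sB ux'); split=> //; rewrite -yx -mulrA; apply: intM => //.
      exact: (stage_sub_int sB).
    move=> h; have := h x' (cl_mem sB Bx' ux'); rewrite XE => /(clP _ sB ux)[_].
    rewrite -xE invrM// mulrA mulrV// mul1r => Ic.
    have : M = B.
      rewrite ME; apply/seteqP; split=> [_ [b Bb <-]|b Bb]; first exact: BM.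
      exists (c^-1 * b); last by rewrite mulVKr.
      by apply: BM => //; exact: unit_stage.
    by case: MM.
  - by apply/(clP _ sB ux'); rewrite -yx yE; split=> //; move: Xy; rewrite XE => /(clP _ sB ux)[].
  - by exists v => //; rewrite -yE -vE -xE mulrA.
apply/seteqP; split; first exact: integral_mem.
move=> q Iq; have [b [s [Bb Bs us qE]]] := fracB q.
have [|v Bv vE] := main s Bs us b.
  by apply/(clP _ sB us); rewrite -qE -(stage_int sB).
by rewrite qE -vE mulrC mulKr.
Qed.

End Stages.

(** * Factorizations into nonunits *)

Definition minimal_over (A : comNzRingType) (x : A) (p : set A) :=
  [/\ is_prime p, p x & forall q, is_prime q -> q x -> q `<=` p -> p `<=` q].

Lemma minimal_over_prime (A : comNzRingType) (x : A) p :
  minimal_over x p -> is_prime p.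
Proof. by case. Qed.

Definition principal (A : comNzRingType) (x : A) : set A := scale x setT.

Lemma ideal_principal (A : comNzRingType) (x : A) : ideal (principal x).
Proof. by apply: submod_scale; split. Qed.

Lemma principal_mem (A : comNzRingType) (x : A) : principal x x.
Proof. by exists 1; rewrite ?mulr1. Qed.

Lemma lenle_min_prime (A : comNzRingType) (x : A) : noeth A ->
  exists l, lenle (minimal_over x) idfun setT (principal x) l.
Proof.
move=> nA; apply: lenle_finite => //; first exact: minimal_over_prime.
  exact: ideal_principal.
move=> q pq xq p [_ _ pmin] qp; apply: pmin => //; apply: xq; exact: principal_mem.
Qed.

(** By [krull_pit], localized at a minimal prime [p] of [x], the regular [d] divides a power of [x].
    So a prime inside [p] that contains [d] also contains [x], and equals [p]. *)
Lemma lenle_min_regular (A : comNzRingType) (x d : A) : noeth A ->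
  (forall c, d * c = 0 -> c = 0) ->
  exists l, lenle (minimal_over x) idfun setT (principal d) l.
Proof.
move=> nA rd; apply: lenle_finite => //; first exact: minimal_over_prime.
  exact: ideal_principal.
move=> q pq dq p [pp px pmin] qp; apply: (pmin) => //.
have [l hl] := lenle_min_prime x nA.
have [idp p1 pM] := pp; have [p0 pD pS] := idp.
have sT : bmod [set: A] setT by split.
have [||||||||||J Jb Jd|t [j [b [pt _ E]]]] := @krull_pit A A idfun setT (~` p) [:: 1] x d nA.
- by split.
- by [].
- exact: ideal_full.
- by [].
- exact: p1.
- by move=> u v pu pv /pM[].
- move=> u b pu _ pub; apply: pu; have -> : u = (u + x * b) + (- b) * x by ring.
  by apply: pD => //; exact: pS.
- by [].
- by [].
- by move=> e _; exact: rd.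
- have sJ i : submod idfun (J i) by apply: (@bmod_submod A A idfun setT) (Jb i).1.
  have [||i hi] := lenle_dcc hl (Z := fun n => addm (J n) (principal x)).
  + move=> i; split=> //; first by apply: submod_add => //; exact: ideal_principal.
    exact: addm_subr (sJ i).
  + by move=> i; exact: addmSl.
  have [t pt tP] := hi p (And3 pp px pmin).
  exists i, t => // u Ju; have [|v [_ [Jv [b _ <-] ->]]] := tP u.
    by apply: (addm_subl (ideal_principal x)).
  by exists v, b.
have [_ _ qM] := pq; have : q (t * x ^+ j) by rewrite E; apply: dq; exists b.
by move=> /qM[/qp //|/(primeX pq)].
Qed.

Section Bound.
Variables (A : comNzRingType) (Q : comUnitRingType) (f : {rmorphism A -> Q}).
Hypothesis nA : noeth A.
Hypothesis finj : injective f.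
Hypothesis nzd_unit : forall (B : set Q) x,
  range f `<=` B -> nonzerodivisors B x -> x \is a GRing.unit.
Hypothesis fracQ : forall q : Q, exists a s, f s \is a GRing.unit /\ q = f a / f s.
Local Notation stage := (finite_ext f).
Local Notation R := (range f).

Lemma common_denominator B : stage B -> exists d, f d \is a GRing.unit /\
  forall b, B b -> R (f d * b).
Proof.
move=> [_ _ [s ->]]; elim: s => [|g s [d [ud dP]]].
  exists 1; rewrite rmorph1 unitr1; split=> // b ->; exists 0 => //.
  by rewrite mulr0 rmorph0.
have [a [e [ue gE]]] := fracQ g; exists (d * e); rewrite rmorphM unitrM ud ue.
split=> // _ [c [v [_ sv ->]]]; have [v' _ vE] := dP v sv.
exists (d * c * a + e * v') => //.
rewrite rmorphD !rmorphM vE gE.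
have R4 (d' e' c' a' e1 w : Q) : d' * e' * (c' * (a' * e1) + w) =
  d' * c' * a' * (e' * e1) + e' * (d' * w) by ring.
by rewrite R4 mulrV ?mulr1.
Qed.

Lemma regular_of_unit d : f d \is a GRing.unit -> forall c, d * c = 0 -> c = 0.
Proof.
move=> ud c dc; apply: finj; rewrite rmorph0 -[f c](mulKr ud) -rmorphM dc.
by rewrite rmorph0 mulr0.
Qed.

Variable x : A.
Hypothesis ux : f x \is a GRing.unit.
(** A factor [a] of [x] that is not a unit of [B] remains a nonunit over some minimal prime of [x].
    The dimension hypotheses enter through [contracted_minimal_prime], which proves this. *)
Hypothesis contract : forall B a, stage B -> B a -> a \is a GRing.unit -> ~ B a^-1 ->
  (exists2 b, B b & f x = a * b) ->
  exists2 p, minimal_over x p & forall t b, B b -> f t = a * b -> p t.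

Lemma prod_flatten_nseq (s : seq Q) k :
  \prod_(a <- flatten (nseq k s)) a = (\prod_(a <- s) a) ^+ k.
Proof.
elim: k => [|k IH]; first by rewrite big_nil.
by rewrite /= big_cat /= IH exprS.
Qed.

(** The quotient by [d] contributes [m], and each further factor [x] adds a cyclic quotient killed
    by [x], contributing [l]. *)
Lemma lenle_powers d k m l :
  lenle (minimal_over x) idfun setT (principal d) m ->
  lenle (minimal_over x) idfun setT (principal x) l ->
  lenle (minimal_over x) f R (scale (f d * f x ^+ k) R) (m + k * l).
Proof.
move=> hm hl; have sR := submod_range f.
elim: k => [|k IH].
  rewrite addn0 expr0 mulr1; have sY := submod_scale (f d) sR.
  have h := @lenle_cyclic A (minimal_over x) Q f _ 1 (principal d) m sY.
  apply: lenle_sub (h _ hm) => // [_ [a _ <-]|a [b _ <-]].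
    by apply: (addm_subl sY); exists a; rewrite mulr1.
  by exists (f b); rewrite ?mulr1 ?rmorphM//; exists b.
have sub : scale (f d * f x ^+ k.+1) R `<=` scale (f d * f x ^+ k) R.
  move=> _ [_ [a _ <-] <-]; exists (f (x * a)); first by exists (x * a).
  by rewrite rmorphM exprSr; ring.
have sY := submod_scale (f d * f x ^+ k) sR.
have sY' := submod_scale (f d * f x ^+ k.+1) sR.
rewrite mulSn addnCA addnC; apply: (lenle_add (@minimal_over_prime A x) sY) => //.
  move=> _ [_ [a _ <-] <-]; exists (d * x ^+ k * a) => //.
  by rewrite !rmorphM rmorphXn.
have h := @lenle_cyclic A (minimal_over x) Q f _
  (f d * f x ^+ k) (principal x) l sY'.
apply: lenle_sub (h _ hl) => // [_ [_ [a _ <-] <-]|a [b _ <-]].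
  by apply: (addm_subl sY'); exists a; rewrite mulrC.
exists (f b); first by exists b.
by rewrite rmorphM exprSr; ring.
Qed.

(* With [d] a common denominator of [B], the k-th power of a factorization of [x]
   into [n] nonunits gives a chain of length [n k] between [A] and [d x^k A], whose
   length is at most [m + k l]; let [k] tend to infinity. *)
Lemma nonunit_factorization_bound : exists l, forall B s x', stage B ->
  (forall a, a \in s -> [/\ B a, a \is a GRing.unit & ~ B a^-1]) -> B x' ->
  f x = \prod_(a <- s) a * x' -> (size s <= l)%N.
Proof.
have [l hl] := lenle_min_prime x nA; exists l => B s x' sB sP Bx' xE.
rewrite leqNgt; apply/negP => ls.
have [d [ud dP]] := common_denominator sB.
have [m hm] := lenle_min_regular x nA (regular_of_unit ud).
have [rB AB fB] := sB; have [B1 BB BM] := rB; have bB := bmod_refl rB.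
have prodB (r : seq Q) : (forall a, a \in r -> B a) -> B (\prod_(a <- r) a).
  by move=> rP; rewrite big_seq; apply: (big_ind B).
suff main k : (size s * k <= m + k * l)%N.
  (* With [k = m + 1] and at least [l + 1] factors, [(l + 1) (m + 1)] already exceeds
     [m + (m + 1) l]. *)
  have := main m.+1; rewrite leqNgt => /negP; apply.
  rewrite (mulnC m.+1); apply: leq_trans (leq_mul ls (leqnn m.+1)).
  by rewrite mulSn ltn_add2r.
pose ss := flatten (nseq k s).
have ssz : size ss = (size s * k)%N by rewrite /ss size_flatten /shape map_nseq sumn_nseq.
have ssP a : a \in ss -> a \in s by move=> /flattenP[r /nseqP[-> _]].
pose g i := \prod_(a <- take i ss) a.
pose Z i := scale (f d * g i) B.
have gB i : B (g i) by apply: prodB => a /mem_take /ssP /sP[].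
have gu i : g i \is a GRing.unit.
  rewrite /g big_seq; apply: rpred_prod => a /mem_take /ssP /sP[] //.
have gS i : (i < size s * k)%N -> g i.+1 = g i * ss`_i.
  by move=> ik; rewrite /g (take_nth 0) ?ssz// -cats1 big_cat big_seq1.
rewrite -ssz.
have hZ := @lenle_powers d k m l hm hl; apply: leq_trans (hZ Z (size ss) _ _).
- rewrite -[X in (X <= _)%N]card_ord -sum1_card; apply: leq_sum => -[i /= ik] _.
  (* A negligible step at [p] gives [t] outside [p] with [t d g_i] in [d g_(i+1) B]. Cancelling the
     unit [d g_i] leaves [t] in [aB] for the factor [a] at position [i], which [contract]
     forbids. *)
  rewrite asboolT// => neg; rewrite ssz in ik.
  have ssi : ss`_i \in ss by rewrite mem_nth// ssz.
  have [Bi ui nBi] := sP _ (ssP _ ssi).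
  have [|p Fp pT] := contract sB Bi ui nBi.
    have si := ssP _ ssi; exists (\prod_(a <- rem ss`_i s) a * x').
      by apply: BM => //; apply: prodB => a /mem_rem /sP[].
    by rewrite xE (big_rem _ si)/= mulrA.
  have [t pt tP] := neg p Fp; apply: pt.
  have [|b Bb bE] := tP (f d * g i); first by exists 1; rewrite ?mulr1.
  apply: (pT _ b Bb); have udg : f d * g i \is a GRing.unit by rewrite unitrM ud gu.
  apply: (mulrI udg); rewrite [LHS]mulrC -bE gS//; ring.
- move=> i ik; have bZ := bmod_scale (f d * g i) bB; split.
  + exact: bmod_submod AB bZ.
  + move=> _ [_ [r _ <-] <-]; exists (\prod_(a <- drop i ss) a * x' ^+ k * f r).
      apply: (BM); last by apply: AB; exists r.
      apply: (BM); last exact: subringX.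
      by apply: prodB => a /mem_drop /ssP /sP[].
    rewrite xE exprMn -prod_flatten_nseq -/ss -{2}(cat_take_drop i ss) big_cat /=.
    by rewrite -/(g i); ring.
  + by move=> _ [b Bb <-]; rewrite -mulrA; apply: dP; exact: BM.
- move=> i ik _ [b Bb <-]; rewrite ssz in ik; have ssi : ss`_i \in ss by rewrite mem_nth// ssz.
  have [Bi _ _] := sP _ (ssP _ ssi).
  by exists (ss`_i * b); [exact: BM | rewrite gS//; ring].
Qed.

Local Notation int := (integral_elements R).

(* [(B, x', y', z')] is replaced by [(M : M, x'/a, y'/a, z'/a)] where [M] is a
   maximal element containing the closure of [x'] and [M ^ 2 = a M]. *)
Lemma warf_of_reductions (good : set Q -> Prop) :
  (forall B, good B -> stage B) ->
  (forall B M, good B -> MaxLambda B M -> exists2 a, M a & smul M M = scale a M) ->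
  (forall B M, good B -> B <> integral_elements B -> MaxLambda B M ->
     (2 <= mu B M)%N -> good (blowup B M)) ->
  forall B y z, good B -> B (f x) -> B y -> B z -> int (y / f x) -> int (z / f x) ->
    B (y * z / f x).
Proof.
move=> gstage gred gblow B0 y0 z0 gB0 B0x B0y B0z Iy0 Iz0.
have [l hl] := nonunit_factorization_bound.
(* The list [s] holds the nonunit factors already split off, and [i] counts how many more are
   awaited; at [i = 0] there are [l.+1] of them, against the bound. *)
suff main i : forall B s x' y z, good B ->
    (forall a, a \in s -> [/\ B a, a \is a GRing.unit & ~ B a^-1]) ->
    f x = \prod_(a <- s) a * x' -> B x' -> B y -> B z -> int (y / x') ->
    int (z / x') -> (size s + i = l.+1)%N -> B (y * z / x').
  apply: (main l.+1 B0 [::]) => //; last by rewrite big_nil mul1r.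
elim: i => [|i IH] B s x' y z gB sP xE Bx' By Bz Iy Iz si.
  by have := hl B s x' (gstage _ gB) sP Bx' xE; rewrite addn0 in si; rewrite si ltnn.
have sB := gstage _ gB; have [rB AB fB] := sB; have [B1 BB BM] := rB.
have ux' : x' \is a GRing.unit by move: ux; rewrite xE unitrM => /andP[].
have [Bx'1|nBx'] := pselect (B x'^-1); first by apply: (BM) => //; exact: BM.
have [BI|nBI] := pselect (B = integral_elements B).
  have BI' : B = int by rewrite BI; exact: finite_ext_integralE.
  rewrite mulrAC; apply: BM => //; rewrite BI'; exact: Iy.
have [M MM xM] := ex_MaxLambda nzd_unit nA sB Bx' ux' nBx'.
have [w [Bw uw ME nBw]] := MaxLambdaP nzd_unit sB MM.
have [a Ma Mred] := gred B M gB MM.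
have bM : bmod B M by rewrite ME; exact: (bmod_cl sB uw).
have MB : M `<=` B by rewrite ME; exact: cl_sub.
have [ua Cx Cy Cz back] : [/\ a \is a GRing.unit, colon M M (x' / a),
    colon M M (y / a), colon M M (z / a) &
    colon M M ((y / a) * (z / a) / (x' / a)) -> B (y * z / x')].
  by rewrite ME in xM Ma Mred *; exact: (step_back sB Bw uw Ma Mred).
have gC : good (colon M M).
  have [mu2|mu2] := leqP 2 (mu B M).
    by rewrite -(blowupE rB bM MB ua Mred); exact: gblow.
  (* A principal [M] is not blown up, but then [M : M = B]: the ring stays the same, while [x']
     still loses the nonunit factor [a]. *)
  have [c Bc McB] := principal_of_mu nzd_unit nA sB MM mu2.
  suff -> : colon M M = B by [].
  have uc : c \is a GRing.unit.
    have : scale c B w by rewrite -McB ME; exact: (cl_mem sB Bw uw).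
    by move=> [v _ vE]; move: uw; rewrite -vE unitrM => /andP[].
  apply/seteqP; split=> [q qM|b Bb _ [m Mm <-]]; last by case: bM => _ _; apply.
  have : scale c B (q * c).
    by rewrite -McB; apply: qM; exists c => //; rewrite McB; exists 1; rewrite ?mulr1.
  move=> [b Bb bE]; suff -> : q = b by [].
  by apply: (mulIr uc); rewrite -bE mulrC.
have sC := gstage _ gC; have [_ BC] := stage_colon nA sB bM MB Ma ua.
have Ba : B a by exact: MB.
have nB b : B b -> b \is a GRing.unit -> ~ B b^-1 -> ~ colon M M b^-1.
  move=> Bb ub nb Cb; apply: nb; apply: (unit_stage sB) => //.
  exact: (stage_sub_int sC).
(* As [a] is in the closure of [w], the quotient [a / w] is integral; an inverse of [a] in [B] would
   make 1/w integral and [w] a unit of [B]. *)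
have nBa : ~ B a^-1.
  move=> Ba'; apply: nBw; apply: (unit_stage sB) => //.
  have -> : w^-1 = (a / w) * a^-1 by rewrite mulrAC mulrV ?mul1r.
  apply: intM; last exact: (stage_sub_int sB).
  by move: Ma; rewrite ME => /(clP _ sB uw)[].
have fr v : (v / a) / (x' / a) = v / x'.
  have R4 (v0 a1 a0 x1 : Q) : v0 * a1 * (a0 * x1) = v0 * x1 * (a0 * a1) by ring.
  by rewrite invrM ?unitrV// invrK R4 mulrV ?mulr1.
apply: back; apply: (IH (colon M M) (a :: s)) => //.
- move=> b; rewrite inE => /orP[/eqP ->|/sP[Bb ub nb]].
    by split=> //; [exact: BC | exact: nB].
  by split=> //; [exact: BC | exact: nB].
- rewrite xE big_cons.
  have R4 (a0 p x0 a1 : Q) : a0 * p * (x0 * a1) = p * x0 * (a0 * a1) by ring.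
  by rewrite R4 mulrV ?mulr1.
- by rewrite fr.
- by rewrite fr.
- by rewrite -si /= addnS addSn.
Qed.

End Bound.

(** * The adic completion *)

Section Adic.
Variables (L : comNzRingType) (m : idealr L).
Local Notation adic := (Completion.adic m).

Lemma adic_ideal k : ideal (adic k).
Proof.
apply: (bmod_submod (B := setT)) => //; exact: bmod_spow (setT_subring L).
Qed.

Lemma adic_mul k l a b : adic k a -> adic l b -> adic (k + l) (a * b).
Proof.
elim: k a => [|k IH] a ak bl; first by apply: idealM => //; exact: adic_ideal.
have [X0 XD XM] := adic_ideal (k.+1 + l).
suff : [set u | adic (k.+1 + l) (u * b)] a by [].
move: a ak; apply: smul_min; rewrite /= ?mul0r//.
  by move=> u v ub vb; rewrite mulrDl; exact: XD.
by move=> u v mu /IH/(_ bl) kv; rewrite -mulrA; exact: smul_mem.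
Qed.

Lemma adic_split k l a : adic (k + l) a ->
  smul (adic k) (adic l) a.
Proof.
elim: k a => [|k IH] a ak.
  by rewrite -[a]mul1r; exact: smul_mem.
have [X0 XD XM] := bmod_smul (adic k.+1) (bmod_spow [set` m] l (setT_subring L)).
move: a ak; apply: smul_min => // u v mu /IH kv.
suff : [set w | smul (adic k.+1) (adic l) (u * w)] v by [].
move: v kv; apply: smul_min; rewrite /= ?mulr0//.
  by move=> w w' h h'; rewrite mulrDr; exact: XD.
by move=> w w' kw lw'; rewrite mulrA; apply: smul_mem => //; exact: smul_mem.
Qed.

Lemma adicS k : adic k.+1 `<=` adic k.
Proof.
apply: smul_min; have [X0 XD XM] := adic_ideal k; rewrite //=.
by move=> u v _ kv; exact: XM.
Qed.

Lemma adic_leq k l : (k <= l)%N -> adic l `<=` adic k.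
Proof.
move=> /subnK <-; elim: (l - k)%N => // n IH.
exact: subset_trans (@adicS _) IH.
Qed.

Lemma adic1 a : a \in m -> adic 1 a.
Proof. by move=> ma; rewrite -[a]mulr1; exact: smul_mem. Qed.

Lemma adic1_mem a : adic 1 a -> a \in m.
Proof.
move: a; apply: smul_min; [exact: idealr0 | by move=> *; exact: rpredD |].
by move=> u v mu _; rewrite mulrC; exact: idealMr.
Qed.

End Adic.

Local Coercion Completion.cseq : Completion.cauchy_seq >-> Funclass.

Section CompletionFiltration.
Variables (L : comNzRingType) (m : idealr L).
Local Notation adic := (Completion.adic m).
Local Notation H := (completion m).
Local Notation cseq := (Completion.cauchy_seq m).

Definition comp_pi (c : cseq) : H := \pi_H c.

Lemma comp_piB c c' : comp_pi (c - c') = comp_pi c - comp_pi c'.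
Proof. by rewrite /comp_pi !piE. Qed.

Lemma comp_piD c c' : comp_pi (c + c') = comp_pi c + comp_pi c'.
Proof. by rewrite /comp_pi !piE. Qed.

Lemma comp_piM c c' : comp_pi (c * c') = comp_pi c * comp_pi c'.
Proof. by rewrite /comp_pi !piE. Qed.

Lemma comp_pi1 : comp_pi 1 = 1.
Proof. by rewrite /comp_pi piE. Qed.

Lemma comp_pi0 : comp_pi 0 = 0.
Proof. by rewrite /comp_pi piE. Qed.

Lemma comp_piP (z : H) : exists c, z = comp_pi c.
Proof. by exists (repr z); rewrite /comp_pi reprK. Qed.

Definition tends0 (c : nat -> L) := forall k, exists N : nat, forall i, (N <= i)%N -> adic k (c i).

Lemma comp_pi_eq0 c : comp_pi c = 0 <-> tends0 c.
Proof.
rewrite -comp_pi0 /comp_pi; split.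
  by move=> /eqP; rewrite -Quotient.idealrBE subr0 => /asboolP.
by move=> h; apply/eqP; rewrite -Quotient.idealrBE subr0; exact/asboolP.
Qed.

Definition comp_seq (z : nat -> L) (zP : forall k, exists N : nat, forall i j,
  (N <= i)%N -> (N <= j)%N -> adic k (z i - z j)) : cseq :=
  Completion.CauchySeq (asboolT zP).

Lemma const_cauchy (a : L) k : exists N : nat, forall i j,
  (N <= i)%N -> (N <= j)%N -> adic k ((fun=> a) i - (fun=> a) j).
Proof. by exists 0%N => i j _ _; rewrite subrr; exact: Completion.adic0. Qed.

Definition comp_inj (a : L) : H := comp_pi (comp_seq (const_cauchy a)).

Lemma cseq_eq (c c' : cseq) : (forall i, c i = c' i) -> c = c'.
Proof. by move=> e; apply: val_inj; exact: funext. Qed.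

Lemma comp_inj_is_zmod_morphism : zmod_morphism comp_inj.
Proof. by move=> a b; rewrite /comp_inj -comp_piB; congr comp_pi; exact: cseq_eq. Qed.

Lemma comp_inj_is_monoid_morphism : monoid_morphism comp_inj.
Proof.
split; first by rewrite /comp_inj -comp_pi1; congr comp_pi; exact: cseq_eq.
by move=> a b; rewrite /comp_inj -comp_piM; congr comp_pi; exact: cseq_eq.
Qed.

HB.instance Definition _ :=
  GRing.isZmodMorphism.Build L H comp_inj comp_inj_is_zmod_morphism.
HB.instance Definition _ :=
  GRing.isMonoidMorphism.Build L H comp_inj comp_inj_is_monoid_morphism.

(* The closure of [m ^ k] in the completion. *)
Definition filt k : set H := [set z | exists2 c, z = comp_pi c &
  exists N : nat, forall i, (N <= i)%N -> adic k (c i)].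

Lemma filtP k c : filt k (comp_pi c) <-> exists N : nat, forall i, (N <= i)%N -> adic k (c i).
Proof.
split=> [[c' cc' [N NP]]|h]; last by exists c.
have [|N' N'P] := (comp_pi_eq0 (c - c')).1 _ k; first by rewrite comp_piB cc' subrr.
exists (maxn N N') => i; rewrite geq_max => /andP[Ni N'i].
have [_ XD _] := adic_ideal m k; rewrite -[c i](subrK (c' i)); apply: XD.
  exact: N'P.
exact: NP.
Qed.

Lemma filt_ideal k : ideal (filt k).
Proof.
have [X0 XD XM] := adic_ideal m k; split.
- by rewrite -comp_pi0; apply/filtP; exists 0%N => i _; exact: X0.
- move=> u v; have [c ->] := comp_piP u; have [c' ->] := comp_piP v.
  move=> /filtP[N NP] /filtP[N' N'P]; rewrite -comp_piD; apply/filtP.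
  exists (maxn N N') => i; rewrite geq_max => /andP[/NP ? /N'P ?]; exact: XD.
- move=> u v; have [c ->] := comp_piP u; have [c' ->] := comp_piP v.
  move=> /filtP[N NP]; rewrite -comp_piM; apply/filtP.
  by exists N => i /NP; exact: XM.
Qed.

Lemma filt_mul k l u v : filt k u -> filt l v -> filt (k + l) (u * v).
Proof.
have [c ->] := comp_piP u; have [c' ->] := comp_piP v.
move=> /filtP[N NP] /filtP[N' N'P]; rewrite -comp_piM; apply/filtP.
exists (maxn N N') => i; rewrite geq_max => /andP[/NP ? /N'P ?]; exact: adic_mul.
Qed.

Lemma filt_leq k l : (k <= l)%N -> filt l `<=` filt k.
Proof.
move=> kl u; have [c ->] := comp_piP u => /filtP[N NP]; apply/filtP.
by exists N => i /NP; exact: adic_leq.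
Qed.

Lemma filt0 u : filt 0 u.
Proof. by have [c ->] := comp_piP u; apply/filtP; exists 0%N. Qed.

Lemma filt_sep u : (forall k, filt k u) -> u = 0.
Proof.
have [c ->] := comp_piP u => h; apply/comp_pi_eq0 => k; exact/filtP/h.
Qed.

Lemma filt_dense u k : exists a, filt k (u - comp_inj a).
Proof.
have [c ->] := comp_piP u; have /asboolP/(_ k)[N NP] := Completion.cauchy_seqP c.
exists (c N); rewrite /comp_inj -comp_piB; apply/filtP.
by exists N => i Ni; exact: NP.
Qed.

Lemma filt_inj k a : filt k (comp_inj a) <-> adic k a.
Proof.
rewrite /comp_inj; split=> [/filtP[N /(_ N (leqnn N))] //|ka].
by apply/filtP; exists 0%N.
Qed.

Lemma filt_limit (z : nat -> L) : (forall n, adic n (z n.+1 - z n)) ->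
  exists u, forall n, filt n (u - comp_inj (z n)).
Proof.
move=> zP; have zd n i : (n <= i)%N -> adic n (z i - z n).
  move=> /subnK <-; have [X0 XD XM] := adic_ideal m n.
  elim: (i - n)%N => [|k IH]; first by rewrite subrr.
  have -> : z (k.+1 + n)%N - z n = (z (k + n).+1 - z (k + n)%N) + (z (k + n)%N - z n).
    by rewrite addSn; ring.
  by apply: XD => //; apply: (adic_leq (leq_addl k n)); exact: zP.
have zc : forall k, exists N : nat, forall i j,
    (N <= i)%N -> (N <= j)%N -> adic k (z i - z j).
  move=> k; exists k => i j ki kj.
  have -> : z i - z j = (z i - z k) - (z j - z k) by ring.
  by apply: (submodB (adic_ideal m k)); exact: zd.
exists (comp_pi (comp_seq zc)) => n; rewrite /comp_inj -comp_piB; apply/filtP.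
by exists n => i ni; exact: zd.
Qed.

(** Replacing each partial sum by an element of [L] up to [filt n] reduces convergence in the
    completion to Cauchy sequences of [L]. *)
Lemma filt_series (g : nat -> H) : (forall n, filt n (g n)) ->
  exists u, forall n, filt n (u - \sum_(i < n) g i).
Proof.
move=> gP; have /choice[s sP] : forall n, exists a, filt n (\sum_(i < n) g i - comp_inj a).
  by move=> n; exact: filt_dense.
have [|u uP] := @filt_limit s.
  move=> n; apply/filt_inj; rewrite rmorphB.
  have -> : comp_inj (s n.+1) - comp_inj (s n) = g n - (\sum_(i < n.+1) g i - comp_inj (s n.+1))
      + (\sum_(i < n) g i - comp_inj (s n)) by rewrite big_ord_recr /=; ring.
  have [_ XD _] := filt_ideal n; apply: XD => //.
  by apply: (submodB (filt_ideal n)) => //; apply: (filt_leq (leqnSn n)).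
exists u => n; have -> : u - \sum_(i < n) g i =
    (u - comp_inj (s n)) - (\sum_(i < n) g i - comp_inj (s n)) by ring.
exact: (submodB (filt_ideal n)).
Qed.

(** Summing coefficient by coefficient keeps the limit a combination of the fixed generators:
    finitely generated ideals of the completion are closed. *)
Lemma filt_lin_limit (X : set H) (g : seq H) (u : nat -> H) : ideal X ->
  (forall h, h \in g -> X h) -> (forall n, lin idfun (filt n) g (u n)) ->
  exists2 w, X w & forall n, filt n (w - \sum_(i < n) u i).
Proof.
move=> idX; have [X0 XD XM] := idX; elim: g u => [|h g IH] u gX uP.
  exists 0 => // n; rewrite big1; first by rewrite subrr; case: (filt_ideal n).
  by move=> i _; exact: uP.
have /choice[cv cvP] : forall n, exists p : H * H, [/\ filt n p.1,
    lin idfun (filt n) g p.2 & u n = p.1 * h + p.2].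
  by move=> n; have [a [v [na gv uE]]] := uP n; exists (a, v).
have [||w Xw wP] := IH (fun n => (cv n).2).
- by move=> k kg; apply: gX; rewrite inE kg orbT.
- by move=> n; case: (cvP n).
have [|r rP] := @filt_series (fun n => (cv n).1).
  by move=> n; case: (cvP n).
exists (r * h + w).
  by apply: XD => //; apply: XM; apply: gX; exact: mem_head.
move=> n; have -> : r * h + w - \sum_(i < n) u i =
   h * (r - \sum_(i < n) (cv i).1) + (w - \sum_(i < n) (cv i).2).
  under eq_bigr => i _ do have [_ _ ->] := cvP i.
  by rewrite big_split /= -mulr_suml; ring.
have [_ FD FM] := filt_ideal n; apply: FD => //; exact: FM.
Qed.

Lemma lin_comp_inj n (g : seq L) a : lin idfun (adic n) g a ->
  lin idfun (filt n) [seq comp_inj h | h <- g] (comp_inj a).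
Proof.
elim: g a => [_ ->|h g IH _ [b [v [nb /IH gv ->]]]] /=; first exact: rmorph0.
by exists (comp_inj b), (comp_inj v); split=> //; [exact/filt_inj | rewrite rmorphD rmorphM].
Qed.

(** [filt k] is generated by the image of [m ^ k]. Successive approximations of [u] differ by
    elements of [m ^ (n + k)], which are combinations of generators of [m ^ k] with coefficients in
    [m ^ n]; [filt_lin_limit] sums them. *)
Lemma filt_min (X : set H) k : noeth L -> ideal X ->
  (forall a, adic k a -> X (comp_inj a)) -> filt k `<=` X.
Proof.
move=> nL idX aX u ku; have [g gE] := nL _ (adic_ideal m k).
have /choice[a aP] : forall n, exists a, filt (n + k) (u - comp_inj a).
  by move=> n; exact: filt_dense.
have [||w Xw wP] := @filt_lin_limit X [seq comp_inj h | h <- g]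
    (fun n => comp_inj (a n.+1 - a n)) idX.
- by move=> _ /mapP[h hg ->]; apply: aX; rewrite gE; exact: lin_mem.
- move=> n; apply: lin_comp_inj; have : adic (n + k) (a n.+1 - a n).
    apply/filt_inj; rewrite rmorphB.
    have -> : comp_inj (a n.+1) - comp_inj (a n) =
      (u - comp_inj (a n)) - (u - comp_inj (a n.+1)) by ring.
    apply: (submodB (filt_ideal _)) => //; apply: filt_leq (aP n.+1).
    by rewrite leq_add2r.
  move=> /adic_split; move: (_ - _); apply: smul_min.
  + by apply: lin0; exact: Completion.adic0.
  + by move=> v v'; apply: linD => b c; have [_ + _] := adic_ideal m n; apply.
  + move=> v v' nv; rewrite gE; apply: linM => b _; rewrite mulrC.
    by have [_ _] := adic_ideal m n; apply.
- have [_ XD XM] := idX.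
  have ka0 : adic k (a 0%N).
    apply/filt_inj; have -> : comp_inj (a 0%N) = u - (u - comp_inj (a 0%N)) by ring.
    by apply: (submodB (filt_ideal _)) => //; exact: (aP 0%N).
  have -> : u = w + comp_inj (a 0%N).
    apply/eqP; rewrite -subr_eq0; apply/eqP; apply: filt_sep => n.
    have := wP n; rewrite -(rmorph_sum _ _ _ (fun i : 'I_n => a i.+1 - a i)) -(big_mkord xpredT (fun i => a i.+1 - a i)) telescope_sumr// rmorphB => wn.
    have -> : u - (w + comp_inj (a 0%N)) = (u - comp_inj (a n)) -
      (w - (comp_inj (a n) - comp_inj (a 0%N))) by ring.
    by apply: (submodB (filt_ideal _)) => //; apply: filt_leq (aP n); exact: leq_addr.
  by apply: XD => //; exact: aX.
Qed.

End CompletionFiltration.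

(** * Idempotents in the completion of a finite extension *)

Lemma lin_ind (A E : comNzRingType) (f : {rmorphism A -> E}) (I : set A) s
    (X : set E) : X 0 -> (forall u v, X u -> X v -> X (u + v)) ->
  (forall a g, I a -> g \in s -> X (f a * g)) -> lin f I s `<=` X.
Proof.
move=> X0 XD; elim: s => [_ _ -> //|g s IH Xs _ [a [v [Ia sv ->]]]].
apply: XD; first by apply: Xs => //; exact: mem_head.
by apply: IH sv => b h Ib hs; apply: Xs => //; rewrite inE hs orbT.
Qed.

Section LocalLength.
Variables (L : comNzRingType) (m : idealr L).
Hypothesis nL : noeth L.
Hypothesis unitL : forall t, t \notin m -> exists u, u * t = 1.

Definition only_m : set (set L) := [set [set` m]].

Lemma only_m_prime p : only_m p -> is_prime p.
Proof.
move=> ->; split; [exact: idealr_ideal | by rewrite /= idealr1 |].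
move=> a b /= mab; have [ma|/unitL[u ua]] := boolP (a \in m); first by left.
by right; rewrite -[b]mul1r -ua -mulrA; exact: idealMr.
Qed.

Lemma lenle_local (I : set L) : ideal I ->
  (forall t, t \in m -> exists N, I (t ^+ N)) ->
  exists n, lenle only_m idfun setT I n.
Proof.
move=> idI mI; apply: lenle_finite => //; first exact: only_m_prime.
move=> q pq Iq p -> qm t mt; have [N tN] := mI t mt.
by apply: (primeX pq (n := N)); exact: Iq.
Qed.

Lemma negl_local (E : comNzRingType) (f : {rmorphism L -> E}) (X Y : set E) :
  submod f Y -> negl only_m f X Y -> X `<=` Y.
Proof.
move=> [_ _ YM] /(_ _ erefl)[t /negP/unitL[u ut] tP] v Xv.
by rewrite -[v]mul1r -(rmorph1 f) -ut rmorphM -mulrA; apply: YM; exact: tP.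
Qed.

(** Noetherian induction: if [I] is not prime, powers of m lie in two larger ideals [I + aL] and
    [I + bL] whose product is in [I]. *)
Lemma adic_sub_radical (I : set L) : ideal I ->
  (forall t, t \in m -> exists N, I (t ^+ N)) ->
  exists M, Completion.adic m M `<=` I.
Proof.
move: I; apply: ideal_ind => // I idI IH mI.
have {}IH J : ideal J -> I `<=` J -> ~ J `<=` I ->
    exists M, Completion.adic m M `<=` J.
  by move=> idJ IJ JI; apply: IH => // t /mI[N tN]; exists N; exact: IJ.
have [I1|I1] := pselect (I 1).
  by exists 0%N => b _; rewrite -[b]mulr1; exact: idealM.
have [pI|] := pselect (forall a b, I (a * b) -> I a \/ I b).
  exists 1%N => b /adic1_mem /mI[N]; exact: primeX.
move=> /existsNP[a /existsNP[b /not_implyP[Iab /not_orP[Ia Ib]]]].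
have idP c : ideal (addm (principal c) I).
  by apply: submod_add => //; exact: ideal_principal.
have big c : ~ I c -> exists M, Completion.adic m M `<=` addm (principal c) I.
  move=> Ic; apply: IH => //; first by apply: addm_subr; exact: ideal_principal.
  move=> /(_ c) h; apply: Ic; apply: h; apply: (addm_subl idI).
  exact: principal_mem.
have [M1 h1] := big a Ia; have [M2 h2] := big b Ib.
have [I0 ID IM] := idI.
exists (M1 + M2)%N => c /adic_split; move: c.
apply: smul_min => // u v /h1[_ [i [[a' _ <-] Ii ->]]] /h2[_ [i' [[b' _ <-] Ii' ->]]].
have -> : (a * a' + i) * (b * b' + i') =
  (a' * b') * (a * b) + ((a * a' + i) * i' + (b * b') * i) by ring.
by apply: (ID); [exact: IM | apply: (ID); exact: IM].
Qed.

End LocalLength.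

Section IdempotentLimit.
Variables (L E : comNzRingType) (m : idealr L) (f : {rmorphism L -> E}).
Hypothesis nL : noeth L.
Hypothesis unitL : forall t, t \notin m -> exists u, u * t = 1.
Hypothesis finj : injective f.
Variables (B : set E) (bs : seq E).
Hypothesis rB : is_subring B.
Hypothesis AB : range f `<=` B.
Hypothesis BE : B = lin f setT bs.
Variables (d x : L) (a : E).
Hypothesis dB : forall b, B b -> exists l, f d * b = f l.
Hypothesis rd : forall e, f d * e = 0 -> e = 0.
Hypothesis mx : x \in m.
Hypothesis rx : forall e, f x * e = 0 -> e = 0.
Hypothesis Ba : B a.
Hypothesis na : forall b, B b -> a * b <> 1.
Hypothesis ma : forall t, t \in m -> exists N b, B b /\ f t ^+ N = a * b.

Local Notation adic := (Completion.adic m).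

Let B1 : B 1. Proof. by case: rB. Qed.
Let BB u v : B u -> B v -> B (u - v). Proof. by case: rB => _ + _; apply. Qed.
Let BM u v : B u -> B v -> B (u * v). Proof. by case: rB => _ _; apply. Qed.
Let BD u v : B u -> B v -> B (u + v). Proof. exact: subringD. Qed.
Let BN u : B u -> B (- u). Proof. exact: subringN. Qed.
Let BX u n : B u -> B (u ^+ n). Proof. exact: subringX. Qed.
Let Bf l : B (f l). Proof. by apply: AB; exists l. Qed.
Let sB : submod f B. Proof. exact: bmod_submod AB (bmod_refl rB). Qed.

(* [B] has dimension one at the primes containing [a], where [1 + a b0] is a unit. *)
Lemma divides_unit_power : exists b0 j b,
  [/\ B b0, B b & (1 + a * b0) * a ^+ j = f x * b].
Proof.
(* Krull's theorem is used with [a] as the element modulo which the chain condition holds and [f x]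
   as the regular element. *)
pose U := [set u | exists2 b, B b & u = 1 + a * b].
have saB : submod f (scale a B) by apply: submod_scale.
pose T := [set l | scale a B (f l)].
have idT : ideal T.
  have [T0 TD TM] := saB; split; rewrite /T /=; first by rewrite rmorph0.
    by move=> u v Tu Tv; rewrite rmorphD; exact: TD.
  by move=> u v Tv; rewrite rmorphM; exact: TM.
have [n hn] : exists n, lenle (only_m m) idfun setT T n.
  apply: lenle_local => // t /ma[N [b [Bb tE]]]; exists N; rewrite /T /= rmorphXn.
  by exists b.
have [|||||||||t [j [b [[b0 Bb0 ->] Bb E']]]] := @krull_pit L E f B U bs a (f x) nL rB AB.
- by rewrite BE.
- by move=> _ [b Bb ->]; apply: BD => //; exact: BM.
- by exists 0; [exact: subring0 | rewrite mulr0 addr0].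
- move=> _ _ [b Bb ->] [c Bc ->]; exists (b + c + a * b * c); last by ring.
  by apply: BD; [exact: BD | apply: (BM) => //; exact: BM].
- by move=> _ b [c Bc ->] Bb; exists (c + b); [exact: BD | ring].
- by [].
- exact: Bf.
- by move=> e _; exact: rx.
- move=> J Jb Jd.
  have sJ i : submod f (J i) by apply: (bmod_submod AB); case: (Jb i).
  have sZ i : submod f (addm (J i) (scale a B)) by exact: submod_add.
  have hIY g l : g \in bs -> T l -> scale a B (f l * g).
    move=> gs [b Bb lE]; rewrite -lE; exists (b * g); last by ring.
    by apply: BM => //; rewrite BE; exact: lin_mem.
  have hB := @lenle_lin L (only_m m) (only_m_prime unitL) E f (scale a B) bs T n saB hIY hn.
  have [|i|i hi] := lenle_dcc hB (Z := fun i => addm (J i) (scale a B)).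
  + move=> i; split=> //; first exact: addm_subr.
    by rewrite -BE; apply: addmSl; case: (Jb i).
  + exact: addmSl.
  exists i, 1; first by exists 0; [exact: subring0 | rewrite mulr0 addr0].
  move=> u Ju; have [|v [_ [Jv [b Bb <-] uE]]] := negl_local unitL (sZ i.+1) hi (t := u).
    exact: (addm_subl saB).
  by exists v, b; rewrite mul1r.
by exists b0, j, b.
Qed.

Definition mB n := lin f (adic n) bs.

Lemma submod_mB n : submod f (mB n).
Proof.
have [X0 XD XM] := adic_ideal m n.
split; [exact: lin0 | by move=> *; exact: linD | by move=> c u; apply: linM => b; exact: XM].
Qed.

Lemma mB_smul n l b : adic n l -> B b -> mB n (f l * b).
Proof.
move=> nl; rewrite BE; apply: linM => c _; rewrite mulrC.
by have [_ _] := adic_ideal m n; apply.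
Qed.

Lemma mB_mul k l u v : mB k u -> mB l v -> mB (k + l) (u * v).
Proof.
move=> ku lv; have [X0 XD XM] := submod_mB (k + l).
have gB g : g \in bs -> B g by rewrite BE; exact: lin_mem.
have lgv g : g \in bs -> mB l (g * v).
  move=> gs; have [Y0 YD YM] := submod_mB l.
  move: v lv; apply: (@lin_ind _ _ _ _ _ [set v | mB l (g * v)]).
  - by rewrite /= mulr0.
  - by move=> v w hv hw; rewrite /= mulrDr; exact: YD.
  - move=> c h lc hs /=; rewrite mulrCA; apply: mB_smul => //.
    by apply: BM; exact: gB.
move: u ku; apply: (@lin_ind _ _ _ _ _ [set u | mB (k + l) (u * v)]).
- by rewrite /= mul0r.
- by move=> u w hu hw; rewrite /= mulrDl; exact: XD.
- move=> c g kc gs /=; rewrite -mulrA; move: (lgv g gs); apply: linM => e le.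
  exact: adic_mul.
Qed.

Lemma mB0 b : B b -> mB 0 b.
Proof. by rewrite BE. Qed.

Lemma mBM n b u : B b -> mB n u -> mB n (b * u).
Proof. by move=> /mB0; exact: mB_mul. Qed.

Lemma mB_leq k l : (k <= l)%N -> mB l `<=` mB k.
Proof. by move=> kl; apply: lin_sub; exact: adic_leq. Qed.

(** Multiplication by [d] carries [m^n B] into [m^n]; this is what allows limits of elements of [B]
    to be taken in the completion of [L]. *)
Lemma dmB n u : mB n u -> exists2 l, adic n l & f d * u = f l.
Proof.
have [X0 XD XM] := adic_ideal m n.
move: u; apply: (@lin_ind _ _ _ _ _ [set u | exists2 l, adic n l & f d * u = f l]).
- by exists 0 => //; rewrite mulr0 rmorph0.
- move=> u v [l nl lE] [l' nl' lE']; exists (l + l'); first exact: XD.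
  by rewrite mulrDr lE lE' rmorphD.
- move=> c g nc gs; have [|l lE] := dB (b := g); first by rewrite BE; exact: lin_mem.
  exists (l * c); first exact: XM.
  by rewrite mulrCA lE -rmorphM mulrC.
Qed.

(* The radical of [aB]: it is proper and contains [mB]. *)
Let rad := [set b | B b /\ exists k c, B c /\ b ^+ k = a * c].

Let rad0 : rad 0.
Proof.
split; first exact: subring0.
by exists 1%N, 0; split; [exact: subring0 | rewrite expr1 mulr0].
Qed.

Let radM b u : B b -> rad u -> rad (b * u).
Proof.
move=> Bb [Bu [k [c [Bc E']]]]; split; first exact: BM.
exists k, (b ^+ k * c); split; first by apply: BM => //; exact: BX.
by rewrite exprMn E'; ring.
Qed.

Let radD u v : rad u -> rad v -> rad (u + v).
Proof.
move=> [Bu [k [c [Bc E']]]] [Bv [l [c' [Bc' E2]]]]; split; first exact: BD.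
have bB := bmod_refl rB.
have := binomial_mem rB (bmod_scale a bB) Bu Bv B1 B1 (k := k) (l := l).
rewrite !mul1r => -[||c2 Bc2 c2E]; [by exists c | by exists c' |].
by exists (k + l)%N, c2.
Qed.

Let rad1 : ~ rad 1.
Proof. by move=> [_ [k [c [Bc]]]]; rewrite expr1n => /esym; exact: na. Qed.

Let radB u v : rad u -> rad v -> rad (u - v).
Proof. by move=> ru rv; rewrite -mulN1r; apply: radD => //; apply: radM => //; exact: BN. Qed.

Let rad_m t : t \in m -> rad (f t).
Proof. by move=> /ma[N [b [Bb E']]]; split; [exact: Bf | exists N, b]. Qed.

Let rad_mB u : mB 1 u -> rad u.
Proof.
move: u; apply: lin_ind => //.
move=> l g /adic1_mem ml gs; rewrite mulrC; apply: radM; last exact: rad_m.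
by rewrite BE; exact: lin_mem.
Qed.

(** The elements equal to 1 at all primes of [B] containing [a]; a multiplicative set that replaces
    localization at these primes. *)
Let one_rad := [set e | B e /\ rad (e - 1)].

Let one_radM e e' : one_rad e -> one_rad e' -> one_rad (e * e').
Proof.
move=> [Be re] [Be' re']; split; first exact: BM.
have -> : e * e' - 1 = e' * (e - 1) + (e' - 1) by ring.
by apply: radD => //; exact: radM.
Qed.

Let one_radX e n : one_rad e -> one_rad (e ^+ n).
Proof.
move=> he; elim: n => [|n IH]; last by rewrite exprS; exact: one_radM.
by rewrite expr0; split=> //; rewrite subrr.
Qed.

(* Fitting: the chain [s^i B + mB] stabilizes, so a power of [u s] is idempotent
   modulo [mB]; it is 1 at the primes containing [a]. *)
Lemma ex_idempotent : exists s u f0, [/\ B s /\ one_rad s, B u,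
  forall t, t \in m -> exists N b, B b /\ f t ^+ N * s = f x * b,
  f0 = u * s & one_rad f0 /\ mB 1 (f0 * f0 - f0)].
Proof.
have [b0 [j [b [Bb0 Bb sE]]]] := divides_unit_power.
pose s := 1 + a * b0; rewrite -/s in sE.
have Bs : B s by apply: BD => //; exact: BM.
have os : one_rad s.
  split=> //; have -> : s - 1 = b0 * a by rewrite /s; ring.
  by apply: radM => //; split=> //; exists 1%N, 1; rewrite mulr1.
have sm t : t \in m -> exists N b, B b /\ f t ^+ N * s = f x * b.
  move=> /ma[N [c [Bc tE]]]; exists (N * j)%N, (b * c ^+ j); split.
    by apply: BM => //; exact: BX.
  rewrite exprM tE exprMn; transitivity (s * a ^+ j * c ^+ j); first by ring.
  by rewrite sE; ring.
have [n hn] : exists n, lenle (only_m m) idfun setT [set` m] n.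
  apply: lenle_local => //; first exact: idealr_ideal.
  by move=> t mt; exists 1%N.
have hIY g l : g \in bs -> l \in m -> mB 1 (f l * g).
  by move=> gs ml; apply: mB_smul; [exact: adic1 | rewrite BE; exact: lin_mem].
have hB := @lenle_lin L (only_m m) (only_m_prime unitL) E f (mB 1) bs [set` m] n
   (submod_mB 1) hIY hn.
have sZ i : submod f (addm (scale (s ^+ i) B) (mB 1)).
  by apply: submod_add; [exact: submod_scale | exact: submod_mB].
have [|i|i hi] := lenle_dcc hB (Z := fun i => addm (scale (s ^+ i) B) (mB 1)).
- move=> i; split=> //; first exact: addm_subr (submod_scale (s ^+ i) sB).
  by rewrite -BE; apply: addmSl => _ [c Bc <-]; apply: BM => //; exact: BX.
- by apply: addmSl => _ [c Bc <-]; exists (s * c); [exact: BM | rewrite exprSr mulrA].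
have [|_ [m1 [[u Bu <-] mm1 pE]]] := negl_local unitL (sZ i.+1) hi (t := s ^+ i).
  by apply: (addm_subl (submod_mB 1)); exists 1 => //; exact: mulr1.
have [M0 MD MM] := submod_mB 1.
(* Stabilization gives [s ^+ i] congruent to [s ^+ i.+1 * u], so [s * u] acts as the identity on [p]
   modulo [mB 1]; hence [u ^+ i.+1 * p] is idempotent there. *)
pose p := s ^+ i.+1.
have Bp : B p by exact: BX.
have pu1 : mB 1 (p - s * u * p).
  have -> : p - s * u * p = s * m1.
    rewrite /p exprS; transitivity (s * (s ^+ i - s ^+ i.+1 * u)).
      by rewrite exprS; ring.
    by rewrite {1}pE; ring.
  exact: mBM.
have Bsu k : B ((s * u) ^+ k) by apply: BX; exact: BM.
have puk k : mB 1 (p - (s * u) ^+ k * p).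
  elim: k => [|k IH]; first by rewrite expr0 mul1r subrr.
  have -> : p - (s * u) ^+ k.+1 * p =
     (p - (s * u) ^+ k * p) + (s * u) ^+ k * (p - s * u * p) by rewrite exprSr; ring.
  by apply: MD => //; exact: mBM.
have osu : one_rad (s * u).
  split; first exact: BM.
  have [_ rp] := one_radX i.+1 os; rewrite -/p in rp.
  have -> : s * u - 1 = (s * u - 1) * - (p - 1) - (p - s * u * p) by ring.
  apply: radB; last exact: rad_mB.
  have -> : (s * u - 1) * - (p - 1) = - (s * u - 1) * (p - 1) by ring.
  by apply: radM => //; apply: BN; apply: BB => //; exact: BM.
exists s, (u ^+ i.+1 * s ^+ i), (u ^+ i.+1 * p); split=> //.
- by apply: BM; exact: BX.
- by rewrite /p -mulrA -exprSr.
- rewrite /p -exprMn; split; first by rewrite mulrC; exact: one_radX.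
  rewrite exprMn -/p.
  have -> : u ^+ i.+1 * p * (u ^+ i.+1 * p) - u ^+ i.+1 * p =
    (- u ^+ i.+1) * (p - (s * u) ^+ i.+1 * p) by rewrite exprMn -/p; ring.
  by apply: mBM => //; apply: BN; exact: BX.
Qed.

Local Notation H := (completion m).
Local Notation j := (comp_inj m).

(* Newton iteration [e <- 3 e^2 - 2 e^3] lifts the idempotent of [B/mB]; its
   limit exists in the completion after multiplication by [d]. *)
Lemma idempotent_limit : exists eps : H, (forall n, eps ^+ n <> 0) /\
  forall t, t \in m -> exists N g, eps * (j t ^+ N - j x * g) = 0.
Proof.
have [s [u [f0 [[Bs os] Bu sm f0E [of0 if0]]]]] := ex_idempotent.
have Bf0 : B f0 by case: of0.
(* The second component is the cofactor [k n] with [e n = f0 * k n = u * s * k n]: the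
   approximations remain visible multiples of [s]. *)
pose step (p : E * E) := (p.1 ^+ 2 * (3%:R - 2%:R * p.1), p.2 * p.1 * (3%:R - 2%:R * p.1)).
pose ek n := iter n step (f0, 1).
pose e n := (ek n).1; pose k n := (ek n).2.
have eS n : e n.+1 = e n ^+ 2 * (3%:R - 2%:R * e n) by [].
have kS n : k n.+1 = k n * e n * (3%:R - 2%:R * e n) by [].
have Bn (n : nat) : B n%:R.
  by elim: n => [|n IH]; [exact: subring0 | rewrite -natr1; exact: BD].
have B32 v : B v -> B (3%:R - 2%:R * v) by move=> Bv; apply: BB => //; exact: BM.
have Be n : B (e n).
  by elim: n => [//|n IH]; rewrite eS; apply: BM; [exact: BX | exact: B32].
have Bk n : B (k n).
  by elim: n => [//|n IH]; rewrite kS; apply: (BM); [exact: BM | exact: B32].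
have eE n : e n = f0 * k n.
  elim: n => [|n IH]; first by rewrite /e /k /= mulr1.
  by rewrite eS kS expr2 {1}IH; ring.
have ie n : mB n.+1 (e n * e n - e n).
  elim: n => [//|n IH].
  have -> : e n.+1 * e n.+1 - e n.+1 =
     (4%:R * (e n * e n - e n) - 3%:R) * ((e n * e n - e n) * (e n * e n - e n)).
    by rewrite eS; ring.
  apply: mBM; first by apply: BB => //; apply: BM => //; apply: BB => //; exact: BM.
  by apply: mB_leq (mB_mul IH IH); rewrite addnS !addSn ltnS ltnS leq_addr.
have oe n : one_rad (e n).
  elim: n => [//|n [Ben IH]]; split; first exact: Be.
  have -> : e n.+1 - 1 = (1 + e n - 2%:R * e n * e n) * (e n - 1) by rewrite eS; ring.
  apply: radM => //; apply: BB; first exact: BD.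
  by apply: (BM) => //; exact: BM.
have de n : mB n (e n.+1 - e n).
  have -> : e n.+1 - e n = (1 - 2%:R * e n) * (e n * e n - e n) by rewrite eS; ring.
  apply: mBM; first by apply: BB => //; exact: BM.
  exact: mB_leq (ie n).
(* By [dB] the elements [d e_n b_n] come from [L], and by [dmB] they form a Cauchy sequence
   there. *)
have lim (b : nat -> E) : (forall n, B (b n)) -> (forall n, mB n (b n.+1 - b n)) ->
    exists v : H, forall n (l : L), f l = f d * (e n * b n) -> filt n (v - j l).
  move=> Bb db; have /choice[z zE] : forall n, exists l, f d * (e n * b n) = f l.
    by move=> n; apply: dB; exact: BM.
  have [n|v vP] := @filt_limit L m z.
    have : mB n (e n.+1 * b n.+1 - e n * b n).
      have -> : e n.+1 * b n.+1 - e n * b n =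
        e n.+1 * (b n.+1 - b n) + b n * (e n.+1 - e n) by ring.
      by have [_ XD _] := submod_mB n; apply: XD; apply: mBM.
    move=> /dmB[l nl lE]; suff -> : z n.+1 - z n = l by [].
    by apply: finj; rewrite rmorphB -!zE -lE; ring.
  by exists v => n l lE; have -> : l = z n by apply: finj; rewrite lE zE.
have limu (v w : H) : (forall n, filt n (v - w)) -> v = w.
  by move=> h; apply/eqP; rewrite -subr_eq0; apply/eqP; exact: filt_sep h.
(* [V b] is the limit of [d e_n b]; outside [B] it is a dummy value. *)
have /choice[V VP] : forall b, exists v : H, B b ->
    forall n (l : L), f l = f d * (e n * b) -> filt n (v - j l).
  move=> b; have [Bb|nBb] := pselect (B b); last by exists 0.
  have [||v vP] := lim (fun=> b) => //; last by exists v.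
  by move=> n; rewrite subrr; case: (submod_mB n).
have Vlin (c : seq E) (w : nat -> E) : (forall g, g \in c -> B g) ->
    (forall n, lin f (adic n) c (w n)) -> exists2 v : H,
    blin setT [seq V g | g <- c] v &
    forall n (l : L), f l = f d * (e n * \sum_(i < n) w i) -> filt n (v - j l).
  elim: c w => [|g c IH] w cB wP.
    exists 0 => // n l lE; have -> : l = 0.
      apply: finj; rewrite lE rmorph0 big1 ?mulr0// => i _; exact: wP.
    by rewrite rmorph0 subrr; case: (filt_ideal m n).
  have /choice[cv cvP] : forall n, exists p : L * E, [/\ adic n p.1,
      lin f (adic n) c p.2 & w n = f p.1 * g + p.2].
    by move=> n; have [r [v [nr cv wE]]] := wP n; exists (r, v).
  have [||v cv' vP] := IH (fun n => (cv n).2).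
  - by move=> h hc; apply: cB; rewrite inE hc orbT.
  - by move=> n; case: (cvP n).
  have [|r rP] := @filt_series L m (fun n => j (cv n).1).
    by move=> n; apply/filt_inj; case: (cvP n).
  have Bg : B g by apply: cB; exact: mem_head.
  have Bc h : h \in c -> B h by move=> hc; apply: cB; rewrite inE hc orbT.
  exists (r * V g + v); first by exists r, v.
  move=> n l lE.
  have [l1 l1E] : exists l, f d * (e n * g) = f l by apply: dB; exact: BM.
  have [l2 l2E] : exists l, f d * (e n * \sum_(i < n) (cv i).2) = f l.
    apply: dB; apply: BM => //; apply: subring_sum => // i _.
    have [_ cvi _] := cvP i; apply: (lin_min sB Bc).
    exact: lin_sub cvi.
  pose S := \sum_(i < n) (cv i).1.
  have -> : l = S * l1 + l2.
    apply: finj; rewrite lE rmorphD rmorphM -l1E -l2E /S rmorph_sum.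
    under eq_bigr => i _ do have [_ _ ->] := cvP i.
    by rewrite big_split /= -mulr_suml; ring.
  have SE : j S = \sum_(i < n) j (cv i).1 by rewrite /S rmorph_sum.
  have -> : r * V g + v - j (S * l1 + l2) =
    V g * (r - \sum_(i < n) j (cv i).1) + (j S * (V g - j l1) + (v - j l2)).
    by rewrite rmorphD rmorphM -SE; ring.
  have [_ FD FM] := filt_ideal m n.
  apply: (FD); first exact: FM.
  by apply: FD; [apply: FM; apply: VP | apply: vP].
have Vspan (b : nat -> E) : (forall n, B (b n)) -> (forall n, mB n (b n.+1 - b n)) ->
    exists2 v : H, blin setT [seq V g | g <- bs] v &
    forall n (l : L), f l = f d * (e n * b n) -> filt n (v - j l).
  (* Starting with [b 1] makes the sum of the first [n] terms equal to [b n] for positive [n]; at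
     [n = 0] the claim is void, [filt 0] being everything. *)
  move=> Bb db; pose w n := if n is 0%N then b 1%N else b n.+1 - b n.
  have [||v sv vP] := Vlin bs w.
  - by move=> g gs; rewrite BE; exact: lin_mem.
  - by case=> [|n]; [exact: (mB0 (Bb 1%N)) | exact: db].
  exists v => // -[|n] l lE; first exact: filt0.
  apply: vP; rewrite lE big_ord_recl /= /bump.
  have -> // : b n.+1 = b 1%N + \sum_(i < n) (b i.+2 - b i.+1).
  have := telescope_sumr (fun i => b i.+1) (leq0n n).
  by rewrite big_mkord => ->; ring.
have [||eps eS' epsP] := Vspan (fun=> 1) => //.
  by move=> n; rewrite subrr; case: (submod_mB n).
have /choice[wv wvP] : forall n, exists l, f d * (e n * 1) = f l.
  by move=> n; apply: dB; exact: BM.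
exists eps; split.
  move=> [|r] eps0; first by move/eqP: eps0; rewrite expr0 oner_eq0.
  (* If a power of [eps] vanishes, the approximations [D * e n ^+ r.+1] lie in ever higher powers of
     m. Multiplied by powers of [s] they become divisible by any power of [x]. *)
  pose D := f d ^+ r.+1.
  have rD v : D * v = 0 -> v = 0.
    rewrite /D; elim: (r.+1) => [|r' IH]; first by rewrite mul1r.
    by rewrite exprS -mulrA => /rd.
  have wvN n : adic n (wv n ^+ r.+1).
    apply/filt_inj; rewrite rmorphXn /=.
    have -> : j (wv n) ^+ r.+1 = - (eps ^+ r.+1 - j (wv n) ^+ r.+1) by rewrite eps0; ring.
    apply: (submodN (filt_ideal m n)); rewrite subrXX mulrC.
    by have [_ _ FM] := filt_ideal m n; apply: FM; apply: epsP; rewrite wvP.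
  have wvE n : f (wv n ^+ r.+1) = D * e n ^+ r.+1.
    by rewrite rmorphXn /= -wvP mulr1 exprMn.
  have [M MP] : exists M, forall l, adic M l -> exists2 b, B b & f l * s = f x * b.
    pose I := [set l | exists2 b, B b & f l * s = f x * b].
    have idI : ideal I.
      split.
      - by exists 0; [exact: subring0 | rewrite rmorph0 mul0r mulr0].
      - move=> v v' [b Bb E1] [b' Bb' E2]; exists (b + b'); first exact: BD.
        by rewrite rmorphD mulrDl E1 E2; ring.
      - move=> v v' [b Bb E1]; exists (f v * b); first exact: BM.
        by rewrite rmorphM -mulrA E1; ring.
    have [t mt|M hM] := @adic_sub_radical L m nL I idI; last by exists M.
    by have [N [b [Bb tE]]] := sm t mt; exists N, b => //; rewrite rmorphXn.
  have MjP i l : adic (i * M) l -> exists2 b, B b & f l * s ^+ i = f x ^+ i * b.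
    have sI i' : submod f [set v | exists2 b, B b & v * s ^+ i' = f x ^+ i' * b].
      split.
      - by exists 0; [exact: subring0 | rewrite mul0r mulr0].
      - move=> v v' [b Bb E1] [b' Bb' E2]; exists (b + b'); first exact: BD.
        by rewrite mulrDl E1 E2; ring.
      - move=> v v' [b Bb E1]; exists (f v * b); first exact: BM.
        by rewrite -mulrA E1; ring.
    elim: i l => [|i IH] l; first by move=> _; exists (f l) => //; ring.
    rewrite mulSn => /adic_split; move: l.
    have [X0 XD XM] := sI i.+1.
    apply: smul_min; first by rewrite rmorph0.
      by move=> v v' hv hv'; rewrite rmorphD; exact: XD.
    move=> v v' /MP[b Bb E1] /IH[b' Bb' E2]; exists (b * b'); first exact: BM.
    rewrite rmorphM exprS; transitivity ((f v * s) * (f v' * s ^+ i)); first by ring.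
    by rewrite E1 E2 exprS; ring.
  have /choice[g gP] : forall i, exists p : E * E, [/\ one_rad p.1, B p.2 &
      D * p.1 = f x ^+ i * p.2].
    move=> i; have [b Bb bE] := MjP i _ (wvN (i * M)%N).
    exists (e (i * M)%N ^+ r.+1 * s ^+ i, b); split=> //.
      by apply: one_radM; exact: one_radX.
    by rewrite /= -bE wvE mulrA.
  (* Up to [one_rad], [Y i] is the ideal generated by the quotient of [D] by [x ^+ i]. When the
     ascending chain stops, an element [1 - b x], again in [one_rad] as [x] is in m, kills that
     quotient for [i.+1], hence kills [D]; this makes 0 an element of [one_rad]. *)
  pose Y i := [set y | B y /\ exists c b, [/\ one_rad c, B b & c * y = b * (g i).2]].
  have sY i : submod f (Y i).
    split.
    - split; first exact: subring0.
      exists 1, 0; split; [by split=> //; rewrite subrr | exact: subring0 | by ring].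
    - move=> y y' [By [c [b [oc Bb E1]]]] [By' [c' [b' [oc' Bb' E2]]]].
      split; first exact: BD.
      exists (c * c'), (c' * b + c * b'); split; first exact: one_radM.
        by apply: BD; apply: BM => //; [case: oc' | case: oc].
      transitivity (c' * (c * y) + c * (c' * y')); first by ring.
      by rewrite E1 E2; ring.
    - move=> l y [By [c [b [oc Bb E1]]]]; split; first exact: BM.
      by exists c, (f l * b); split=> //; [exact: BM | rewrite mulrCA E1 mulrA].
  have rg i : (g i.+1).1 * (g i).2 = (g i).1 * f x * (g i.+1).2.
    have [_ _ E1] := gP i; have [_ _ E2] := gP i.+1.
    have rxi v : f x ^+ i * v = 0 -> v = 0.
      by elim: i {E1 E2} => [|i IH]; rewrite ?mul1r// exprS -mulrA => /rx.
    apply/eqP; rewrite -subr_eq0; apply/eqP; apply: rxi.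
    transitivity ((g i.+1).1 * (f x ^+ i * (g i).2) -
       (g i).1 * (f x ^+ i.+1 * (g i.+1).2)); first by rewrite exprS; ring.
    by rewrite -E1 -E2; ring.
  have [|i|i iP] := noeth_acc nL (s := bs) sY.
  - by move=> i y [By _]; rewrite -BE.
  - move=> y [By [c [b [oc Bb E1]]]]; split=> //.
    have [o1 _ _] := gP i; have [o2 _ _] := gP i.+1.
    exists ((g i.+1).1 * c), (b * (g i).1 * f x); split; first exact: one_radM.
      by apply: (BM) => //; apply: BM => //; case: o1.
    rewrite -mulrA E1; transitivity (b * ((g i.+1).1 * (g i).2)); first by ring.
    by rewrite rg; ring.
  - have [o2 Bg E2] := gP i.+1; have [o1 _ _] := gP i.
    have [|_ [c [b [oc Bb E1]]]] := iP i.+1 (g i.+1).2.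
      by split=> //; exists 1, 1; split=> //; split=> //; rewrite subrr.
    pose c' := c * (g i.+1).1 - b * (g i).1 * f x.
    have oc' : one_rad c'.
      have [Bc1 rc1] := one_radM oc o2.
      have Bb1 : B (b * (g i).1) by apply: BM => //; case: o1.
      split; first by apply: BB => //; exact: BM.
      have -> : c' - 1 = (c * (g i.+1).1 - 1) - b * (g i).1 * f x by rewrite /c'; ring.
      by apply: radB => //; apply: radM => //; exact: rad_m.
    have c0 : c' * (g i.+1).2 = 0.
      rewrite /c' mulrBl; transitivity ((g i.+1).1 * (c * (g i.+1).2) -
        b * ((g i).1 * f x * (g i.+1).2)); first by ring.
      by rewrite E1 -rg; ring.
    have : D * (c' * (g i.+1).1) = 0.
      rewrite mulrCA E2; transitivity (f x ^+ i.+1 * (c' * (g i.+1).2)); first by ring.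
      by rewrite c0 mulr0.
    move=> /rD c1; have [_] := one_radM oc' o2; rewrite c1 sub0r => r1; apply: rad1.
    by rewrite -[1]mulr1 -mulrNN; apply: radM => //; exact: BN.
move=> t mt; have [N [b0 [Bb0 tE]]] := sm t mt.
(* Convergence is claimed for [e n * k n] only: the increments of [k n] contain the factor
   [e n - 1], which need not be small. *)
have kap n : mB n (e n.+1 * k n.+1 - e n * k n).
  have -> : e n.+1 * k n.+1 - e n * k n = k n.+1 * (e n.+1 - e n) +
     k n * (1 - 2%:R * e n) * (e n * e n - e n) by rewrite kS; ring.
  have [_ XD _] := submod_mB n; apply: XD; first exact: mBM.
  apply: mBM; last exact: mB_leq (ie n).
  by apply: BM => //; apply: BB => //; exact: BM.
pose tN := j t ^+ N; pose jx := j x.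
(* Replace [e n] by its cube, to which it is congruent, and write one factor as [u * s * k n]; then
   [t ^+ N * s = x * b0] supplies the factor [x]. *)
have key g : g \in bs -> exists2 w, blin setT [seq V g | g <- bs] w & tN * V g = jx * w.
  move=> gs; have Bg : B g by rewrite BE; exact: lin_mem.
  have Bub : B (u * b0 * g) by apply: (BM) => //; exact: BM.
  have [||w sw wP] := Vspan (fun n => u * b0 * g * (e n * k n)).
  - by move=> n; apply: (BM) => //; exact: BM.
  - by move=> n; rewrite -mulrBr; exact: mBM.
  exists w => //; apply: limu => n.
  have [l1 l1E] : exists l, f d * (e n * g) = f l by apply: dB; exact: BM.
  have [l2 l2E] : exists l, f d * (e n * (u * b0 * g * (e n * k n))) = f l.
    by apply: dB; apply: (BM) => //; apply: (BM) => //; exact: BM.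
  have : mB n (f t ^+ N * (e n * g) - f x * (e n * (u * b0 * g * (e n * k n)))).
    have -> : f t ^+ N * (e n * g) - f x * (e n * (u * b0 * g * (e n * k n))) =
       - (f t ^+ N * g * (1 + e n)) * (e n * e n - e n).
      transitivity (f t ^+ N * (e n * g) - u * g * e n * e n * k n * (f x * b0)); first by ring.
      rewrite -tE; transitivity (f t ^+ N * g * (e n - e n * e n * (u * s * k n))); first by ring.
      by rewrite -f0E -eE; ring.
    apply: mBM; last exact: mB_leq (ie n).
    apply: BN; apply: (BM); last exact: BD.
    by apply: (BM) => //; exact: BX.
  move=> /dmB[l3 nl3 l3E].
  have lE : t ^+ N * l1 - x * l2 = l3.
    apply: finj; rewrite rmorphB !rmorphM rmorphXn -l1E -l2E -l3E; ring.
  have -> : tN * V g - jx * w = tN * (V g - j l1) - jx * (w - j l2) + j l3.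
    by rewrite -lE /tN /jx rmorphB !rmorphM rmorphXn; ring.
  have [_ FD FM] := filt_ideal m n; apply: (FD); last exact/filt_inj.
  by apply: (submodB (filt_ideal m n)); apply: FM; [apply: VP | apply: wP].
pose U := [set z : H | exists n g, z = j t ^+ n + jx * g].
have bT : bmod [set: H] [set 0].
  by split=> //= [v w -> ->|v w _ ->]; rewrite ?addr0 ?mulr0.
(* Nakayama with zero target: by [key], [t ^+ N] maps the span of the [V g] into [x] times itself,
   so some [t ^+ i + x * g] kills the span, which contains [eps]. *)
have [||||||v [i [g ->]] vP] := @nakayama _ [set: H] U jx [seq V g | g <- bs]
    (setT_subring _) _ _ _ _ _ _ bT.
- by [].
- by exists 0%N, 0; rewrite expr0 mulr0 addr0.
- by [].
- move=> _ _ [n [g ->]] [n' [g' ->]].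
  by exists (n + n')%N, (j t ^+ n * g' + g * j t ^+ n' + jx * g * g'); rewrite exprD; ring.
- by move=> _ b [n [g ->]] _; exists n, (g + b); ring.
- move=> _ /mapP[g gs ->]; have [w sw wE] := key g gs.
  exists tN, 0, w; split=> //; last by rewrite wE add0r.
  by exists N, 0; rewrite mulr0 addr0.
exists i, (- g).
have := blin_smul bT vP eS'; rewrite /= mulrN opprK mulrC => E0.
by rewrite -[RHS]E0 /jx; ring.
Qed.

End IdempotentLimit.

(** * Quasi-unmixed local rings *)

Lemma quot_prime_pull (R : comNzRingType) (P : prime_idealr R)
    (r : prime_idealr {ideal_quot P}) :
  is_prime [set z | \pi_({ideal_quot P}) z \in r].
Proof.
split; first split; rewrite /=.
- by rewrite rmorph0; exact: idealr0.
- by move=> u v hu hv; rewrite rmorphD; exact: rpredD.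
- by move=> u v hv; rewrite rmorphM; exact: idealMr.
- by rewrite rmorph1 idealr1.
- by move=> u v /=; rewrite rmorphM prime_idealrM => /orP.
Qed.

Lemma sub_quot_prime_pull (R : comNzRingType) (P : prime_idealr R)
    (r : prime_idealr {ideal_quot P}) :
  [set` P] `<=` [set z | \pi_({ideal_quot P}) z \in r].
Proof.
move=> z /= Pz.
have -> : \pi_({ideal_quot P}) z = \pi_({ideal_quot P}) 0.
  by apply/eqP; rewrite -Quotient.idealrBE subr0.
by rewrite rmorph0; exact: idealr0.
Qed.

Section DimensionOne.
Variables (L : comNzRingType) (m : idealr L).
Hypothesis nL : noeth L.
Hypothesis unitL : forall t : L, t \notin m -> exists u, u * t = 1.
Local Notation adic := (Completion.adic m).
Local Notation H := (completion m).
Local Notation j := (comp_inj m).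

Variables (x : L) (eps : H).
Hypothesis mx : x \in m.
Hypothesis epsP : forall t, t \in m -> exists N g, eps * (j t ^+ N - j x * g) = 0.

Let ann : set H := [set z | eps * z = 0].

Let ann_ideal : ideal ann.
Proof.
split; rewrite /ann /=; first by rewrite mulr0.
  by move=> u v hu hv; rewrite mulrDr hu hv addr0.
by move=> b u hu; rewrite mulrCA hu mulr0.
Qed.

Lemma filt_sub_principal_ann : exists M : nat, filt M `<=` addm (principal (j x)) ann.
Proof.
have idX : ideal (addm (principal (j x)) ann).
  by apply: submod_add => //; exact: ideal_principal.
have [X0 XD XM] := idX.
have [||M MP] := @adic_sub_radical L m nL [set l | addm (principal (j x)) ann (j l)].
- split; rewrite /=; first by rewrite rmorph0.
    by move=> u v hu hv; rewrite rmorphD; exact: XD.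
  by move=> u v hv; rewrite rmorphM; exact: XM.
- move=> t /epsP[N [g E]]; exists N; rewrite /= rmorphXn.
  by exists (j x * g), (j t ^+ N - j x * g); split=> //; [exists g | ring].
by exists M; apply: filt_min.
Qed.

Lemma filt1X (M : nat) (z : H) : filt 1 z -> filt M (z ^+ M).
Proof.
move=> z1; elim: M => [|M IH]; first exact: filt0.
by rewrite exprS -add1n; exact: filt_mul.
Qed.

Section Chain.
Variables q q1 : set H.
Hypothesis pq : is_prime q.
Hypothesis q_eps : ~ q eps.
Hypothesis pq1 : is_prime q1.
Hypothesis qq1 : q `<=` q1.

Let ann_q : ann `<=` q.
Proof.
have [[q0 _ _] _ qM] := pq => z hz; have : q (eps * z) by rewrite hz.
by move=> /qM[].
Qed.

(** Containing [x] and the annihilator of [eps], the prime [q1] contains a power of each element of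
    [filt 1], hence [filt 1] itself. Elements outside [filt 1] are invertible modulo it, so no
    larger prime exists. *)
Lemma prime_over_x_maximal q2 z : q1 (j x) -> is_prime q2 -> q1 `<=` q2 -> q2 z -> q1 z.
Proof.
move=> q1x [[_ q2D q2M] q21 _] q12 q2z; apply: contrapT => q1z.
have [M MP] := filt_sub_principal_ann.
have [[q10 q1D q1M] q11 q1P] := pq1.
have f1 y : filt 1 y -> q1 y.
  move=> /(filt1X M)/MP[_ [k [[b _ <-] hk E]]]; apply: (primeX pq1 (n := M)); rewrite E.
  by apply: q1D; [rewrite mulrC; exact: q1M | exact/qq1/ann_q].
have [l zl] := filt_dense z 1.
have [ml|/unitL[u ul]] := boolP (l \in m).
  apply: q1z; rewrite -[z](subrK (j l)); apply: q1D; apply: f1 => //.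
  exact/filt_inj/adic1.
apply: q21; have -> : 1 = j u * z + j u * - (z - j l).
  transitivity (j u * j l); last by ring.
  by rewrite -rmorphM ul rmorph1.
apply: q2D; first exact: q2M.
apply: q2M; apply/q12/f1; exact: (submodN (filt_ideal m 1)).
Qed.

Variable y : H.

Let J n : set H := [set z | exists (c : nat) b, q (j x ^+ c * z - y ^+ n * b)].

Let J_ideal n : ideal (J n).
Proof.
have [[q0 qD qM] _ _] := pq; split.
- by exists 0%N, 0; rewrite !mulr0 subrr.
- move=> u v [c [b h]] [c' [b' h']]; exists (c + c')%N, (j x ^+ c' * b + j x ^+ c * b').
  have -> : j x ^+ (c + c') * (u + v) - y ^+ n * (j x ^+ c' * b + j x ^+ c * b') =
    j x ^+ c' * (j x ^+ c * u - y ^+ n * b) + j x ^+ c * (j x ^+ c' * v - y ^+ n * b').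
    by rewrite exprD; ring.
  by apply: qD; exact: qM.
- move=> u v [c [b h]]; exists c, (u * b).
  have -> : j x ^+ c * (u * v) - y ^+ n * (u * b) = u * (j x ^+ c * v - y ^+ n * b) by ring.
  exact: qM.
Qed.

Let J_dec n : J n.+1 `<=` J n.
Proof.
move=> z [c [b h]]; exists c, (y * b).
by rewrite (mulrA (y ^+ n)) -exprSr.
Qed.

Let J_sat n z : J n (j x * z) -> J n z.
Proof. by move=> [c [b h]]; exists c.+1, b; rewrite exprSr -mulrA. Qed.

Let q_J n : q `<=` J n.
Proof. by move=> z qz; exists 0%N, 0; rewrite mulr0 subr0 mul1r. Qed.

(* Krull's principal ideal theorem for [H/q]: [J n] is the [x]-saturation of
   [y ^+ n H + q]; a descending chain condition modulo [x] gives
   [J n = J n.+1 + x J n] for some [n], and [J n = J n.+1] by completeness. *)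
Lemma prime_below_x : q1 y -> ~ q1 (j x) -> q y.
Proof.
move=> q1y q1x; apply: contrapT => qy.
have [M MP] := filt_sub_principal_ann.
have idX : ideal (principal (j x)) by exact: ideal_principal.
have idJX n : ideal (addm (J n) (principal (j x))) by exact: submod_add.
pose I n : set L := [set l | addm (J n) (principal (j x)) (j l)].
have idI n : ideal (I n).
  have [X0 XD XM] := idJX n; split; rewrite /I /=; first by rewrite rmorph0.
    by move=> u v hu hv; rewrite rmorphD; exact: XD.
  by move=> u v hv; rewrite rmorphM; exact: XM.
have fX (z : H) : filt M z -> exists b k, [/\ ann k & z = j x * b + k].
  by move=> /MP[_ [k [[b _ <-] hk E]]]; exists b, k.
(* All [I n] contain [m ^ M], because [filt M] is in [xH + ann] and [ann] is in [q], hence in [J n];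
   so their chain has bounded length over [L]. *)
have [N hN] : exists N, lenle (only_m m) idfun setT (adic M) N.
  apply: lenle_local => //; first exact: adic_ideal.
  move=> t mt; exists M; elim: M {MP fX} => [//|M IH].
  by rewrite exprS -add1n; apply: adic_mul => //; exact: adic1.
have [i|i|n /(negl_local unitL (idI n.+1)) In] := lenle_dcc hN (Z := I).
- split=> // l Ml; have [|b [k [hk E]]] := @fX (j l); first exact/filt_inj.
  exists k, (j x * b); split; [exact/q_J/ann_q | by exists b |].
  by rewrite E addrC.
- by move=> l; apply: addmSl.
have [al alE] := nL (idI n.+1).
have [gs Jgs gsP] : exists2 gs : seq H, (forall g, g \in gs -> J n.+1 g) &
    forall l, lin idfun setT al l -> exists h b, lin idfun setT gs h /\ j l = h + j x * b.
  have: forall l, l \in al -> I n.+1 l by rewrite alE => l; exact: lin_mem.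
  elim: (al) => [_|l al' IH Ial].
    by exists [::] => // l ->; exists 0, 0; rewrite rmorph0 mulr0 addr0.
  have [|gs Jgs gsP] := IH; first by move=> l' hl'; apply: Ial; rewrite inE hl' orbT.
  have [g [_ [Jg [b _ <-] lE]]] := Ial l (mem_head _ _).
  exists (g :: gs); first by move=> h; rewrite inE => /orP[/eqP -> //|]; exact: Jgs.
  move=> _ [c [v [_ /gsP[h [b' [hh vE]]] ->]]].
  exists (j c * g + h), (j c * b + b'); split; first by exists (j c), h.
  have -> : j (idfun c * l + v) = j c * j l + j v by rewrite rmorphD rmorphM.
  by rewrite lE vE; ring.
have [_ JD JM] := J_ideal n.+1.
have JJ : J n `<=` J n.+1.
  (* Iterating [z = h + k + x z'] inside [J n] writes [z0] as the sum of the series of [x^i h_i] and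
     [x^i k_i]: the first lies in [J n.+1] by [filt_lin_limit], the second in [ann], and the
     remainder tends to 0. *)
  pose T := {z | J n z}.
  have step (z : T) : exists z' : T, exists h k,
      [/\ lin idfun setT gs h, ann k & sval z = h + k + j x * sval z'].
    case: z => z Jz; have [l zl] := filt_dense z M.
    have [b [k [hk E]]] := fX _ zl.
    have Jk : J n k by exact/q_J/ann_q.
    have /In : I n l.
      exists (z - k), (j x * - b); split; [exact: (submodB (J_ideal n)) | by exists (- b) |].
      have -> : j l = z - (z - j l) by ring.
      by rewrite E; ring.
    rewrite alE => /gsP[h [b' [hh lE]]].
    have Jh : J n h by apply: J_dec; exact: (lin_min (J_ideal n.+1) Jgs).
    have zE : z = h + k + j x * (b + b').
      have -> : z = (z - j l) + j l by ring.
      by rewrite E lE; ring.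
    have Jb : J n (b + b').
      apply: J_sat; have -> : j x * (b + b') = z - (h + k) by rewrite zE; ring.
      by apply: (submodB (J_ideal n)) => //; have [_ + _] := J_ideal n; apply.
    by exists (exist _ _ Jb), h, k.
  move=> z0 Jz0.
  have [u u0 uP] := ex_sequence (exist _ z0 Jz0 : T) step.
  have /choice[hk hkP] : forall i, exists p : H * H,
      [/\ lin idfun setT gs p.1, ann p.2 & sval (u i) = p.1 + p.2 + j x * sval (u i.+1)].
    by move=> i; have [h [k hP]] := uP i; exists (h, k).
  have xi i : filt i (j x ^+ i).
    by rewrite -rmorphXn; apply/filt_inj; elim: i => [//|i IH];
      rewrite exprS -add1n; apply: adic_mul => //; exact: adic1.
  have [||w Jw wP] := @filt_lin_limit L m (J n.+1) gs
     (fun i => j x ^+ i * (hk i).1) (J_ideal n.+1).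
  - exact: Jgs.
  - move=> i; have [+ _ _] := hkP i; apply: linM => b _; rewrite mulrC.
    by have [_ _ FM] := filt_ideal m i; exact: FM.
  have [|k kP] := @filt_series L m (fun i => j x ^+ i * (hk i).2).
    by move=> i; rewrite mulrC; have [_ _ FM] := filt_ideal m i; exact: FM.
  have ak : ann k.
    apply: (@filt_sep L m) => N'.
    have -> : eps * k = eps * (k - \sum_(i < N') j x ^+ i * (hk i).2).
      rewrite mulrBr mulr_sumr big1 ?subr0// => i _.
      by rewrite mulrCA; have [_ -> _] := hkP i; rewrite mulr0.
    by have [_ _ FM] := filt_ideal m N'; exact: FM.
  have part N' : z0 = \sum_(i < N') j x ^+ i * (hk i).1 +
      \sum_(i < N') j x ^+ i * (hk i).2 + j x ^+ N' * sval (u N').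
    elim: N' => [|N' IH]; first by rewrite !big_ord0 !add0r expr0 mul1r u0.
    have [_ _ E] := hkP N'; rewrite IH E !big_ord_recr /= exprS; ring.
  suff -> : z0 = w + k by apply: JD => //; exact/q_J/ann_q.
  apply/eqP; rewrite -subr_eq0; apply/eqP; apply: (@filt_sep L m) => N'.
  have -> : z0 - (w + k) = sval (u N') * j x ^+ N' -
     ((w - \sum_(i < N') j x ^+ i * (hk i).1) + (k - \sum_(i < N') j x ^+ i * (hk i).2)).
    by rewrite [in LHS](part N'); ring.
  have [_ FD FM] := filt_ideal m N'.
  by apply: (submodB (filt_ideal m N')); [exact: FM | exact: FD].
(* Now [y ^+ n] is in [J n.+1], so [y ^+ n * (x ^+ c - y * b)] is in [q]. As [y] is not, [x ^+ c]
   lies in [q1] along with [y], a contradiction. *)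
have : J n (y ^+ n).
  by exists 0%N, 1; rewrite mulr1 mul1r subrr; case: pq => -[].
move=> /JJ[c [b h]]; have [_ _ qM] := pq.
have : q (y ^+ n * (j x ^+ c - y * b)).
  by have -> : y ^+ n * (j x ^+ c - y * b) = j x ^+ c * y ^+ n - y ^+ n.+1 * b
    by rewrite exprSr; ring.
move=> /qM[/(primeX pq) //|/qq1 h1].
apply: q1x; apply: (primeX pq1 (n := c)).
rewrite -[_ ^+ c](subrK (y * b)); have [[_ q1D q1M] _ _] := pq1.
by apply: q1D => //; rewrite mulrC; exact: q1M.
Qed.

End Chain.

(** [P] avoids the powers of [eps]. In a chain of three primes over [P], the middle one is maximal
    if it contains [x], and otherwise lies in [P]; neither is possible. *)
Lemma ex_minimal_prime_dim_le1 : (forall n, eps ^+ n <> 0) ->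
  exists2 P : prime_idealr H, minimal_prime P &
    forall k (p : nat -> prime_idealr {ideal_quot P}), prime_chain k p -> (k <= 1)%N.
Proof.
move=> neps; pose S : set H := [set z | exists n, z = eps ^+ n].
have [||||q [pq _ Sq qmin]] := @prime_avoid H [set 0] S.
- exact: submod0.
- by exists 0%N.
- by move=> _ _ [n ->] [n' ->]; exists (n + n')%N; rewrite exprD.
- by move=> _ [n ->]; exact: neps.
have [P PE] := prime_idealrP pq; exists P.
  move=> P' sub z Pz; have : q z by rewrite -PE.
  move=> /qmin[t [n [qt tz]]]; have := idealr0 P'; rewrite -tz prime_idealrM.
  move=> /orP[/sub h|]; first by case: qt; rewrite -PE.
  exact: (primeX (idealr_prime P')).
move=> k p pk; rewrite leqNgt; apply/negP => k1.
have pull (r : prime_idealr {ideal_quot P}) := quot_prime_pull r.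
have q_eps : ~ q eps by apply: Sq; exists 1%N; rewrite expr1.
have q_pull (r : prime_idealr {ideal_quot P}) :
    q `<=` [set z | \pi_({ideal_quot P}) z \in r].
  by rewrite -PE; exact: sub_quot_prime_pull.
have [_ /nonsubset[y' /= [p1y p0y]]] := pk 0%N (ltnW k1).
have [s12 /nonsubset[z' /= [p2z p1z]]] := pk 1%N k1.
move: y' z' p1y p0y p2z p1z; elim/quotW => y; elim/quotW => z p1y p0y p2z p1z.
have [q1x|q1x] := pselect (\pi_({ideal_quot P}) (j x) \in p 1%N).
  apply: p1z; apply: (prime_over_x_maximal pq q_eps (pull (p 1%N)) (q_pull _) q1x
    (pull (p 2%N)) _ p2z) => u; exact: s12.
apply: p0y; apply: (q_pull (p 0%N)).
exact: (prime_below_x pq q_eps (pull (p 1%N)) (q_pull _) p1y q1x).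
Qed.

End DimensionOne.

Lemma local_ring_unit (L : comNzRingType) (m : idealr L) : noeth L -> local_ring m ->
  forall t, t \notin m -> exists u, u * t = 1.
Proof.
move=> nL [_ mP] t tm; apply: contrapT => ntu.
pose P I := ~ I 1 -> exists2 n : idealr L, maximal_ideal n & I `<=` [set` n].
have [|[b' _ E]|n nmax tn] := @ideal_ind L P nL _ (principal t) (ideal_principal t).
- move=> I idI IH I1; have [n nE] := ideal_idealr idI I1.
  have [[J [nJ /existsNP[z /not_implyP[Jz /negP nz]]]]|nmax] := pselect (exists J : idealr L,
      {subset n <= J} /\ ~ {subset J <= n}).
    have [|||n' n'max Jn'] := IH [set` J].
    + exact: idealr_ideal.
    + by rewrite -nE; split; [exact: nJ | move=> /(_ z Jz); apply/negP].
    + by rewrite /= idealr1.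
    + by exists n' => //; rewrite -nE; apply: subset_trans Jn'; exact: nJ.
  exists n; last by rewrite nE.
  by move=> J nJ; apply: contrapT => Jn; apply: nmax; exists J.
- by apply: ntu; exists b'; rewrite mulrC.
- by move/negP: tm; apply; rewrite -(mP n nmax); apply: tn; exact: principal_mem.
Qed.

Lemma krull_dim_Some (R : comNzRingType) n : krull_dim R = Some n ->
  forall k (p : nat -> prime_idealr R), prime_chain k p -> (k <= n)%N.
Proof.
by rewrite /krull_dim; case: xgetP => // d -> [n' [-> _ h]] [<-].
Qed.

(** [p0] supplies the chain of length 0, without which the dimension would take its default value
    [None]. *)
Lemma krull_dim_le1 (R : comNzRingType) (p0 : prime_idealr R) :
  (forall k (p : nat -> prime_idealr R), prime_chain k p -> (k <= 1)%N) ->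
  exists2 n, krull_dim R = Some n & (n <= 1)%N.
Proof.
move=> h; rewrite /krull_dim; case: xgetP => [d _ [n [-> [p pn] _]]|none].
  by exists n => //; exact: h pn.
have [[p p1]|no1] := pselect (exists p : nat -> prime_idealr R, prime_chain 1 p).
  by case: (none (Some 1%N)); exists 1%N; split=> //; exists p.
case: (none (Some 0%N)); exists 0%N; split=> //; first by exists (fun=> p0).
move=> [//|k] p pk; case: no1; exists p => i i0; apply: pk; exact: leq_trans i0 _.
Qed.

(** Quasi-unmixedness transfers the dimension bound from the quotient of the completion to [L].
    Membership in the maximal ideal is phrased as non-invertibility, since that ideal is only given
    existentially by [quasi_unmixed]. *)
Lemma quasi_unmixed_dim_le1 (L E : comNzRingType) (f : {rmorphism L -> E})
    (B : set E) (d x : L) (a : E) :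
  quasi_unmixed L -> injective f -> is_subring B -> range f `<=` B -> fg f B ->
  (forall b, B b -> exists l, f d * b = f l) ->
  (forall e, f d * e = 0 -> e = 0) -> (forall e, f x * e = 0 -> e = 0) ->
  B a -> (forall b, B b -> a * b <> 1) ->
  ~ (exists u, u * x = 1) ->
  (forall t, ~ (exists u, u * t = 1) -> exists N b, B b /\ f t ^+ N = a * b) ->
  forall k (p : nat -> prime_idealr L), prime_chain k p -> (k <= 1)%N.
Proof.
move=> [/noetherian_noeth nL [m locm qu]] finj rB AB [bs BE] dB rd rx Ba na mx ma.
have unitL := local_ring_unit nL locm.
have mE t : t \in m <-> ~ exists u, u * t = 1.
  split=> [mt [u ut]|nu]; last by apply/negPn/negP => /unitL.
  have := idealr1 m; rewrite -ut.
  by move/negbT/negP; apply; exact: idealMr.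
have [|t /mE /ma //|eps [neps epsP]] := idempotent_limit nL unitL finj rB AB BE dB rd _ rx Ba na.
  exact/mE.
have [P Pmin Pdim] := ex_minimal_prime_dim_le1 nL unitL ((mE x).2 mx) epsP neps.
have p0 : exists p : prime_idealr {ideal_quot P}, True.
  have [||||q [pq _ _ _]] := @prime_avoid {ideal_quot P} [set 0] [set 1].
  - exact: submod0.
  - by [].
  - by move=> _ _ -> ->; rewrite /= mulr1.
  - by move=> _ -> /eqP; rewrite oner_eq0.
  by have [p _] := prime_idealrP pq; exists p.
have [p _] := p0; have [n nE n1] := krull_dim_le1 p Pdim.
move=> k c ck; apply: leq_trans n1; apply: krull_dim_Some ck.
by rewrite -nE; symmetry; exact: qu.
Qed.

(** * Localization *)

Lemma localization_lift (A : comNzRingType) (S : multSet A) (R : comUnitRingType)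
    (g : {rmorphism A -> R}) : (forall s, s \in S -> g s \is a GRing.unit) ->
  exists h : {rmorphism localization S -> R},
    forall a, h (@Localization.tofrac A S a) = g a.
Proof.
move=> gS; pose h (z : localization S) : R := g (repr z).1 / g (sval (repr z).2).
(* [h] is computed on a chosen representative; this equation shows that the choice is immaterial. *)
have hE a s : h (Localization.frac a s) = g a / g (sval s).
  have [u Su] := Localization.repr_frac (a, s).
  rewrite -/(Localization.frac a s) /= => E.
  have us : g (sval s) \is a GRing.unit by apply: gS; exact: valP.
  have ur : g (sval (repr (Localization.frac a s)).2) \is a GRing.unit by apply: gS; exact: valP.
  rewrite /h; set r := repr _ in ur E *.
  have : g u * (g a * g (sval r.2) - g r.1 * g (sval s)) = 0.
    by rewrite -!rmorphM -rmorphB -rmorphM E rmorph0.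
  move=> /(congr1 ( *%R (g u)^-1)); rewrite mulKr ?gS// mulr0 => /eqP; rewrite subr_eq0 => /eqP E2.
  apply: (mulIr ur); rewrite divrK//; apply: (mulIr us).
  by rewrite -E2 mulrAC divrK.
have gu (s : {s : A | s \in S}) : g (sval s) \is a GRing.unit by apply: gS; exact: valP.
have hB : zmod_morphism h.
  move=> z w; have [a [s ->]] := Localization.fracP z.
  have [b [t ->]] := Localization.fracP w; rewrite !hE.
  have -> : Localization.frac a s - Localization.frac b t =
     Localization.frac (a * sval t + - b * sval s) (Localization.mul_den s t).
    rewrite -[LHS]/(Localization.add (Localization.frac a s)
      (Localization.opp (Localization.frac b t))).
    by rewrite Localization.fracN Localization.fracD.
  rewrite hE /= rmorphD !rmorphM rmorphN invrM//.
  have R6 (a' t' b' s' t1 s1 : R) : (a' * t' + - b' * s') * (t1 * s1) =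
    a' * s1 * (t' * t1) - b' * t1 * (s' * s1) by ring.
  by rewrite R6 !mulrV// !mulr1.
have hM : monoid_morphism h.
  split.
    rewrite -[1]/(Localization.frac 1 (Localization.one_den S)) hE /=.
    by rewrite mulrV ?gS ?mset1.
  move=> z w; have [a [s ->]] := Localization.fracP z.
  have [b [t ->]] := Localization.fracP w; rewrite !hE.
  have -> : Localization.frac a s * Localization.frac b t =
     Localization.frac (a * b) (Localization.mul_den s t).
    rewrite -[LHS]/(Localization.mul (Localization.frac a s) (Localization.frac b t)).
    by rewrite Localization.fracM.
  rewrite hE /= !rmorphM invrM//; ring.
pose K1 := GRing.isZmodMorphism.Build (localization S) R h hB.
pose K2 := GRing.isMonoidMorphism.Build (localization S) R h hM.
pose hh : {rmorphism localization S -> R} := HB.pack h K1 K2.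
exists hh => a; rewrite -[LHS]/(h (Localization.frac a (Localization.one_den S))) hE /=.
by rewrite rmorph1 divr1.
Qed.

Lemma localizationP (A : comNzRingType) (S : multSet A) :
  let t := @Localization.tofrac A S in
  [/\ forall s, s \in S -> t s \is a GRing.unit,
      forall z, exists a s, s \in S /\ z * t s = t a &
      forall a, t a = 0 -> exists2 s, s \in S & s * a = 0].
Proof.
split=> [s|z|a]; first exact: Localization.tofrac_unit.
  have [a [s ->]] := Localization.fracP z; exists a, (sval s); split; first exact: valP.
  by rewrite Localization.fracE divrK ?Localization.tofrac_unit//; exact: valP.
move=> /Localization.frac_eq[u Su] /=; rewrite mulr1 mul0r subr0 => E.
by exists u.
Qed.

Lemma localization_prime (A L : comNzRingType) (lam : {rmorphism A -> L}) (p q : set A) :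
  is_prime p -> (forall z, exists a t, ~ p t /\ z * lam t = lam a) ->
  (forall a, lam a = 0 -> exists2 t, ~ p t & t * a = 0) ->
  is_prime q -> q `<=` p ->
  exists r : prime_idealr L, forall a, lam a \in r <-> q a.
Proof.
move=> pp fracL kerL pq qp; have [[q0 qD qM] q1 qP] := pq; have [_ p1 pP] := pp.
pose r : set L := [set z | exists a t, [/\ q a, ~ p t & z * lam t = lam a]].
have rP a : r (lam a) <-> q a.
  split=> [[b [t [qb pt]]]|qa]; last by exists a, 1; rewrite rmorph1 mulr1.
  rewrite -rmorphM => /eqP; rewrite -subr_eq0 -rmorphB => /eqP/kerL[u pu E].
  have : q (u * t * a).
    have -> : u * t * a = u * (a * t - b) + u * b by ring.
    by rewrite E add0r; exact: qM.
  by move=> /qP[/qP[/qp|/qp]|].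
have pr : is_prime r.
  split; first split.
  - by rewrite -(rmorph0 lam); exact/rP.
  - move=> u v [a [t [qa pt E]]] [b [t' [qb pt' E']]].
    exists (a * t' + b * t), (t * t'); split.
    + by apply: qD; rewrite mulrC; exact: qM.
    + by case/pP.
    + rewrite rmorphD !rmorphM -E -E'; ring.
  - move=> u v [b [t [qb pt E]]]; have [c [t' [pt' E']]] := fracL u.
    exists (c * b), (t' * t); split; [exact: qM | by case/pP |].
    by rewrite !rmorphM -E -E' /=; ring.
  - by rewrite -(rmorph1 lam) => /rP.
  - move=> u v ruv; have [a [t [pt E]]] := fracL u; have [b [t' [pt' E']]] := fracL v.
    have : r (lam (a * b)).
      have [c [s [qc ps Es]]] := ruv; exists (c * t * t'), s; split=> //.
        by rewrite -mulrA mulrC; exact: qM.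
      by rewrite !rmorphM -E -E' -Es; ring.
    by move=> /rP/qP[qa|qb]; [left; exists a, t | right; exists b, t'].
have [R RE] := prime_idealrP pr; exists R => a.
by rewrite -rP -RE.
Qed.

(** [E] inverts the image in [Q] of the complement of [p]; it is the common overring in which the
    localizations of [A] and [B] at [p] are compared. *)
Lemma ex_localization_along (A : comNzRingType) (Q : comUnitRingType)
    (f : {rmorphism A -> Q}) (p : set A) : injective f -> is_prime p ->
  exists (E : comUnitRingType) (kap : {rmorphism Q -> E}),
    (forall t, ~ p t -> kap (f t) \is a GRing.unit) /\
    (forall z, kap z = 0 -> exists2 t, ~ p t & f t * z = 0).
Proof.
move=> finj [[p0 _ _] p1 pP].
pose S : {pred Q} := fun z => `[< exists2 t, ~ p t & z = f t >].
have SP z : z \in S <-> exists2 t, ~ p t & z = f t.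
  by rewrite unfold_in; split=> [/asboolP //|h]; exact/asboolP.
have S1 : 1 \in S by apply/SP; exists 1; rewrite ?rmorph1.
have SM : {in S &, forall s t, s * t \in S}.
  move=> _ _ /SP[t pt ->] /SP[t' pt' ->]; apply/SP; exists (t * t'); last by rewrite rmorphM.
  by case/pP.
have S0 : 0 \notin S.
  apply/negP => /SP[t pt] /esym; rewrite -(rmorph0 f) => /finj t0; by rewrite t0 in pt.
pose M := MultSet S1 SM S0.
have [kU _ kK] := localizationP M.
exists (localization M), (@Localization.tofrac Q M); split.
  by move=> t pt; apply: kU; apply/SP; exists t.
by move=> z /kK[_ /SP[t pt ->] E]; exists t.
Qed.

(** * Nonunit factors over minimal primes *)

Section Contract.
Variables (A : comNzRingType) (Q : comUnitRingType) (f : {rmorphism A -> Q}).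
Hypothesis finj : injective f.
Hypothesis fracQ : forall q : Q, exists a s, f s \is a GRing.unit /\ q = f a / f s.
Local Notation stage := (finite_ext f).

(* [lam : A -> L] and [kap : Q -> E] are the localizations at [p]. *)
Lemma quasi_unmixed_no_chain (L : comNzRingType) (E : comUnitRingType)
    (lam : {rmorphism A -> L}) (kap : {rmorphism Q -> E}) (io : {rmorphism L -> E})
    (p : set A) (x : A) (B : set Q) (a : Q) :
  quasi_unmixed L -> is_prime p ->
  (forall t, ~ p t -> exists u, u * lam t = 1) ->
  (forall z, exists a t, ~ p t /\ z * lam t = lam a) ->
  (forall a, lam a = 0 -> exists2 t, ~ p t & t * a = 0) ->
  (forall t, ~ p t -> kap (f t) \is a GRing.unit) ->
  (forall z, kap z = 0 -> exists2 t, ~ p t & f t * z = 0) ->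
  (forall c, io (lam c) = kap (f c)) ->
  stage B -> B a -> f x \is a GRing.unit -> p x ->
  (forall t b, B b -> f t = a * b -> p t) ->
  (forall g, p g -> exists t n b, [/\ ~ p t, B b & f (t * g ^+ n) = a * b]) ->
  forall k (c : nat -> prime_idealr L), prime_chain k c -> (k <= 1)%N.
Proof.
move=> quL pp lamU lamF lamK kapU kapK ioE sB Ba ux px Tp pT.
have [idp p1 pP] := pp; have [p0 pD pM] := idp.
have pt2 t t' : ~ p t -> ~ p t' -> ~ p (t * t') by move=> h h' /pP[].
have ptX t n : ~ p t -> ~ p (t ^+ n) by move=> h /(primeX pp).
have [rB AB [bs BE]] := sB; have [B1 BB BM] := rB.
have [d [ud dP]] := common_denominator fracQ sB.
(* The localization of [B] at [p], inside [E]. *)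
pose BL := [set e | exists b t, [/\ B b, ~ p t & e * kap (f t) = kap b]].
have kapB b : B b -> BL (kap b).
  by move=> Bb; exists b, 1; rewrite !rmorph1 mulr1.
have rBL : is_subring BL.
  split; first by rewrite -(rmorph1 kap); exact: kapB.
  - move=> u v [b [t [Bb pt E1]]] [b' [t' [Bb' pt' E2]]].
    exists (b * f t' - b' * f t), (t * t'); split; last 2 first.
    + exact: pt2.
    + by rewrite rmorphB !rmorphM -E1 -E2; ring.
    + by apply: BB; apply: BM => //; apply: AB; [exists t' | exists t].
  - move=> u v [b [t [Bb pt E1]]] [b' [t' [Bb' pt' E2]]].
    exists (b * b'), (t * t'); split; [exact: BM | exact: pt2 |].
    by rewrite !rmorphM -E1 -E2; ring.
have ioBL : range io `<=` BL.
  move=> _ [z _ <-]; have [c [t [pt zE]]] := lamF z.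
  by exists (f c), t; split=> //; [apply: AB; exists c | rewrite -!ioE -rmorphM zE].
have sBL : submod io BL by exact: bmod_submod ioBL (bmod_refl rBL).
have fBL : fg io BL.
  exists [seq kap b | b <- bs]; apply/seteqP; split; last first.
    apply: (lin_min sBL) => _ /mapP[b bbs ->]; apply: kapB.
    by rewrite BE; exact: lin_mem.
  move=> e [b [t [Bb pt eE]]]; have [u ut] := lamU t pt.
  have -> : e = io u * kap b.
    by rewrite -eE mulrCA -ioE -rmorphM ut rmorph1 mulr1.
  have [_ _ LM] := submod_lin io [seq kap b | b <- bs]; apply: LM.
  move: Bb; rewrite BE; elim: (bs) b {eE} => [_ ->|g s IH _ [c [v [_ sv ->]]]] /=.
    exact: rmorph0.
  exists (lam c), (kap v); split=> //; first exact: IH.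
  by rewrite rmorphD rmorphM ioE.
have ioinj : injective io.
  move=> z w zw; apply/eqP; rewrite -subr_eq0; apply/eqP.
  have : io (z - w) = 0 by rewrite rmorphB zw subrr.
  move: (z - w) => {zw}z {w} z0.
  have [c [t [pt zE]]] := lamF z.
  have : kap (f c) = 0 by rewrite -ioE -zE rmorphM z0 mul0r.
  move=> /kapK[t' pt' E0]; have {}E0 : t' * c = 0 by apply: finj; rewrite rmorphM E0 rmorph0.
  have [u ut] := lamU _ pt; have [u' ut'] := lamU _ pt'.
  have c0 : lam c = 0 by rewrite -[lam c]mul1r -ut' -mulrA -rmorphM E0 rmorph0 mulr0.
  by rewrite -[z]mulr1 -ut mulrCA zE c0 mulr0.
have lam_nonunit c : p c -> ~ exists u, u * lam c = 1.
  move=> pc [u uc]; have [c' [t [pt uE]]] := lamF u.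
  have : lam (c' * c - t) = 0.
    by rewrite rmorphB rmorphM -uE; apply/eqP; rewrite subr_eq0 mulrAC uc mul1r.
  move=> /lamK[t' pt' E0]; apply: (pt2 _ _ pt' pt).
  have -> : t' * t = (t' * c') * c - t' * (c' * c - t) by ring.
  by rewrite E0 subr0; exact: pM.
apply: (@quasi_unmixed_dim_le1 L E io BL (lam d) (lam x) (kap a)) => //.
- move=> e [b [t [Bb pt eE]]]; have [l _ lE] := dP b Bb; have [u ut] := lamU t pt.
  exists (lam l * u).
  have -> : e = io u * kap b.
    by rewrite -eE mulrCA -ioE -rmorphM ut rmorph1 mulr1.
  by rewrite ioE rmorphM ioE mulrCA -rmorphM -lE mulrC.
- move=> e; rewrite ioE => e0.
  by rewrite -[e](mulKr (rmorph_unit kap ud)) e0 mulr0.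
- move=> e; rewrite ioE => e0.
  by rewrite -[e](mulKr (rmorph_unit kap ux)) e0 mulr0.
- exact: kapB.
(* Clearing denominators in an inverse of [a] would give an element of [aB] contracting to one
   outside [p], against [Tp]. *)
- move=> e [b [t [Bb pt eE]]] ae.
  have : kap (a * b - f t) = 0.
    by rewrite rmorphB rmorphM -eE mulrA ae mul1r subrr.
  move=> /kapK[t' pt' E0]; apply: (pt2 _ _ pt' pt); apply: (Tp _ (f t' * b)).
    by apply: BM => //; apply: AB; exists t'.
  move: E0; rewrite mulrBr => /eqP; rewrite subr_eq0 rmorphM => /eqP <-.
  exact: mulrCA.
- exact: lam_nonunit.
(* A nonunit of [L] has its numerator in [p], and [pT], the minimality of [p] over the contraction
   of [aB], puts a power of it in [a BL]. *)
- move=> z nz; have [g [t [pt zE]]] := lamF z.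
  have pg : p g.
    apply: contrapT => /lamU[u ug]; apply: nz; exists (u * lam t).
    by rewrite -mulrA [lam t * z]mulrC zE.
  have [t' [n [b [pt' Bb gE]]]] := pT g pg.
  have uv : kap (f (t' * t ^+ n)) \is a GRing.unit by apply: kapU; apply: pt2 => //; exact: ptX.
  exists n, (kap b / kap (f (t' * t ^+ n))); split.
    by exists b, (t' * t ^+ n); split=> //; [apply: pt2 => //; exact: ptX | rewrite divrK].
  apply: (mulIr uv); rewrite -[RHS]mulrA divrK// -rmorphM -gE -!ioE -rmorphXn -rmorphM.
  congr (io _); rewrite !rmorphM !rmorphXn -zE exprMn; ring.
Qed.

Lemma chain2_le1 (R : comNzRingType) (r0 r1 r2 : prime_idealr R) :
  (forall k (c : nat -> prime_idealr R), prime_chain k c -> (k <= 1)%N) ->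
  [set` r0] `<` [set` r1] -> [set` r1] `<` [set` r2] -> False.
Proof.
move=> h r01 r12; pose c i := if i is 0%N then r0 else if i is 1%N then r1 else r2.
by have /h : prime_chain 2 c by move=> [|[|//]] _.
Qed.

(* The only use of the dimension hypothesis: a minimal prime of the contraction of
   [aB] that is not minimal over [x] is the end of a chain of primes of length 2. *)
Lemma contracted_minimal_prime (x : A) (B : set Q) (a : Q) :
  (krull_dim A = Some 1%N \/
     forall p : prime_idealr A, quasi_unmixed (localization_at p)) ->
  f x \is a GRing.unit -> stage B -> B a -> a \is a GRing.unit -> ~ B a^-1 ->
  (exists2 b, B b & f x = a * b) ->
  exists2 p, minimal_over x p & forall t b, B b -> f t = a * b -> p t.
Proof.
move=> dimA ux sB Ba ua nBa [bx Bbx xE].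
have [rB AB _] := sB; have [B1 BB BM] := rB.
pose T := [set t | exists2 b, B b & f t = a * b].
have idT : ideal T.
  split.
  - by exists 0; [exact: subring0 | rewrite rmorph0 mulr0].
  - move=> t t' [b Bb E1] [b' Bb' E2]; exists (b + b'); first exact: subringD.
    by rewrite rmorphD E1 E2 mulrDr.
  - move=> s t [b Bb E1]; exists (f s * b); first by apply: BM => //; apply: AB; exists s.
    by rewrite rmorphM E1 mulrCA.
have [|_ -> [b Bb]|p [pp Tp _ pT]] := @prime_avoid A T [set 1] idT erefl.
- by move=> _ _ -> ->; rewrite /= mulr1.
- rewrite rmorph1 => ab; apply: nBa.
  by have -> : a^-1 = b by rewrite -[LHS]mulr1 ab mulKr.
have px : p x by apply: Tp; exists bx.
have pTb t b : B b -> f t = a * b -> p t by move=> Bb E; apply: Tp; exists b.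
have [pmin|npmin] := pselect (minimal_over x p); first by exists p.
exfalso.
have [q [pq qx qp pnq]] : exists q, [/\ is_prime q, q x, q `<=` p & ~ p `<=` q].
  apply: contrapT => noq; apply: npmin; split=> // q pq qx qp.
  by apply: contrapT => pnq; apply: noq; exists q.
have [idq q1 qM] := pq; have [q00 _ _] := idq.
(* A prime disjoint from [S] lies in [q] and omits [x]; it exists because [x] is regular. It is the
   bottom of the chain of length 2. *)
pose S := [set z | exists s n, ~ q s /\ z = s * x ^+ n].
have [||||q0 [pq0 _ Sq0 _]] := @prime_avoid A [set 0] S.
- exact: submod0.
- by exists 1, 0%N; rewrite mul1r.
- move=> _ _ [s [n [qs ->]]] [s' [n' [qs' ->]]]; exists (s * s'), (n + n')%N; split.
    by case/qM.
  by rewrite exprD; ring.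
- move=> _ [s [n [qs ->]]] /(congr1 f); rewrite rmorphM rmorphXn rmorph0.
  move=> E; apply: qs; have : f s = 0.
    by rewrite -[f s](mulrK (unitrX n ux)) E mul0r.
  by rewrite -(rmorph0 f) => /finj ->.
have q0x : ~ q0 x by apply: Sq0; exists 1, 1%N; rewrite mul1r expr1.
have q0q : q0 `<=` q.
  move=> z q0z; apply: contrapT => qz; apply: (Sq0 z) => //.
  by exists z, 0%N; rewrite mulr1.
have [g pg qg] : exists2 g, p g & ~ q g by move/nonsubset: pnq => [g [? ?]]; exists g.
case: dimA => [dim1|quA].
  have [r0 r0E] := prime_idealrP pq0; have [r1 r1E] := prime_idealrP pq.
  have [r2 r2E] := prime_idealrP pp.
  apply: (@chain2_le1 A r0 r1 r2 (krull_dim_Some dim1)); rewrite ?r0E ?r1E ?r2E.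
    by split=> // /(_ x qx).
  by split.
have [P PE] := prime_idealrP pp.
have PEm t : t \in prime_mset P <-> ~ p t.
  by rewrite -PE /= inE /=; split=> [/negP //|/negP].
have [lamU0 lamF0 lamK0] := localizationP (prime_mset P).
pose lam : {rmorphism A -> localization_at P} := @Localization.tofrac A (prime_mset P).
have lamU t : ~ p t -> exists u, u * lam t = 1.
  move=> /PEm/lamU0 ut; exists (lam t)^-1; exact: mulVr.
have lamF z : exists a t, ~ p t /\ z * lam t = lam a.
  by have [c [t [/PEm pt zE]]] := lamF0 z; exists c, t.
have lamK c : lam c = 0 -> exists2 t, ~ p t & t * c = 0.
  by move=> /lamK0[t /PEm pt tc]; exists t.
have [E [kap [kapU kapK]]] := ex_localization_along finj pp.
have [|io ioE] := @localization_lift A (prime_mset P) E (kap \o f).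
  by move=> t /PEm; exact: kapU.
have h := @quasi_unmixed_no_chain _ E lam kap io p x B a (quA P) pp lamU lamF lamK
  kapU kapK ioE sB Ba ux px pTb.
have {}h := h (fun g pg => let: ex_intro t (ex_intro n (conj pt (ex_intro2 b Bb E1))) := pT g pg in
  ex_intro _ t (ex_intro _ n (ex_intro _ b (And3 pt Bb E1)))).
have [r0 r0E] := localization_prime pp lamF lamK pq0 (subset_trans q0q qp).
have [r1 r1E] := localization_prime pp lamF lamK pq qp.
have [r2 r2E] := localization_prime pp lamF lamK pp (fun _ h => h).
have sub (r r' : prime_idealr (localization_at P)) (s s' : set A) :
    (forall c, lam c \in r <-> s c) -> (forall c, lam c \in r' <-> s' c) ->
    s `<=` s' -> [set` r] `<=` [set` r'].
  move=> rE r'E ss' z /= rz; have [c [t [pt zE]]] := lamF z.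
  have [u ut] := lamU t pt; have -> : z = u * lam c.
    by rewrite -zE mulrCA ut mulr1.
  by apply: idealMr; apply/r'E/ss'/rE; rewrite -zE mulrC; exact: idealMr.
apply: (@chain2_le1 _ r0 r1 r2 h); split.
- exact: sub r0E r1E q0q.
- by move=> /(_ (lam x)) /= h'; apply/q0x/r0E/h'/r1E.
- exact: sub r1E r2E qp.
- by move=> /(_ (lam g)) /= h'; apply/qg/r1E/h'/r2E.
Qed.

End Contract.

(** * Blow-up chains *)

Section Main.
Variables (A : comNzRingType) (Q : comUnitRingType) (f : {rmorphism A -> Q}).
Hypothesis nA : noeth A.
Hypothesis finj : injective f.
Hypothesis nzd_unit : forall (B : set Q) x,
  range f `<=` B -> nonzerodivisors B x -> x \is a GRing.unit.
Hypothesis fracQ : forall q : Q, exists a s, f s \is a GRing.unit /\ q = f a / f s.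
Local Notation stage := (finite_ext f).
Local Notation R := (range f).

Definition chain_step (B B1 : set Q) : Prop :=
  (B = integral_elements B /\ B1 = integral_elements B) \/
  (B <> integral_elements B /\
   exists M, [/\ MaxLambda B M, (2 <= mu B M)%N & B1 = blowup B M]).

Definition step_chain (C : nat -> set Q) : Prop :=
  C 0%N = R /\ forall n, chain_step (C n) (C n.+1).

Definition has_reduction (M : set Q) : Prop := exists2 a, M a & smul M M = scale a M.

(** The rings that occur in blow-up chains, without the rest of the chain, so that properties
    propagate by induction on single steps. *)
Inductive reach : set Q -> Prop :=
| reach_base : reach R
| reach_step B B1 : reach B -> chain_step B B1 -> reach B1.

Lemma stage_step B B1 : stage B -> chain_step B B1 -> stage B1.
Proof.
move=> sB [[BI ->]|[_ [M [MM _ ->]]]]; first by rewrite -BI.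
have [w [Bw uw -> _]] := MaxLambdaP nzd_unit sB MM.
by have [] := stage_blowup nA sB Bw uw.
Qed.

Lemma stage_reach B : reach B -> stage B.
Proof.
elim=> [|C C1 _ sC]; first exact: finite_ext_range.
exact: stage_step.
Qed.

Lemma reach_chain C n : step_chain C -> reach (C n).
Proof.
move=> [C0 CS]; elim: n => [|n IH]; first by rewrite C0; exact: reach_base.
exact: reach_step IH (CS n).
Qed.

Lemma ex_step B : stage B -> exists B1, chain_step B B1.
Proof.
move=> sB; have [BI|nBI] := pselect (B = integral_elements B).
  by exists (integral_elements B); left.
have [|M MM mu2] := nonprincipal_MaxLambda nzd_unit nA sB _ nBI.
  move=> q; have [a [s [us qE]]] := fracQ q; have [_ AB _] := sB.
  by exists (f a), (f s); split=> //; apply: AB; [exists a | exists s].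
by exists (blowup B M); right; split=> //; exists M.
Qed.

(** A finite sequence of steps extends to an infinite chain because every stage has a next step.
    Hypotheses about all chains therefore apply to each reachable ring and are not vacuous. *)
Lemma chain_through B : reach B -> exists C n, step_chain C /\ C n = B.
Proof.
move=> rB; have [C [n [C0 CS Cn]]] : exists C n, [/\ C 0%N = R,
    forall i, (i < n)%N -> chain_step (C i) (C i.+1) & C n = B].
  elim: rB => [|D D1 _ [C [n [C0 CS Cn]]] DD1]; first by exists (fun=> R), 0%N.
  exists (fun i => if (i <= n)%N then C i else D1), n.+1; split=> //; last by rewrite ltnn.
  move=> i; rewrite ltnS => ile; rewrite ile.
  by case: ltnP => ni; [exact: CS | have -> : i = n by apply/eqP; rewrite eqn_leq ile];
    rewrite Cn.
have [u u0 uS] := ex_sequence (R := fun X Y : {X | stage X} => chain_step (sval X) (sval Y))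
   (exist _ B (stage_reach rB))
   (fun X => let: ex_intro Y XY := ex_step (svalP X) in
      ex_intro _ (exist _ Y (stage_step (svalP X) XY)) XY).
exists (fun i => if (i < n)%N then C i else sval (u (i - n)%N)), n.
have Cu : C n = sval (u 0%N) by rewrite u0.
split; last by rewrite ltnn subnn -Cu.
split; first by case: posnP Cu => [-> //|//]; rewrite subnn => <-.
move=> i; case: (ltngtP i.+1 n) => [lt|gt|eqn].
- by apply: CS; exact: ltnW.
- by rewrite subSn//; exact: uS.
- by rewrite eqn subnn -Cu -eqn; apply: CS; rewrite -eqn.
Qed.

Lemma warf_step B B1 : stage B -> warf B -> chain_step B B1 -> warf B1.
Proof.
move=> sB wB [[BI ->]|[_ [M [MM _ ->]]]]; first by rewrite -BI.
have [w [Bw uw -> _]] := MaxLambdaP nzd_unit sB MM; have [rB _ _] := sB.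
rewrite (blowupE rB (bmod_cl sB uw) (@cl_sub _ B w) uw (warf_reduction nzd_unit sB wB Bw uw)).
exact: (warf_colon nzd_unit nA sB wB Bw uw).
Qed.

Lemma warf_reach B : warf R -> reach B -> warf B.
Proof.
move=> wR; elim=> [//|C C1 rC wC]; apply: warf_step => //; exact: stage_reach.
Qed.

Lemma warf_MaxLambda B M : stage B -> warf B -> MaxLambda B M ->
  warf (colon M M) /\ has_reduction M.
Proof.
move=> sB wB MM; have [w [Bw uw -> _]] := MaxLambdaP nzd_unit sB MM; split.
  exact: (warf_colon nzd_unit nA sB wB Bw uw).
by exists w; [exact: (cl_mem sB Bw uw) | exact: (warf_reduction nzd_unit sB wB Bw uw)].
Qed.

Lemma warf_of_MaxLambda B : stage B ->
  (forall M, MaxLambda B M -> warf (colon M M) /\ has_reduction M) -> warf B.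
Proof.
move=> sB hB; apply/(warfP nzd_unit sB) => x y z Bx ux By Bz Iy Iz.
have [rB AB _] := sB; have [B1 BB BM] := rB.
have [Bx'|nBx] := pselect (B x^-1); first by apply: (BM) => //; exact: BM.
have [M MM xM] := ex_MaxLambda nzd_unit nA sB Bx ux nBx.
have [wM [a Ma Mred]] := hB M MM.
have [w [Bw uw ME _]] := MaxLambdaP nzd_unit sB MM.
rewrite ME in xM Ma Mred wM.
have [ua Cx Cy Cz] := step_back sB Bw uw Ma Mred Bx ux xM By Bz Iy Iz; apply.
have [sC _] := stage_colon nA sB (bmod_cl sB uw) (@cl_sub _ B w) Ma ua.
have fr v : (v / a) / (x / a) = v / x.
  have R4 (v0 a1 a0 x1 : Q) : v0 * a1 * (a0 * x1) = v0 * x1 * (a0 * a1) by ring.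
  by rewrite invrM ?unitrV// invrK R4 mulrV ?mulr1.
apply: (warfP nzd_unit sC).1 => //; rewrite ?fr//.
by rewrite unitrM ux unitrV.
Qed.

Lemma warf_equivalences :
  [/\ warf R <-> (forall M, MaxLambda R M -> warf (colon M M) /\ has_reduction M),
      warf R <-> (forall C, step_chain C -> forall n, warf (C n)) &
      warf R -> forall C, step_chain C -> forall n N, MaxLambda (C n) N ->
        has_reduction N].
Proof.
have sR := finite_ext_range f; split.
- by split=> [wR M|]; [exact: warf_MaxLambda | exact: warf_of_MaxLambda].
- split=> [wR C CC n|h]; first by apply: warf_reach => //; exact: reach_chain.
  (* The converse reads off the first term of a chain, so it needs a chain to exist. *)
  have [C [n [CC _]]] := chain_through reach_base.
  by have := h C CC 0%N; case: CC => ->.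
- move=> wR C CC n N NM; have rC := reach_chain n CC.
  by have [] := warf_MaxLambda (stage_reach rC) (warf_reach wR rC) NM.
Qed.

Lemma warf_of_chain_reductions :
  (krull_dim A = Some 1%N \/
     forall p : prime_idealr A, quasi_unmixed (localization_at p)) ->
  (forall C, step_chain C -> forall n N, MaxLambda (C n) N -> has_reduction N) ->
  warf R.
Proof.
move=> dimA hC; have sR := finite_ext_range f.
apply/(warfP nzd_unit sR) => _ y z [x _ <-] ux Ry Rz Iy Iz.
apply: (warf_of_reductions nA finj nzd_unit fracQ ux _ (good := reach)) => //.
- move=> B a sB Ba ua nBa xE; exact: (contracted_minimal_prime finj fracQ dimA ux sB Ba ua nBa xE).
- exact: stage_reach.
- move=> B M rB MM; have [C [n [CC CE]]] := chain_through rB.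
  by apply: (hC C CC n); rewrite CE.
- move=> B M rB nBI MM mu2; apply: (reach_step rB); right; split=> //.
  by exists M.
- exact: reach_base.
Qed.

End Main.

(** The four properties of the total ring of fractions on which the argument rests. *)
Lemma total_frac_embedding (A : comNzRingType) :
  exists f : {rmorphism A -> total_frac A}, [/\ range f = base_ring A, injective f,
    forall (B : set (total_frac A)) x,
      range f `<=` B -> nonzerodivisors B x -> x \is a GRing.unit &
    forall q : total_frac A, exists a s, f s \is a GRing.unit /\ q = f a / f s].
Proof.
exists (@Localization.tofrac A (regular_mset A)); split.
- by [].
- have [_ _ kerf] := localizationP (regular_mset A).
  move=> a b ab; apply/eqP; rewrite -subr_eq0; apply/eqP.
  have [|s /asboolP rs] := kerf (a - b); last exact: rs.
  by rewrite rmorphB ab subrr.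
- exact: regular_unit.
- move=> q; have [a [s ->]] := Localization.fracP q; exists a, (sval s).
  by split; [exact/Localization.tofrac_unit/valP | exact: Localization.fracE].
Qed.

Theorem theorem1p7 (A : comNzRingType) (noethA : noetherian A) :
  let R := base_ring A in
  let cond1 := weakly_Arf R in
  let cond2 := forall M, MaxLambda R M ->
    weakly_Arf (colon M M) /\ principal_reduction M in
  let cond3 := forall C : nat -> set (total_frac A), blowup_chain C ->
    forall n, weakly_Arf (C n) in
  let cond4 := forall C : nat -> set (total_frac A), blowup_chain C ->
    forall n N, MaxLambda (C n) N -> principal_reduction N in
  [/\ cond1 <-> cond2, cond2 <-> cond3, cond3 -> cond4 &
      (krull_dim A = Some 1%N \/
       forall p : prime_idealr A, quasi_unmixed (localization_at p)) ->
      cond4 -> cond1].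
Proof.
have [f [fE finj nzdu fracQ]] := total_frac_embedding A.
have nA := noetherian_noeth noethA.
have [h12 h13 h14] := warf_equivalences nA nzdu fracQ.
have h41 := warf_of_chain_reductions nA finj nzdu fracQ.
rewrite /step_chain fE in h12 h13 h14 h41.
move=> R cond1 cond2 cond3 cond4.
have e12 : cond1 <-> cond2 by exact: h12.
have e13 : cond1 <-> cond3 by exact: h13.
split=> //.
- by rewrite -e12.
- by move=> /e13 c1; exact: h14.
Qed.
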